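(* Let $n\ge 1$ be an integer and let $K$ be the knot type of the $2n$-twist knot $T_{2n}$. For every $\epsilon>0$, the knot type $K$ contains a folded ribbon knot $K_w$ with folded ribbonlength $\mathrm{Rib}(K_w)=8\sqrt{3}+2+\epsilon$.
   Context: The twist knot $T_m$ ($m\ge1$), also called the $m$-twist knot, is constructed from two strands twisted around one another with $m$ half-twists whose ends are joined by a clasp; the orientation of the clasp is chosen so that the resulting standard knot diagram is alternating (so $T_1$ is a trefoil and $T_2$ is the figure-8 knot). A folded ribbon knot $K_w$ of width $w>0$ is obtained from a polygonal knot diagram $K$ in the plane (a closed polygon with finitely many straight edges and crossing information; edges may overlap in projection) by placing two lines parallel to each edge at distance $w/2$, one on each side. At each vertex with fold angle $\theta\in[0,\pi]$ (the angle between the two adjacent edges) a fold line is added that is centered at the vertex and perpendicular to the bisector of the fold angle; the fold line acts as a mirror reflecting the adjacent edges' ribbon strips into each other. The result is required to be a piecewise-linear immersion into the plane of an embedded (possibly knotted) Möbius band or annulus, with singularities exactly the fold lines, together with continuous over/under (layering) information consistent with the crossing information of $K$. A knot type contains $K_w$ if the diagram $K$ represents that knot type. The folded ribbonlength is $\mathrm{Rib}(K_w)=\mathrm{Len}(K)/w$. *)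

(* Defs.v *)
From HB Require Import structures.
From mathcomp Require Import all_boot all_order all_algebra.
From mathcomp Require Import all_classical all_reals all_analysis.

Set Implicit Arguments.
Unset Strict Implicit.
Unset Printing Implicit Defensive.

Import Order.TTheory GRing.Theory Num.Theory.
Import numFieldNormedType.Exports.

Local Open Scope classical_set_scope.
Local Open Scope ring_scope.

Notation plane R := (R * R)%type.
Notation space R := ((R * R) * R)%type.

(* The library norm on products is the sup norm; lengths and angles below are
   Euclidean, hence these explicit operations.  The product topology used for
   continuity is the usual topology of R^2 and R^3. *)
Definition dot (R : realType) (p q : plane R) : R := p.1 * q.1 + p.2 * q.2.

Definition cross (R : realType) (p q : plane R) : R := p.1 * q.2 - p.2 * q.1.

Definition enorm (R : realType) (p : plane R) : R := Num.sqrt (dot p p).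

Definition segment (R : realType) (V : lmodType R) (a b : V) : set V :=
  [set x | exists2 t : R, 0 <= t <= 1 & x = a + t *: (b - a)].

(* Some ambient isotopy H of R^3 moves A to B; G t is the inverse of H t. *)
Definition ambient_isotopic (R : realType) (A B : set (space R)) : Prop :=
  exists H G : R * space R -> space R,
    [/\ {within `[0, 1]%classic `*` setT, continuous H},
        {within `[0, 1]%classic `*` setT, continuous G},
        (forall t : R, 0 <= t <= 1 -> forall x,
           G (t, H (t, x)) = x /\ H (t, G (t, x)) = x),
        (forall x, H (0, x) = x) &
        (fun x => H (1, x)) @` A = B].

(* A closed polygon in the plane with cyclically ordered vertices; edge i runs
   from vertex i to vertex (ordS i).  [over i j p] says that at the common
   point p edge i passes over edge j; edges may overlap in segments, so p is
   not determined by i and j. *)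
Record knot_diagram (R : realType) := KnotDiagram {
  nedges : nat;
  vertex : 'I_nedges -> plane R;
  over : 'I_nedges -> 'I_nedges -> plane R -> Prop;
  vertex_neq : forall i, vertex (ordS i) != vertex i }.

Section Diagram.
Variables (R : realType) (D : knot_diagram R).
Local Notation I := 'I_(nedges D).
Implicit Types (i j : I) (p : plane R) (w : R) (h : I -> plane R -> R).

Definition edge i : set (plane R) := segment (vertex i) (vertex (ordS i)).

Definition edge_length i : R := enorm (vertex (ordS i) - vertex i).

Definition length : R := \sum_i edge_length i.

Definition direction i : plane R :=
  (edge_length i)^-1 *: (vertex (ordS i) - vertex i).

(* A point of the abstract closed curve is a pair (i, p) with p on edge i, up
   to identification of the end of each edge with the start of the next. *)
Definition same_curve_point i j p : Prop :=
  [\/ i = j, j = ordS i /\ p = vertex j | i = ordS j /\ p = vertex i].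

(* The knots in R^3 with diagram D are the simple closed curves that project
   onto the polygon, the heights h realizing the crossing information. *)
Definition is_lift h : Prop :=
  [/\ (forall i, {within edge i, continuous (h i)}),
      (forall i, h i (vertex (ordS i)) = h (ordS i) (vertex (ordS i))) &
      (forall i j p, edge i p -> edge j p -> ~ same_curve_point i j p ->
         h i p != h j p /\ (over i j p <-> h j p < h i p))].

Definition lifted_curve h : set (space R) :=
  [set x | exists2 i, edge i x.1 & x.2 = h i x.1].

Definition represents (K : set (space R)) : Prop :=
  exists2 h, is_lift h & ambient_isotopic (lifted_curve h) K.

(* At vertex i the edges leave in the directions - direction (ord_pred i) and
   direction i.  The bisector of the fold angle has the direction of their sum,
   and both adjacent strips lie on the same side of the fold line.  When the
   fold angle is pi this sum vanishes: there is no fold line, and the ribbon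
   continues straight across the perpendicular to the edge.
   [start_normal i] and [end_normal i] are the normals, pointing into strip i,
   of the lines that bound it at vertex i and at vertex (ordS i). *)
Definition start_normal i : plane R :=
  if direction i == direction (ord_pred i) then direction i
  else direction i - direction (ord_pred i).

Definition end_normal i : plane R :=
  if direction (ordS i) == direction i then - direction i
  else direction (ordS i) - direction i.

Definition on_start_line i p : Prop := dot (p - vertex i) (start_normal i) = 0.

Definition on_end_line i p : Prop :=
  dot (p - vertex (ordS i)) (end_normal i) = 0.

Definition within_width w i p : Prop :=
  `|cross (direction i) (p - vertex i)| <= w / 2.

Definition strip w i : set (plane R) :=
  [set p | [/\ within_width w i p,
               0 <= dot (p - vertex i) (start_normal i) &
               0 <= dot (p - vertex (ordS i)) (end_normal i)]].

(* A point of the abstract band is a pair (i, p) with p in strip i, up to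
   identification of consecutive strips along the line at their common vertex.
   Each fold exchanges the two sides of the edge, so the band is a Moebius band
   or an annulus according to the parity of the number of folds. *)
Definition same_band_point i j p : Prop :=
  [\/ i = j, j = ordS i /\ on_start_line j p
           | i = ordS j /\ on_start_line i p].

End Diagram.

(* The planar map of the band is the inclusion of each strip, which is an
   immersion off the fold lines as soon as the two ends of a strip are disjoint.
   The layering is carried by continuous heights that make
   (i, p) |-> (p, height i p) an embedding of the band in R^3: at p, strip i
   lies over strip j when height j p < height i p. *)
Record folded_ribbon_knot (R : realType) := FoldedRibbonKnot {
  diagram : knot_diagram R;
  width : R;
  height : 'I_(nedges diagram) -> plane R -> R;
  width_gt0 : 0 < width;
  ends_disjoint : forall (i : 'I_(nedges diagram)) p, within_width width i p ->
    ~ (on_start_line i p /\ on_end_line i p);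
  height_continuous : forall i,
    {within strip width i, continuous (height i)};
  height_glued : forall (i : 'I_(nedges diagram)) p,
    strip width i p -> strip width (ordS i) p -> on_start_line (ordS i) p ->
    height i p = height (ordS i) p;
  height_embedded : forall (i j : 'I_(nedges diagram)) p,
    strip width i p -> strip width j p ->
    ~ same_band_point i j p -> height i p != height j p;
  height_over : forall (i j : 'I_(nedges diagram)) p, edge i p -> edge j p ->
    ~ same_curve_point i j p -> over i j p <-> height j p < height i p }.

Definition ribbonlength (R : realType) (K : folded_ribbon_knot R) : R :=
  length (diagram K) / width K.

(* The m-twist knot.  The two twisted strands occupy [0, m] x [0, 1]: over
   [k, k + 1] they are the two diagonals of a square, the rising one passing
   over.  Above them two hooks are clasped: the one from the left has its tip at
   (1, 3) and the one from the right at (0, 3), crossing at (1/2, 5/2), where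
   the left hook is over, and at (1/2, 7/2), where the right hook is over.  This
   is the choice of clasp that makes the diagram alternating.  Over-strands are
   raised to height z at the crossing and everything else is at height 0.
   The two signs of z give the two mirror images. *)
Section TwistKnot.
Variable R : realType.

Definition flat_edge (a b : plane R) : set (space R) := segment (a, 0) (b, 0).

Definition raised_edge (z : R) (a b : plane R) : set (space R) :=
  let c := (2^-1 *: (a + b), z) in segment (a, 0) c `|` segment c (b, 0).

Definition half_twist (z : R) (k : nat) : set (space R) :=
  raised_edge z (k%:R, 0) (k.+1%:R, 1) `|` flat_edge (k%:R, 1) (k.+1%:R, 0).

Definition clasp (z : R) : set (space R) :=
  (flat_edge (0, 4) (1, 3) `|` raised_edge z (1, 3) (0, 2)) `|`
  (raised_edge z (1, 4) (0, 3) `|` flat_edge (0, 3) (1, 2)).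

Definition closing_arcs (m : nat) : set (space R) :=
  (flat_edge (0, 1) (0, 2) `|`
   (flat_edge (0, 0) (-1, 2) `|` flat_edge (-1, 2) (0, 4))) `|`
  (flat_edge (m%:R, 1) (1, 2) `|`
   (flat_edge (m%:R, 0) (m%:R + 1, 2) `|` flat_edge (m%:R + 1, 2) (1, 4))).

Definition twist_knot (mirror : bool) (m : nat) : set (space R) :=
  let z := if mirror then -1 else 1 in
  (\bigcup_(k in `I_m) half_twist z k) `|` (clasp z `|` closing_arcs m).

End TwistKnot.

(* Main.v *)
Require Import Defs.
From mathcomp Require Import all_boot all_order all_algebra.
From mathcomp Require Import all_classical all_reals all_analysis.
From mathcomp Require Import zify ring lra.
Set Implicit Arguments.
Unset Strict Implicit.
Unset Printing Implicit Defensive.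
Import Order.TTheory GRing.Theory Num.Theory.
Import numFieldNormedType.Exports.
Local Open Scope classical_set_scope.
Local Open Scope ring_scope.

Section Cont.
Context {R : realType} {T : topologicalType}.
Implicit Types f g : T -> R.

Lemma contD f g : continuous f -> continuous g -> continuous (fun x => f x + g x).
Proof. by move=> cf cg x; apply: cvgD; [exact: cf | exact: cg]. Qed.

Lemma contN f : continuous f -> continuous (fun x => - f x).
Proof. by move=> cf x; apply: cvgN; exact: cf. Qed.

Lemma contM f g : continuous f -> continuous g -> continuous (fun x => f x * g x).
Proof. by move=> cf cg x; apply: cvgM; [exact: cf | exact: cg]. Qed.

Lemma cont_max f g : continuous f -> continuous g ->
  continuous (fun x => Num.max (f x) (g x)).
Proof. by move=> cf cg x; apply: (@continuous_max R T f g x); [exact: cf | exact: cg]. Qed.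

Lemma cont_min f g : continuous f -> continuous g ->
  continuous (fun x => Num.min (f x) (g x)).
Proof. by move=> cf cg x; apply: (@continuous_min R T f g x); [exact: cf | exact: cg]. Qed.

Lemma cont_norm f : continuous f -> continuous (fun x => `|f x|).
Proof. by move=> cf x; apply: cvg_norm; exact: cf. Qed.

Lemma cont_comp (h : R -> R) f : continuous h -> continuous f ->
  continuous (fun x => h (f x)).
Proof. by move=> ch cf x; apply: continuous_comp; [exact: cf | exact: ch]. Qed.
End Cont.

Lemma cont_pair (T U V : topologicalType) (f : T -> U) (g : T -> V) :
  continuous f -> continuous g -> continuous (fun x => (f x, g x)).
Proof. by move=> cf cg x; apply: cvg_pair; [exact: cf | exact: cg]. Qed.

Lemma cont_fst (T U V : topologicalType) (f : T -> U * V) :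
  continuous f -> continuous (fun x => (f x).1).
Proof. by move=> cf x; apply: continuous_comp; [exact: cf | exact: cvg_fst]. Qed.

Lemma cont_snd (T U V : topologicalType) (f : T -> U * V) :
  continuous f -> continuous (fun x => (f x).2).
Proof. by move=> cf x; apply: continuous_comp; [exact: cf | exact: cvg_snd]. Qed.

Lemma cont_cst (T U : topologicalType) (c : U) : continuous (fun _ : T => c).
Proof. exact: cst_continuous. Qed.

Lemma cont_id (T : topologicalType) : continuous (fun x : T => x).
Proof. by move=> x; exact: cvg_id. Qed.

Lemma cont_o (T U V : topologicalType) (g : U -> V) (f : T -> U) :
  continuous g -> continuous f -> continuous (fun x => g (f x)).
Proof. by move=> cg cf x; apply: continuous_comp; [exact: cf | exact: cg]. Qed.

Ltac cont1 :=
  lazymatch goal with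
  | |- continuous ?F =>
    lazymatch F with
    | (fun x => x) => exact: cont_id
    | (fun _ => ?c) => exact: cont_cst
    | (fun x => (_, _)) => apply: cont_pair
    | (fun x => (_).1) => apply: cont_fst
    | (fun x => (_).2) => apply: cont_snd
    | (fun x => _ + _) => apply: contD
    | (fun x => - _) => apply: contN
    | (fun x => _ * _) => apply: contM
    | (fun x => Num.max _ _) => apply: cont_max
    | (fun x => Num.min _ _) => apply: cont_min
    | (fun x => `|_|) => apply: cont_norm
    | (fun x => ?h x) => assumption
    | (fun x => ?h (@?f x)) => apply: (@cont_o _ _ _ h f)
    | (fun x => _) => fail
    | _ => first [assumption | change (continuous (fun x => F x))]
    end
  end.
Ltac cont := repeat cont1.

Section Isotopic.
Context {R : realType}.
Notation sp := (R * R * R)%type.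
Implicit Types (A B C K : set sp).

(** A flow defined for all times makes gluing and composing isotopies a matter
    of composing continuous maps. *)
Definition isotopic A B : Prop :=
  exists H G : R * sp -> sp,
    [/\ continuous H, continuous G,
        (forall t x, G (t, H (t, x)) = x /\ H (t, G (t, x)) = x),
        (forall x, H (0, x) = x) & (fun x => H (1, x)) @` A = B].

Lemma isotopic_ambient A B : isotopic A B -> ambient_isotopic A B.
Proof.
case=> H [G [cH cG HG H0 im]]; exists H, G; split => //.
- exact: continuous_subspaceT.
- exact: continuous_subspaceT.
Qed.

Lemma isotopic_refl A : isotopic A A.
Proof.
exists (fun x => x.2), (fun x => x.2); split => //; [by cont | by cont | by rewrite image_id].
Qed.

Lemma isotopic_trans A B C : isotopic A B -> isotopic B C -> isotopic A C.
Proof.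
case=> [H1 [G1 [cH1 cG1 HG1 H10 <-]]] [H2 [G2 [cH2 cG2 HG2 H20 <-]]].
exists (fun x => H2 (x.1, H1 x)), (fun x => G1 (x.1, G2 x)); split.
- by cont.
- by cont.
- move=> t x /=; split.
  + by rewrite (HG2 _ _).1 (HG1 _ _).1.
  + by rewrite (HG1 _ _).2 (HG2 _ _).2.
- by move=> x /=; rewrite H10 H20.
- by rewrite image_comp.
Qed.

Lemma isotopic_sym A B : isotopic A B -> isotopic B A.
Proof.
case=> [H [G [cH cG HG H0 <-]]]; exists G, H; split => //.
- by move=> t x; case: (HG t x).
- by move=> x; rewrite -[in LHS](H0 x) (HG _ _).1.
- rewrite image_comp -[RHS]image_id; apply: eq_imagel => x _ /=.
  by rewrite (HG _ _).1.
Qed.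

Lemma isotopic_conj (s s' : sp -> sp) A B :
  continuous s -> continuous s' -> cancel s s' -> cancel s' s ->
  isotopic A B -> isotopic (s @` A) (s @` B).
Proof.
move=> cs cs' ss' s's [H [G [cH cG HG H0 <-]]].
exists (fun x => s (H (x.1, s' x.2))), (fun x => s (G (x.1, s' x.2))); split.
- by cont.
- by cont.
- by move=> t x /=; rewrite !ss' (HG _ _).1 (HG _ _).2 s's.
- by move=> x /=; rewrite H0 s's.
- by rewrite !image_comp; apply: eq_imagel => x _ /=; rewrite ss'.
Qed.

(** Any strictly increasing reparametrization of the vertical lines comes from
    an isotopy: interpolate linearly with the identity.  The inverse maps exist
    by the intermediate value theorem and are continuous by monotonicity. *)
Lemma isotopic_vertical (F : sp -> R) K :
  continuous F ->
  (forall p z z', z < z' -> F (p, z) < F (p, z')) ->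
  (forall p, exists M, forall z, `|F (p, z) - z| <= M) ->
  isotopic K ((fun x => (x.1, F x)) @` K).
Proof.
move=> cF iF bF.
pose cl (t : R) := Num.min 1 (Num.max 0 t).
have cl01 t : 0 <= cl t <= 1.
  by rewrite /cl le_min ler01 /= ge_min lexx /= le_max lexx.
pose h (t : R) (x : sp) := (1 - cl t) * x.2 + cl t * F x.
have ch : continuous (fun y : R * sp => h y.1 y.2).
  by rewrite /h /cl; cont.
have ih t p z z' : z < z' -> h t (p, z) < h t (p, z').
  move=> zz'; rewrite /h /=; have := iF p _ _ zz'; have := cl01 t.
  set c := cl t; set u := F _; set v := F _ => /andP[c0 c1] uv.
  move: c1; rewrite le_eqVlt => /orP[/eqP -> |c1]; first by lra.
  apply: ltr_leD; first by rewrite ltr_pM2l // subr_gt0.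
  by apply: ler_wpM2l => //; exact: ltW.
have ih' t p z z' : h t (p, z) < h t (p, z') -> z < z'.
  move=> hh; rewrite ltNge; apply/negP; rewrite le_eqVlt => /orP[/eqP E|/(ih t p) E].
    by rewrite E ltxx in hh.
  by have := lt_trans hh E; rewrite ltxx.
have ex t p v : exists z, h t (p, z) = v.
  have [M HM] := bF p.
  have M0 : 0 <= M by apply: le_trans (HM 0); exact: normr_ge0.
  have hM z : `|h t (p, z) - z| <= M.
    have -> : h t (p, z) - z = cl t * (F (p, z) - z) by rewrite /h /=; ring.
    rewrite normrM (ger0_norm (_ : 0 <= cl t)); last by case/andP: (cl01 t).
    apply: le_trans (HM z); rewrite ler_piMl ?normr_ge0 //; by case/andP: (cl01 t).
  have cz : continuous (fun z => h t (p, z)).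
    by rewrite /h /=; cont.
  have [] := @IVT R (fun z => h t (p, z)) (v - M) (v + M) v.
  - lra.
  - exact: continuous_subspaceT.
  - have := hM (v - M); have := hM (v + M); rewrite !ler_norml.
    move=> /andP[h1 h2] /andP[h3 h4]; rewrite ge_min le_max; apply/andP; split; apply/orP.
      by left; lra.
    by right; lra.
  - by move=> z _ <-; exists z.
pose g t x := sval (cid (ex t x.1 x.2)).
have hg t x : h t (x.1, g t x) = x.2 by rewrite /g; case: cid.
have gh t x : g t (x.1, h t x) = x.2.
  have := hg t (x.1, h t x); rewrite /= => E.
  case: (ltgtP (g t (x.1, h t x)) x.2) => // /(ih t x.1); rewrite E.
    by case: (x) => /= a b; rewrite ltxx.
  by case: (x) => /= a b; rewrite ltxx.
exists (fun y => (y.2.1, h y.1 y.2)), (fun y => (y.2.1, g y.1 y.2)); split.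
- by rewrite /h /cl; cont.
- apply: cont_pair; first by cont.
  move=> -[t0 x0]; apply/cvgrPdist_lt => e e0.
  set u0 := g t0 x0.
  have l1 : h t0 (x0.1, u0 - e) < x0.2 by rewrite -(hg t0 x0); apply: ih; rewrite ltrBlDr ltrDl.
  have l2 : x0.2 < h t0 (x0.1, u0 + e) by rewrite -[ltLHS](hg t0 x0); apply: ih; rewrite ltrDl.
  have c1 u : continuous (fun y : R * sp => y.2.2 - h y.1 (y.2.1, u)).
    by rewrite /h /cl; cont.
  have n1 : \forall y \near (t0, x0), 0 < y.2.2 - h y.1 (y.2.1, u0 - e).
    by apply: (cvgr_gt _ (c1 (u0 - e) (t0, x0))); rewrite subr_gt0.
  have n2 : \forall y \near (t0, x0), y.2.2 - h y.1 (y.2.1, u0 + e) < 0.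
    by apply: (cvgr_lt _ (c1 (u0 + e) (t0, x0))); rewrite subr_lt0.
  near=> y.
  have m1 : 0 < y.2.2 - h y.1 (y.2.1, u0 - e) by near: y.
  have m2 : y.2.2 - h y.1 (y.2.1, u0 + e) < 0 by near: y.
  move: m1 m2; rewrite subr_gt0 subr_lt0 -(hg y.1 y.2) => /ih' m1 /ih' m2.
  rewrite -/u0 ltr_distl; apply/andP; split; lra.
- move=> t [p z] /=; split; first by congr pair; exact: (gh t (p, z)).
  by congr pair; exact: (hg t (p, z)).
- move=> [p z] /=; congr pair; rewrite /h /= (_ : cl 0 = 0); first by ring.
  by rewrite /cl maxxx min_r // ler01.
- apply: eq_imagel => -[p z] _ /=; congr pair; rewrite /h (_ : cl 1 = 1) /=; first by ring.
  by rewrite /cl max_r ?ler01 // minxx.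
Unshelve. all: by end_near.
Qed.
End Isotopic.

Section Coordinates.
Context {R : realType}.
Notation sp := (R * R * R)%type.
Implicit Types (A B C K : set sp).

Lemma isotopic_conj_can (s s' : sp -> sp) K B :
  continuous s -> continuous s' -> cancel s s' -> cancel s' s ->
  isotopic (s @` K) B -> isotopic K (s' @` B).
Proof.
move=> cs cs' ss' s's /(isotopic_conj cs' cs s's ss').
rewrite image_comp (_ : (s' \o s) @` K = K) // -[RHS]image_id.
by apply: eq_imagel => p _ /=; rewrite ss'.
Qed.

Lemma isotopic_along_y (F : sp -> R) K :
  continuous F ->
  (forall x z y y', y < y' -> F (x, y, z) < F (x, y', z)) ->
  (forall x z, exists M, forall y, `|F (x, y, z) - y| <= M) ->
  isotopic K ((fun p => (p.1.1, F p, p.2)) @` K).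
Proof.
move=> cF iF bF.
pose s (p : sp) : sp := (p.1.1, p.2, p.1.2).
have cs : continuous s by rewrite /s; cont.
have ss : cancel s s by move=> [[x y] z].
have : isotopic (s @` K) ((fun x => (x.1, F (s x))) @` (s @` K)).
  apply: (isotopic_vertical (F := fun x => F (s x))).
  - by cont.
  - by move=> [x z] y y' yy'; exact: iF.
  - by move=> [x z]; exact: bF.
move=> /(isotopic_conj_can cs cs ss ss); rewrite !image_comp.
congr isotopic; apply: eq_imagel => -[[x y] z] _ /=.
by rewrite /s /=.
Qed.

Lemma isotopic_along_x (F : sp -> R) K :
  continuous F ->
  (forall y z x x', x < x' -> F (x, y, z) < F (x', y, z)) ->
  (forall y z, exists M, forall x, `|F (x, y, z) - x| <= M) ->
  isotopic K ((fun p => (F p, p.1.2, p.2)) @` K).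
Proof.
move=> cF iF bF.
pose s (p : sp) : sp := (p.2, p.1.2, p.1.1).
have cs : continuous s by rewrite /s; cont.
have ss : cancel s s by move=> [[x y] z].
have : isotopic (s @` K) ((fun x => (x.1, F (s x))) @` (s @` K)).
  apply: (isotopic_vertical (F := fun x => F (s x))).
  - by cont.
  - by move=> [z y] x x' xx'; exact: iF.
  - by move=> [z y]; exact: bF.
move=> /(isotopic_conj_can cs cs ss ss); rewrite !image_comp.
congr isotopic; apply: eq_imagel => -[[x y] z] _ /=.
by rewrite /s /=.
Qed.

Lemma shear_z (phi : R -> R -> R) K :
  continuous (fun q : R * R => phi q.1 q.2) ->
  isotopic K ((fun p => (p.1, p.2 + phi p.1.1 p.1.2)) @` K).
Proof.
move=> cphi; apply: (isotopic_vertical (F := fun p => p.2 + phi p.1.1 p.1.2)).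
- by apply: contD; [cont | apply: (@cont_o _ _ _ (fun q : R * R => phi q.1 q.2) fst) => //; cont].
- by move=> [x y] z z' zz' /=; rewrite ltrD2r.
- by move=> [x y]; exists `|phi x y| => z /=; rewrite addrC addKr.
Qed.

Lemma shear_y (phi : R -> R -> R) K :
  continuous (fun q : R * R => phi q.1 q.2) ->
  isotopic K ((fun p => (p.1.1, p.1.2 + phi p.1.1 p.2, p.2)) @` K).
Proof.
move=> cphi; apply: (isotopic_along_y (F := fun p => p.1.2 + phi p.1.1 p.2)).
- apply: contD; first by cont.
  by apply: (@cont_o _ _ _ (fun q : R * R => phi q.1 q.2) (fun p => (p.1.1, p.2))) => //; cont.
- by move=> x z y y' yy' /=; rewrite ltrD2r.
- by move=> x z; exists `|phi x z| => y /=; rewrite addrC addKr.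
Qed.

Lemma shear_x (phi : R -> R -> R) K :
  continuous (fun q : R * R => phi q.1 q.2) ->
  isotopic K ((fun p => (p.1.1 + phi p.1.2 p.2, p.1.2, p.2)) @` K).
Proof.
move=> cphi; apply: (isotopic_along_x (F := fun p => p.1.1 + phi p.1.2 p.2)).
- apply: contD; first by cont.
  by apply: (@cont_o _ _ _ (fun q : R * R => phi q.1 q.2) (fun p => (p.1.2, p.2))) => //; cont.
- by move=> y z x x' xx' /=; rewrite ltrD2r.
- by move=> y z; exists `|phi y z| => x /=; rewrite addrC addKr.
Qed.

(** A quarter turn is a product of three shears. *)
Lemma quarter_turn_y K : isotopic K ((fun p => (p.2, p.1.2, - p.1.1)) @` K).
Proof.
have c1 : continuous (fun q : R * R => q.2) by cont.
have c2 : continuous (fun q : R * R => - q.1) by cont.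
have := isotopic_trans (isotopic_trans (shear_x (phi := fun _ z => z) K c1)
  (shear_z (phi := fun x _ => - x) _ c2)) (shear_x (phi := fun _ z => z) _ c1).
rewrite !image_comp; congr isotopic; apply: eq_imagel => -[[x y] z] _ /=.
by congr (_, _, _); ring.
Qed.

Lemma quarter_turn_z K : isotopic K ((fun p => (p.1.2, - p.1.1, p.2)) @` K).
Proof.
have c1 : continuous (fun q : R * R => q.1) by cont.
have c2 : continuous (fun q : R * R => - q.1) by cont.
have := isotopic_trans (isotopic_trans (shear_x (phi := fun y _ => y) K c1)
  (shear_y (phi := fun x _ => - x) _ c2)) (shear_x (phi := fun y _ => y) _ c1).
rewrite !image_comp; congr isotopic; apply: eq_imagel => -[[x y] z] _ /=.
by congr (_, _, _); ring.
Qed.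
End Coordinates.

Lemma max_cases (R : realDomainType) (a b : R) :
  (Num.max a b = a /\ b <= a) \/ (Num.max a b = b /\ a <= b).
Proof.
case/orP: (le_total b a) => h; [left|right]; split=> //; [exact: max_l|exact: max_r].
Qed.

Lemma min_cases (R : realDomainType) (a b : R) :
  (Num.min a b = a /\ a <= b) \/ (Num.min a b = b /\ b <= a).
Proof.
case/orP: (le_total a b) => h; [left|right]; split=> //; [exact: min_l|exact: min_r].
Qed.

Lemma norm_cases (R : realDomainType) (a : R) :
  (`|a| = a /\ 0 <= a) \/ (`|a| = - a /\ a <= 0).
Proof.
case/orP: (le_total 0 a) => h; [left|right]; split=> //; [exact: ger0_norm|exact: ler0_norm].
Qed.

Ltac mmx := repeat match goal with
  | |- context [Num.max ?a ?b] => case: (max_cases a b) => -[-> ?]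
  | |- context [Num.min ?a ?b] => case: (min_cases a b) => -[-> ?]
  | |- context [Num.norm ?a] => case: (norm_cases a) => -[-> ?]
  | H : context [Num.max _ _] |- _ => move: H
  | H : context [Num.min _ _] |- _ => move: H
  | H : context [Num.norm _] |- _ => move: H
  end.

Section Push.
Context {R : realType}.
Notation sp := (R * R * R)%type.

(** [bump L d] is the displacement of a piecewise-linear homeomorphism of the
    line that moves 0 to [d >= 0] and has slopes [1 + L] and [1 / (1 + L)], so
    that it is supported in [[- d / L, d + d / L]]. *)
Definition bump (L d u : R) : R :=
  Num.max 0 (Num.min (d + L * u) (d - L / (1 + L) * u)).

Definition push (L d u : R) : R := bump L d u - bump L (- d) (- u).

Definition soften (n d : R) : R := Num.max 0 (d - n) - Num.max 0 (- d - n).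

Lemma bump_neg L d u : 0 < L -> d <= 0 -> bump L d u = 0.
Proof.
move=> L0 d0; have l0 : 0 < L / (1 + L) by rewrite divr_gt0 //; lra.
apply: max_l; rewrite ge_min; apply/orP; case/orP: (le_total 0 u) => u0.
  by right; have : 0 <= L / (1 + L) * u; [apply: mulr_ge0 => //; exact: ltW | lra].
by left; have : L * u <= 0; [apply: mulr_ge0_le0 => //; exact: ltW | lra].
Qed.

Lemma bump_lt L d u v : 0 < L -> u < v -> u + bump L d u < v + bump L d v.
Proof.
move=> L0 uv.
have l0 : 0 < L / (1 + L) by rewrite divr_gt0 //; lra.
have l1 : L / (1 + L) < 1 by rewrite ltr_pdivrMr; lra.
rewrite /bump; move: l0 l1; set l := L / _ => l0 l1.
have a1 : L * u < L * v by rewrite ltr_pM2l.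
have a2 : l * u < l * v by rewrite ltr_pM2l.
have a3 : l * v - l * u < v - u by rewrite -mulrBr gtr_pMl // subr_gt0.
by move: a1 a2 a3; move: (L * u) (L * v) (l * u) (l * v) => Lu Lv lu lv *; mmx; lra.
Qed.

Lemma bump_bound L d u : 0 < L -> 0 <= d -> 0 <= bump L d u <= d.
Proof.
move=> L0 d0; rewrite /bump le_max lexx /= ge_max d0 /= ge_min.
have l0 : 0 < L / (1 + L) by rewrite divr_gt0 //; lra.
apply/orP; case/orP: (le_total 0 u) => u0.
  by right; have : 0 <= L / (1 + L) * u; [apply: mulr_ge0 => //; exact: ltW | lra].
by left; have : L * u <= 0; [apply: mulr_ge0_le0 => //; exact: ltW | lra].
Qed.

Lemma bump_out L D d u : 0 < L -> 0 <= d <= D ->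
  D <= - (L * u) \/ D <= L * (u - D) -> bump L d u = 0.
Proof.
move=> L0 /andP[d0 dD] h; apply: max_l; rewrite ge_min; apply/orP.
case: h => h; [left; lra | right].
have l0 : 0 < 1 + L by lra.
rewrite -(pmulr_rle0 _ l0) (_ : _ * _ = (1 + L) * d - L * u); last first.
  by field; rewrite lt0r_neq0.
have : d * L <= D * L by rewrite ler_pM2r.
lra.
Qed.

Lemma pushE L d u : 0 < L ->
  push L d u = if 0 <= d then bump L d u else - bump L (- d) (- u).
Proof.
move=> L0; rewrite /push; case: ifP => d0.
  by rewrite (@bump_neg _ (- d)) ?subr0 // oppr_le0.
by rewrite (@bump_neg _ d) ?sub0r // ltW // ltNge d0.
Qed.

Lemma push0 L d : 0 < L -> push L d 0 = d.
Proof.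
move=> L0; rewrite pushE // /bump oppr0 !mulr0 !subr0 !addr0 !minxx.
by case: ifP => d0; [rewrite max_r | rewrite max_r ?opprK // oppr_ge0 ltW // ltNge d0].
Qed.

Lemma push_zero L u : 0 < L -> push L 0 u = 0.
Proof. by move=> L0; rewrite /push oppr0 !bump_neg // subrr. Qed.

Lemma push_lt L d u v : 0 < L -> u < v -> u + push L d u < v + push L d v.
Proof.
move=> L0 uv; rewrite !pushE //; case: ifP => _; first exact: bump_lt.
have := @bump_lt L (- d) (- v) (- u) L0; rewrite ltrN2 => /(_ uv); lra.
Qed.

Lemma push_bound L d u : 0 < L -> `|push L d u| <= `|d|.
Proof.
move=> L0; rewrite pushE //; case: ifP => d0.
  by have /andP[b0 b1] := bump_bound u L0 d0; rewrite !ger0_norm.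
have d1 : 0 <= - d by rewrite oppr_ge0 ltW // ltNge d0.
have /andP[b0 b1] := bump_bound (- u) L0 d1.
by rewrite normrN -(normrN d) !ger0_norm.
Qed.

Lemma soften0 d : soften 0 d = d.
Proof. by rewrite /soften !subr0; mmx; lra. Qed.

Lemma soften_out n d : `|d| <= n -> soften n d = 0.
Proof. by rewrite ler_norml /soften => /andP[? ?]; rewrite !max_l ?subrr //; lra. Qed.

(** The displacement vanishes outside the interval spanned by [0] and [D],
    enlarged by [|D| / L] on both sides. *)
Lemma push_out L D n u : 0 < L -> 0 <= n ->
  `|D| <= L * (Num.min 0 D - u) \/ `|D| <= L * (u - Num.max 0 D) ->
  push L (soften n D) u = 0.
Proof.
move=> L0 n0 h; case/orP: (le_total 0 D) => D0.
  move: h; rewrite min_l // max_r // ger0_norm // => h.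
  rewrite /push /soften (@max_l _ _ 0 (- D - n)); last by lra.
  rewrite subr0 (@bump_neg _ (- _)) ?subr0 //; last by rewrite oppr_le0 le_max lexx.
  apply: (@bump_out _ D) => //; last by case: h => h; [left|right]; lra.
  by rewrite le_max lexx /= ge_max D0 /=; lra.
move: h; rewrite min_r // max_l // ler0_norm // => h.
rewrite /push /soften (@max_l _ _ 0 (D - n)); last by lra.
rewrite sub0r (@bump_neg _ (- _)) ?sub0r //; last by rewrite oppr_le0 le_max lexx.
rewrite opprK (@bump_out _ (- D)) ?oppr0 //; last by case: h => h; [right|left]; lra.
by rewrite le_max lexx /= ge_max oppr_ge0 D0 /=; lra.
Qed.

Definition strand (f g : R -> R) (a b : R) : set sp :=
  [set p | [/\ a <= p.1.2 <= b, p.1.1 = f p.1.2 & p.2 = g p.1.2]].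

(** An arc transverse to the horizontal planes can be moved vertically, along a
    strip that the rest [K] of the curve avoids.  The neighbourhood in which
    the isotopy takes place is thin of relative size [1 / N] and [1 / L], which
    allows [K] to meet the arc at its ends. *)
Lemma isotopic_push (f g g' : R -> R) (a b N L : R) K :
  continuous f -> continuous g -> continuous g' -> a <= b -> 0 < N -> 0 < L ->
  g a = g' a -> g b = g' b ->
  (forall x y z, K (x, y, z) -> a <= y <= b ->
     [\/ `|g' y - g y| <= N * `|x - f y|,
         `|g' y - g y| <= L * (Num.min (g y) (g' y) - z) |
         `|g' y - g y| <= L * (z - Num.max (g y) (g' y))]) ->
  isotopic (strand f g a b `|` K) (strand f g' a b `|` K).
Proof.
move=> cf cg cg' ab N0 L0 ga gb HK.
pose cl y := Num.min b (Num.max a y).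
have clE y : a <= y <= b -> cl y = y.
  by move=> /andP[ay yb]; rewrite /cl max_r // min_r.
have clout y : ~~ (a <= y <= b) -> g' (cl y) - g (cl y) = 0.
  rewrite negb_and -!ltNge => /orP[h|h].
    by rewrite /cl (max_l (ltW h)) (min_r ab) ga subrr.
  by rewrite /cl (@max_r _ _ a) ?min_l ?gb ?subrr // ltW // (le_lt_trans ab).
pose d (p : sp) := soften (N * `|p.1.1 - f p.1.2|) (g' (cl p.1.2) - g (cl p.1.2)).
pose F (p : sp) := p.2 + push L (d p) (p.2 - g p.1.2).
have cF : continuous F.
  rewrite /F /push /bump /d /soften /cl; cont.
have := @isotopic_vertical R F (strand f g a b `|` K) cF.
have -> : (fun x => (x.1, F x)) @` (strand f g a b `|` K) = strand f g' a b `|` K.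
  rewrite image_setU; congr setU.
    apply/seteqP; split=> [_ [[[x y] z] [/= yab -> ->] <-]|[[x y] z] [/= yab -> ->]].
      split => //=; rewrite /F /d /= subrr normr0 mulr0 soften0 subrr push0 // clE //.
      lra.
    exists (f y, y, g y) => //; congr (_, _).
    rewrite /F /d /= subrr normr0 mulr0 soften0 subrr push0 // clE //; lra.
  rewrite -[RHS]image_id; apply: eq_imagel => -[[x y] z] Kp /=; congr (_, _).
  rewrite /F /d /=; have [yab|yab] := boolP (a <= y <= b); last first.
    by rewrite clout // soften_out ?push_zero ?addr0 // normr0 mulr_ge0 // ltW.
  rewrite clE //; have [h|h|h] := HK _ _ _ Kp yab.
  - by rewrite soften_out // push_zero // addr0.
  - rewrite (push_out L0) ?addr0 //; first by rewrite mulr_ge0 // ltW.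
    left; rewrite (_ : _ - (z - g y) = Num.min (g y) (g' y) - z) //.
    by clear; mmx; lra.
  - rewrite (push_out L0) ?addr0 //; first by rewrite mulr_ge0 // ltW.
    right; rewrite (_ : z - g y - _ = z - Num.max (g y) (g' y)) //.
    by clear; mmx; lra.
apply.
- move=> [x y] z z' zz'; rewrite /F /=.
  have := @push_lt L (d (x, y, 0)) (z - g y) (z' - g y) L0; rewrite ltrD2r => /(_ zz').
  by rewrite /d /=; lra.
- move=> [x y]; exists `|d (x, y, 0)| => z; rewrite /F /= addrC addKr.
  exact: push_bound.
Qed.
End Push.

Section PiecewiseLinear.
Context {R : realType}.
Notation sp := (R * R * R)%type.

Definition clamp (a b y : R) : R := Num.min b (Num.max a y).

(** The piecewise-linear function with value [v k] at the knot [t k], [k <= m],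
    constant outside the knots. *)
Fixpoint pl (m : nat) (t v : nat -> R) (y : R) : R :=
  if m is k.+1 then
    pl k t v y + (v k.+1 - v k) / (t k.+1 - t k) * (clamp (t k) (t k.+1) y - t k)
  else v 0%N.

Lemma clamp_lo a b y : a <= b -> y <= a -> clamp a b y = a.
Proof. by move=> ab ya; rewrite /clamp max_l // min_r. Qed.

Lemma clamp_hi a b y : a <= b -> b <= y -> clamp a b y = b.
Proof. by move=> ab yb; rewrite /clamp min_l // le_max yb orbT. Qed.

Lemma clamp_in a b y : a <= y <= b -> clamp a b y = y.
Proof. by move=> /andP[ay yb]; rewrite /clamp max_r // min_r. Qed.

Lemma knots_le (m : nat) (t : nat -> R) :
  (forall k, (k < m)%N -> t k < t k.+1) ->
  forall j k, (j <= k <= m)%N -> t j <= t k.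
Proof.
move=> h j k; elim: k => [|k IH] /andP[jk km]; first by move: jk; rewrite leqn0 => /eqP ->.
move: jk; rewrite leq_eqVlt => /orP[/eqP -> //|jk].
by apply: (le_trans (IH _) (ltW (h _ km))); rewrite -ltnS jk ltnW.
Qed.

Lemma knots_lt (m : nat) (t : nat -> R) :
  (forall k, (k < m)%N -> t k < t k.+1) ->
  forall j k, (j < k <= m)%N -> t j < t k.
Proof.
move=> h j k /andP[jk km].
apply: lt_le_trans (h j (leq_trans jk km)) _.
by apply: (knots_le h); rewrite jk.
Qed.

Lemma knots_piece (m : nat) (t : nat -> R) y : (0 < m)%N ->
  t 0%N <= y <= t m -> exists2 k, (k < m)%N & t k <= y <= t k.+1.
Proof.
elim: m => // -[|m] IH _ /andP[y0 y1]; first by exists 0%N => //; rewrite y0 y1.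
case/orP: (le_total y (t m.+1)) => h; last by exists m.+1 => //; rewrite h y1.
have [//||k km kk] := IH; first by rewrite y0.
by exists k => //; exact: ltnW.
Qed.

Lemma pl_continuous m t v : continuous (pl m t v).
Proof.
elim: m => [|m IH]; first exact: cont_cst.
by rewrite /= /clamp; cont.
Qed.

Lemma pl_lo m t v y : (forall k, (k < m)%N -> t k < t k.+1) ->
  y <= t 0%N -> pl m t v y = v 0%N.
Proof.
move=> h y0; elim: m h => // m IH h /=.
rewrite IH; last by move=> k km; apply: h; exact: ltnW.
rewrite clamp_lo ?subrr ?mulr0 ?addr0 //; first exact/ltW/h.
by apply: (le_trans y0); apply: (knots_le h); rewrite /= leqW.
Qed.

Lemma pl_hi m t v y : (forall k, (k < m)%N -> t k < t k.+1) ->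
  t m <= y -> pl m t v y = v m.
Proof.
elim: m => // m IH h ym /=.
have tm := h m (leqnn _).
rewrite IH; first last.
- exact: (le_trans (ltW tm)).
- by move=> k km; apply: h; exact: ltnW.
rewrite clamp_hi ?(ltW tm) // divfK; first by rewrite addrC subrK.
by rewrite subr_eq0 gt_eqF.
Qed.

Lemma pl_at m t v k y : (forall k, (k < m)%N -> t k < t k.+1) ->
  (k < m)%N -> t k <= y <= t k.+1 ->
  pl m t v y = v k + (v k.+1 - v k) / (t k.+1 - t k) * (y - t k).
Proof.
elim: m => // m IH h; rewrite ltnS leq_eqVlt => /orP[/eqP ->|km] /andP[yk yk1] /=.
  rewrite clamp_in ?yk ?yk1 // pl_hi //.
  by move=> j jm; apply: h; exact: ltnW.
have h' j : (j < m)%N -> t j < t j.+1 by move=> jm; apply: h; exact: ltnW.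
rewrite IH // ?yk ?yk1 // clamp_lo ?subrr ?mulr0 ?addr0 //; first exact/ltW/h.
by apply: (le_trans yk1); apply: (knots_le h); rewrite km leqnSn.
Qed.

Lemma pl_knot m t v k : (forall k, (k < m)%N -> t k < t k.+1) ->
  (k <= m)%N -> pl m t v (t k) = v k.
Proof.
move=> h; rewrite leq_eqVlt => /orP[/eqP ->|km]; first exact: pl_hi.
by rewrite (pl_at v h km) ?subrr ?mulr0 ?addr0 // lexx ltW // h.
Qed.

Lemma pl_le m t v y z : (forall k, (k < m)%N -> t k < t k.+1) ->
  (forall k, (k < m)%N -> v k < v k.+1) -> y <= z -> pl m t v y <= pl m t v z.
Proof.
move=> h hv yz; elim: m h hv => // m IH h hv /=.
apply: lerD.
  by apply: IH => k km; [apply: h|apply: hv]; exact: ltnW.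
rewrite ler_pM2l ?divr_gt0 ?subr_gt0 ?h ?hv // lerB // /clamp.
by rewrite le_min2 // le_max2.
Qed.
Lemma pl_lt m t v y z : (forall k, (k < m)%N -> t k < t k.+1) ->
  (forall k, (k < m)%N -> v k < v k.+1) ->
  t 0%N <= y -> y < z -> z <= t m -> pl m t v y < pl m t v z.
Proof.
elim: m => [h hv y0 yz z0|m IH h hv y0 yz zm /=].
  by have := lt_le_trans (le_lt_trans y0 yz) z0; rewrite ltxx.
have h' k : (k < m)%N -> t k < t k.+1 by move=> km; apply: h; exact: ltnW.
have hv' k : (k < m)%N -> v k < v k.+1 by move=> km; apply: hv; exact: ltnW.
have sl : 0 < (v m.+1 - v m) / (t m.+1 - t m).
  by rewrite divr_gt0 // subr_gt0 ?h ?hv.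
case: (leP z (t m)) => zt.
  apply: ltr_leD; first exact: IH.
  by rewrite ler_pM2l // lerB // /clamp le_min2 // le_max2 // ltW.
apply: ler_ltD; first by apply: pl_le => //; exact: ltW.
rewrite ltr_pM2l // ltrD2r (clamp_in (y := z)) ?zm ?(ltW zt) //.
by rewrite /clamp gt_min; apply/orP; right; rewrite gt_max zt.
Qed.

(** The same function, continued by slope 1 on both sides. *)
Definition pl_line m t v y : R :=
  pl m t v y + (Num.min 0 (y - t 0%N) + Num.max 0 (y - t m)).

Lemma pl_line_continuous m t v : continuous (pl_line m t v).
Proof. by rewrite /pl_line; have := @pl_continuous m t v => c; cont. Qed.

Lemma pl_lineE m t v y : t 0%N <= y <= t m -> pl_line m t v y = pl m t v y.
Proof.
by move=> /andP[y0 ym]; rewrite /pl_line min_l ?subr_ge0 // max_l ?addr0 // subr_le0.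
Qed.

Lemma pl_line_lt m t v y z : (forall k, (k < m)%N -> t k < t k.+1) ->
  (forall k, (k < m)%N -> v k < v k.+1) -> y < z -> pl_line m t v y < pl_line m t v z.
Proof.
move=> h hv yz; have p : pl m t v y <= pl m t v z by apply: pl_le => //; exact: ltW.
rewrite /pl_line; have [y0|y0] := ltP y (t 0%N).
  rewrite ler_ltD // ltr_leD //.
    by rewrite (@min_r _ _ 0 (y - t 0%N)) ?lt_min; lra.
  by rewrite ge_max le_max lexx /= le_max lerD2r (ltW yz) orbT.
have mn : Num.min 0 (y - t 0%N) <= Num.min 0 (z - t 0%N).
  by rewrite le_min2 // lerD2r ltW.
have [zm|zm] := ltP (t m) z.
  rewrite ler_ltD // ler_ltD //.
  by rewrite (@max_r _ _ 0 (z - t m)) ?gt_max; lra.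
rewrite ltr_leD ?(pl_lt h hv) // lerD // ge_max !le_max lexx /=.
by rewrite lerD2r (ltW yz) orbT.
Qed.

Lemma pl_line_bound m t v : (forall k, (k < m)%N -> t k < t k.+1) ->
  (forall k, (k < m)%N -> v k < v k.+1) ->
  exists M, forall y, `|pl_line m t v y - y| <= M.
Proof.
move=> h hv; exists (`|v 0%N| + `|v m| + `|t 0%N| + `|t m|) => y.
rewrite /pl_line; have v0 : v 0%N <= pl m t v y.
  rewrite -(pl_lo v h (_ : Num.min y (t 0%N) <= t 0%N)) ?ge_min ?lexx ?orbT //.
  by apply: pl_le => //; rewrite ge_min lexx.
have vm : pl m t v y <= v m.
  rewrite -(pl_hi v h (_ : t m <= Num.max y (t m))) ?le_max ?lexx ?orbT //.
  by apply: pl_le => //; rewrite le_max lexx.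
have tt : t 0%N <= t m by apply: (knots_le h); rewrite leqnn.
have nb (x : R) : - `|x| <= x <= `|x| by rewrite -ler_norml.
have := nb (v 0%N); have := nb (v m); have := nb (t 0%N); have := nb (t m).
rewrite ler_norml => /andP[? ?] /andP[? ?] /andP[? ?] /andP[? ?].
have [y0|y0] := ltP y (t 0%N).
  by rewrite (pl_lo v h (ltW y0)) min_r ?max_l; lra.
have [ym|ym] := ltP (t m) y.
  by rewrite (pl_hi v h (ltW ym)) min_l ?max_r; lra.
by rewrite min_l ?max_l; lra.
Qed.

Definition affine_on (f : R -> R) (a b : R) : Prop :=
  forall t, 0 <= t <= 1 -> f (a + t * (b - a)) = f a + t * (f b - f a).

Lemma affine_onP (f : R -> R) a b c d : (forall y, a <= y <= b -> f y = c + d * y) ->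
  forall a' b', a <= a' -> a' <= b' -> b' <= b -> affine_on f a' b'.
Proof.
move=> h a' b' aa ab bb t /andP[t0 t1].
have h1 : 0 <= t * (b' - a') by rewrite mulr_ge0 // subr_ge0.
have h2 : t * (b' - a') <= b' - a' by rewrite ler_piMl // subr_ge0.
by rewrite !h; [ring | lra..].
Qed.

Lemma pl_affine m t v k a b : (forall k, (k < m)%N -> t k < t k.+1) ->
  (k < m)%N -> t k <= a -> a <= b -> b <= t k.+1 -> affine_on (pl m t v) a b.
Proof.
move=> h km; set s := (v k.+1 - v k) / (t k.+1 - t k).
apply: (@affine_onP _ _ _ (v k - s * t k) s) => y yk.
by rewrite (pl_at v h km yk) -/s; ring.
Qed.

Lemma strand_segment (f g : R -> R) (a b : R) : a <= b -> affine_on f a b -> affine_on g a b ->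
  strand f g a b = segment (f a, a, g a) (f b, b, g b).
Proof.
move=> ab af ag; apply/seteqP; split=> [[[x y] z] [/= yab -> ->]|p [t t01 ->]].
  have [t t01 ->] : exists2 t, 0 <= t <= 1 & y = a + t * (b - a).
    have [E|ab'] := eqVneq a b.
      by exists 0; [rewrite lexx ler01 | rewrite mul0r addr0; move: yab; rewrite E => yab; apply/eqP; rewrite eq_le andbC].
    have lab : 0 < b - a by rewrite subr_gt0 lt_neqAle ab' ab.
    exists ((y - a) / (b - a)); last by rewrite divfK ?lt0r_neq0 // addrC subrK.
    by rewrite divr_ge0 ?(ltW lab) ?ler_pdivrMr //; lra.
  by exists t => //; rewrite af // ag.
have /andP[t0 t1] := t01; split => /=; rewrite /GRing.scale /= ?af ?ag //.
have h1 : 0 <= t * (b - a) by rewrite mulr_ge0 // subr_ge0.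
have h2 : t * (b - a) <= b - a by rewrite ler_piMl // subr_ge0.
by lra.
Qed.

Lemma strand_cat (f g : R -> R) (a b c : R) : a <= b -> b <= c ->
  strand f g a c = strand f g a b `|` strand f g b c.
Proof.
move=> ab bc; apply/seteqP; split=> [[[x y] z] [/= /andP[y1 y2] -> ->]|].
  by case/orP: (le_total y b) => h; [left|right]; split; rewrite //= h ?y1 ?y2.
move=> [[x y] z] [] [/= /andP[y1 y2] -> ->]; split => //=; apply/andP; split=> //.
- exact: le_trans bc.
- exact: le_trans ab _.
Qed.

Lemma strand_knots (f g : R -> R) (m : nat) (t : nat -> R) : (0 < m)%N ->
  (forall k, (k < m)%N -> t k < t k.+1) ->
  strand f g (t 0%N) (t m) = \bigcup_(k in `I_m) strand f g (t k) (t k.+1).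
Proof.
move=> m0 h; apply/seteqP; split=> [[[x y] z] [/= yab -> ->]|[[x y] z] [k /= km [/= /andP[y1 y2] -> ->]]].
  by have [k km yk] := knots_piece m0 yab; exists k.
split=> //=; apply/andP; split.
- by apply: le_trans y1; apply: (knots_le h); rewrite /= ltnW.
- by apply: (le_trans y2); apply: (knots_le h); rewrite km leqnn.
Qed.
End PiecewiseLinear.
Arguments pl : simpl never.

Section Segments.
Context {R : realType}.

Lemma segmentC (V : lmodType R) (a b : V) : segment a b = segment b a.
Proof.
suff S (c d : V) : segment c d `<=` segment d c by apply/seteqP; split; exact: S.
move=> x [t /andP[t0 t1] ->]; exists (1 - t).
  by rewrite subr_ge0 t1 /= lerBlDr lerDl t0.
by rewrite scalerBl scale1r -scalerN opprB addrA [d + (c - d)]addrC subrK.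
Qed.

Lemma segment_cat (V : lmodType R) (a c : V) (s : R) (b := a + s *: (c - a)) :
  0 <= s <= 1 -> segment a c = segment a b `|` segment b c.
Proof.
move=> /andP[s0 s1].
have bc t : b + t *: (c - b) = a + (s + t * (1 - s)) *: (c - a).
  have -> : c - b = (1 - s) *: (c - a) by rewrite /b opprD addrA scalerBl scale1r.
  by rewrite /b scalerA -addrA -scalerDl.
have ab t : a + t *: (b - a) = a + (t * s) *: (c - a).
  have -> : b - a = s *: (c - a) by rewrite /b addrC addKr.
  by rewrite scalerA.
apply/seteqP; split=> [x [t /andP[t0 t1] ->]|x].
  have [ts|ts] := leP t s; [left|right].
    have [s00|s00] := eqVneq s 0.
      exists 0; first by rewrite lexx ler01.
      by rewrite ab mul0r; have -> : t = 0 by apply/eqP; rewrite eq_le t0 -s00 ts.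
    have sp : 0 < s by rewrite lt_neqAle eq_sym s00.
    exists (t / s); first by rewrite divr_ge0 //= ler_pdivrMr ?mul1r.
    by rewrite ab divfK.
  have sp : 0 < 1 - s by rewrite subr_gt0; apply: lt_le_trans t1.
  exists ((t - s) / (1 - s)).
    by rewrite divr_ge0 ?(ltW sp) ?subr_ge0 ?(ltW ts) //= ler_pdivrMr ?mul1r ?lerD2r.
  by rewrite bc divfK ?lt0r_neq0 // [s + _]addrC subrK.
case=> -[t /andP[t0 t1] ->].
  exists (t * s); last by rewrite ab.
  by rewrite mulr_ge0 //= mulr_ile1.
exists (s + t * (1 - s)); last by rewrite bc.
have h1 : 0 <= t * (1 - s) by rewrite mulr_ge0 // subr_ge0.
have h2 : t * (1 - s) <= 1 - s by rewrite ler_piMl // subr_ge0.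
by lra.
Qed.

Lemma image_segment (V W : lmodType R) (F : V -> W) (a b : V) :
  (forall t, 0 <= t <= 1 -> F (a + t *: (b - a)) = F a + t *: (F b - F a)) ->
  F @` segment a b = segment (F a) (F b).
Proof.
move=> h; apply/seteqP; split=> [_ [_ [t t01 ->] <-]|_ [t t01 ->]].
  by exists t => //; exact: h.
by exists (a + t *: (b - a)); [exists t | exact: h].
Qed.
End Segments.

Section Plat.
Context {R : realType} (n : nat).
Notation sp := (R * R * R)%type.
Implicit Types s u : R.

Notation lst l := (fun k : nat => nth 0 l k).

Definition zig s : R := pl (2 * n) (fun i => i%:R) (fun i => (odd i)%:R) (- s).

Definition xA s : R :=
  zig s + pl 1 (lst [:: (2 * n)%:R; (2 * n)%:R + 2^-1]) (lst [:: 0; 1]) (- s)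
  + pl 3 (lst [:: 0; 2^-1; 7 / 2; 15 / 4]) (lst [:: 0; 1; 3; 4]) s.

Definition xB s : R :=
  1 - zig s + pl 2 (lst [:: 0; 2; 15 / 4]) (lst [:: 0; 2; 3]) s.

Definition xr s : R := pl 2 (lst [:: - (2 * n)%:R; 0; 3]) (lst [:: 1; 2; 3]) s.

Definition xs s : R :=
  pl 4 (lst [:: - (2 * n)%:R - 2^-1; - (2 * n)%:R; 2 - n%:R; 11 / 4; 3])
    (lst [:: 1; 2; 3; 4; 3]) s.

Definition gA s : R :=
  pl (4 * n) (fun i => i%:R / 2) (fun i => ((i %% 4)%N == 1%N)%:R) (- s).

Definition gB s : R :=
  pl (4 * n) (fun i => i%:R / 2) (fun i => ((i %% 4)%N == 3%N)%:R) (- s)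
  + pl 2 (lst [:: 1; 3 / 2; 2]) (lst [:: 0; 1; 0]) s.

Definition gs s : R := pl 2 (lst [:: 11 / 4; 23 / 8; 3]) (lst [:: 0; 1; 0]) s.

Lemma natr_knots m : forall k, (k < m)%N -> k%:R < k.+1%:R :> R.
Proof. by move=> k _; rewrite ltr_nat. Qed.

Lemma half_knots m : forall k, (k < m)%N -> k%:R / 2 < k.+1%:R / 2 :> R.
Proof. by move=> k _; rewrite ltr_pM2r ?ltr_nat // invr_gt0. Qed.


Hypothesis n0 : (0 < n)%N.
Let n1 : (1 : R) <= n%:R. Proof. by rewrite ler1n. Qed.

Let m0 : (0 : R) <= (2 * n)%:R. Proof. by []. Qed.

Ltac slra := have ? := n1; have ? := m0; lra.

Ltac nz := repeat (apply/andP; split); first [by [] | apply: lt0r_neq0; slra | apply: ltr0_neq0; slra].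

Ltac knots := let k := fresh "k" in
  (case=> [|[|[|[|k]]]] //= _; rewrite ?natrM; slra).

Lemma zig_piece k s : (k < 2 * n)%N -> k%:R <= - s <= k.+1%:R ->
  zig s = if odd k then 1 - (- s - k%:R) else - s - k%:R.
Proof.
move=> kn ks; rewrite /zig (pl_at _ (@natr_knots _) kn ks) -(natr1 k).
have -> : k%:R + 1 - k%:R = 1 :> R by ring.
by rewrite divr1 /=; case: (odd k) => /=; ring.
Qed.

Lemma zig_lo s : 0 <= s -> zig s = 0.
Proof. by move=> s0; rewrite /zig (pl_lo _ (@natr_knots _)) // oppr_le0. Qed.

Lemma zig_hi s : s <= - (2 * n)%:R -> zig s = 0.
Proof.
move=> s0; rewrite /zig (pl_hi _ (@natr_knots _)); last by lra.
by rewrite oddM.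
Qed.

Lemma xA_braid s : - (2 * n)%:R <= s <= 0 -> xA s = zig s.
Proof.
move=> /andP[h1 h2]; rewrite /xA [pl 1 _ _ _]pl_lo /=; [|knots|slra].
by rewrite [pl 3 _ _ _]pl_lo /=; [rewrite !addr0|knots|slra].
Qed.

Lemma xA_low s : - (2 * n)%:R - 2^-1 <= s <= - (2 * n)%:R ->
  xA s = 2 * (- s - (2 * n)%:R).
Proof.
move=> /andP[h1 h2]; rewrite /xA zig_hi // (@pl_at _ 1 _ _ 0) //=; [|knots|slra].
rewrite [pl 3 _ _ _]pl_lo /=; [|knots|slra].
rewrite (addrAC _ 2^-1) subrr add0r; by field.
Qed.

Lemma xA_up s : 0 <= s ->
  xA s = pl 3 (lst [:: 0; 2^-1; 7 / 2; 15 / 4]) (lst [:: 0; 1; 3; 4]) s.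
Proof.
move=> s0; rewrite /xA zig_lo // [pl 1 _ _ _]pl_lo /=; [|knots|slra].
by rewrite !add0r.
Qed.

Lemma xA_up0 s : 0 <= s <= 2^-1 -> xA s = 2 * s.
Proof.
move=> h; rewrite xA_up; last by slra.
by rewrite (@pl_at _ 3 _ _ 0) //=; [field; nz|knots].
Qed.

Lemma xA_up1 s : 2^-1 <= s <= 7 / 2 -> xA s = 2 / 3 * (s + 1).
Proof.
move=> h; rewrite xA_up; last by slra.
by rewrite (@pl_at _ 3 _ _ 1) //=; [field; nz|knots].
Qed.

Lemma xA_up2 s : 7 / 2 <= s <= 15 / 4 -> xA s = 4 * s - 11.
Proof.
move=> h; rewrite xA_up; last by slra.
by rewrite (@pl_at _ 3 _ _ 2) //=; [field; nz|knots].
Qed.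

Lemma xB_braid s : s <= 0 -> xB s = 1 - zig s.
Proof.
by move=> s0; rewrite /xB [pl 2 _ _ _]pl_lo /=; [rewrite addr0|knots|slra].
Qed.

Lemma xB_up0 s : 0 <= s <= 2 -> xB s = 1 + s.
Proof.
move=> h; rewrite /xB zig_lo; last by slra.
by rewrite (@pl_at _ 2 _ _ 0) //=; [field; nz|knots].
Qed.

Lemma xB_up1 s : 2 <= s <= 15 / 4 -> xB s = 3 + 4 / 7 * (s - 2).
Proof.
move=> h; rewrite /xB zig_lo; last by slra.
by rewrite (@pl_at _ 2 _ _ 1) //=; [field; nz|knots].
Qed.

Let nn : (2 * n)%:R = (2 : R) * n%:R. Proof. by rewrite natrM. Qed.

Lemma xr0 s : - (2 * n)%:R <= s <= 0 -> xr s = 2 + s / (2 * n)%:R.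
Proof.
move=> h; rewrite /xr (@pl_at _ 2 _ _ 0) //=; [|knots].
by field; nz.
Qed.

Lemma xr1 s : 0 <= s <= 3 -> xr s = 2 + s / 3.
Proof. by move=> h; rewrite /xr (@pl_at _ 2 _ _ 1) //=; [field; nz|knots]. Qed.

Lemma xs0 s : - (2 * n)%:R - 2^-1 <= s <= - (2 * n)%:R ->
  xs s = 2 + 2 * (s + (2 * n)%:R).
Proof. by move=> h; rewrite /xs (@pl_at _ 4 _ _ 0) //=; [field; nz|knots]. Qed.

Lemma xs1 s : - (2 * n)%:R <= s <= 2 - n%:R ->
  xs s = 2 + (s + 2 * n%:R) / (n%:R + 2).
Proof.
move=> h; rewrite /xs (@pl_at _ 4 _ _ 1) //=; [|knots].
by rewrite nn; field; nz.
Qed.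

Lemma xs2 s : 2 - n%:R <= s <= 11 / 4 -> 
  xs s = 3 + (s + n%:R - 2) / (n%:R + 3 / 4).
Proof.
move=> h; rewrite /xs (@pl_at _ 4 _ _ 2) //=; [|knots].
by field; nz.
Qed.

Lemma xs3 s : 11 / 4 <= s <= 3 -> xs s = 3 + 4 * (3 - s).
Proof. by move=> h; rewrite /xs (@pl_at _ 4 _ _ 3) //=; [field; nz|knots]. Qed.

Lemma gs0 s : s <= 11 / 4 -> gs s = 0.
Proof. by move=> h; rewrite /gs pl_lo //=; knots. Qed.

Lemma gs1 s : 11 / 4 <= s <= 23 / 8 -> gs s = 8 * (s - 11 / 4).
Proof. by move=> h; rewrite /gs (@pl_at _ 2 _ _ 0) //=; [field; nz|knots]. Qed.

Lemma gs2 s : 23 / 8 <= s <= 3 -> gs s = 8 * (3 - s).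
Proof. by move=> h; rewrite /gs (@pl_at _ 2 _ _ 1) //=; [field; nz|knots]. Qed.

Lemma gA_out s : s <= - (2 * n)%:R \/ 0 <= s -> gA s = 0.
Proof.
case=> h; rewrite /gA.
  rewrite (pl_hi _ (@half_knots _)); last by rewrite natrM; slra.
  by rewrite modnMr.
by rewrite (pl_lo _ (@half_knots _)) //= mul0r oppr_le0.
Qed.

Definition tent (u : R) : R := 1 - `|2 * u - 1|.

Lemma tent_piece (r : nat) k (s : R) : (k < 2 * n)%N -> (r < 2)%N ->
  k%:R <= - s <= k.+1%:R ->
  pl (4 * n) (fun i => i%:R / 2) (fun i => ((i %% 4)%N == (2 * r).+1)%:R) (- s)
  = (odd k == (r == 1)%N)%:R * tent (- s - k%:R).
Proof.
move=> kn r2 /andP[k1 k2]; rewrite -(natr1 k) in k2.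
have dk : (2 * k)%:R = 2 * k%:R :> R by rewrite natrM.
have me : ((2 * k) %% 4)%N = (2 * odd k)%N.
  by rewrite -[X in (_ %% X)%N]/(2 * 2)%N -muln_modr modn2.
have mo : ((2 * k).+1 %% 4)%N = (2 * odd k).+1%N.
  by rewrite -addn1 -modnDml me; case: (odd k).
have me2 : ((2 * k).+2 %% 4)%N = (2 * ~~ odd k)%N.
  by rewrite -addn2 -modnDml me; case: (odd k).
case/orP: (le_total (- s) (k%:R + 2^-1)) => h.
  rewrite (@pl_at _ _ _ _ (2 * k)) ?me ?mo; first last.
  - by rewrite -(natr1 (2 * k)) dk; slra.
  - by apply: leq_trans (_ : 2 * (2 * n) <= _)%N; [rewrite ltn_pmul2l | rewrite mulnA].
  - exact: half_knots.
  rewrite /tent ler0_norm; last by slra.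
  rewrite -(natr1 (2 * k)) dk.
  by case: (odd k); case: r r2 => [|[|//]] _ /=; field; nz.
rewrite (@pl_at _ _ _ _ (2 * k).+1) ?me2 ?mo; first last.
- by rewrite -(natr1 (2 * k).+1) -(natr1 (2 * k)) dk; slra.
- apply: leq_trans (_ : 2 * (2 * n) <= _)%N; last by rewrite mulnA.
  by rewrite -[(2 * k).+2]/(2 + 2 * k)%N -mulnS leq_pmul2l.
- exact: half_knots.
rewrite /tent ger0_norm; last by slra.
rewrite -(natr1 (2 * k).+1) -(natr1 (2 * k)) dk.
by case: (odd k); case: r r2 => [|[|//]] _ /=; field; nz.
Qed.

Lemma gA_piece k s : (k < 2 * n)%N -> k%:R <= - s <= k.+1%:R ->
  gA s = if odd k then 0 else tent (- s - k%:R).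
Proof.
move=> kn ks; rewrite /gA (@tent_piece 0 k) //=.
by case: (odd k); rewrite ?mul0r ?mul1r.
Qed.

Lemma gB_low s : s <= 1 -> gB s =
  pl (4 * n) (fun i => i%:R / 2) (fun i => ((i %% 4)%N == 3%N)%:R) (- s).
Proof. by move=> h; rewrite /gB [pl 2 _ _ _]pl_lo /= ?addr0 //; knots. Qed.

Lemma gB_piece k s : (k < 2 * n)%N -> k%:R <= - s <= k.+1%:R ->
  gB s = if odd k then tent (- s - k%:R) else 0.
Proof.
move=> kn ks; rewrite gB_low; last by have : (0 : R) <= k%:R by []; slra.
rewrite (@tent_piece 1 k) //=.
by case: (odd k); rewrite ?mul0r ?mul1r.
Qed.

Lemma gB_up s : 0 <= s -> gB s = pl 2 (lst [:: 1; 3 / 2; 2]) (lst [:: 0; 1; 0]) s.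
Proof.
move=> h; rewrite /gB (pl_lo _ (@half_knots _)) /= ?add0r //.
by rewrite mul0r oppr_le0.
Qed.

Lemma gB_up0 s : 0 <= s <= 1 -> gB s = 0.
Proof.
by move=> h; rewrite gB_up; [rewrite pl_lo //=; [knots|lra]|lra].
Qed.

Lemma gB_up1 s : 1 <= s <= 3 / 2 -> gB s = 2 * (s - 1).
Proof.
by move=> h; rewrite gB_up; [rewrite (@pl_at _ 2 _ _ 0) //=; [field|knots]|lra].
Qed.

Lemma gB_up2 s : 3 / 2 <= s <= 2 -> gB s = 2 * (2 - s).
Proof.
by move=> h; rewrite gB_up; [rewrite (@pl_at _ 2 _ _ 1) //=; [field|knots]|lra].
Qed.

Lemma gB_up3 s : 2 <= s -> gB s = 0.
Proof.
by move=> h; rewrite gB_up; [rewrite pl_hi //=; knots|lra].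
Qed.
Definition plat : set sp :=
  strand xA gA (- (2 * n)%:R - 2^-1) (15 / 4) `|`
  (strand xB gB (- (2 * n)%:R) (15 / 4) `|`
   (strand xr (fun=> 0) (- (2 * n)%:R) 3 `|`
    strand xs gs (- (2 * n)%:R - 2^-1) 3)).

Lemma strand_eq_segment (f g : R -> R) a b x x' z z' : a < b ->
  (forall y, a <= y <= b -> f y = x + (x' - x) / (b - a) * (y - a)) ->
  (forall y, a <= y <= b -> g y = z + (z' - z) / (b - a) * (y - a)) ->
  strand f g a b = segment (x, a, z) (x', b, z').
Proof.
move=> ab hf hg.
have aff (h : R -> R) w w' :
    (forall y, a <= y <= b -> h y = w + (w' - w) / (b - a) * (y - a)) ->
    affine_on h a b.
  move=> hh; apply: (@affine_onP _ _ a b (w - (w' - w) / (b - a) * a) ((w' - w) / (b - a))) => //; last exact: ltW.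
  by move=> y yab; rewrite hh //; ring.
rewrite strand_segment ?(ltW ab) //; [|exact: aff hf|exact: aff hg].
have ba : b - a != 0 by rewrite subr_eq0 gt_eqF.
by rewrite !hf ?hg ?lexx ?(ltW ab) // !subrr !mulr0 !addr0 !divfK // ![_ + (_ - _)]addrC !subrK.
Qed.

Definition bend (Y : R) : R := pl 3 (lst [:: 1; 2; 3; 4]) (lst [:: 0; 1; 3; 15 / 4]) Y.

Lemma bend0 Y : Y <= 1 -> bend Y = 0.
Proof. by move=> h; rewrite /bend pl_lo //=; knots. Qed.

Lemma bend1 Y : 1 <= Y <= 2 -> bend Y = Y - 1.
Proof. by move=> h; rewrite /bend (@pl_at _ 3 _ _ 0) //=; [field|knots]. Qed.

Lemma bend2 Y : 2 <= Y <= 3 -> bend Y = 2 * Y - 3.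
Proof. by move=> h; rewrite /bend (@pl_at _ 3 _ _ 1) //=; [field|knots]. Qed.

Lemma bend3 Y : 3 <= Y <= 4 -> bend Y = 3 / 4 * (Y + 1).
Proof. by move=> h; rewrite /bend (@pl_at _ 3 _ _ 2) //=; [field|knots]. Qed.

(** The standard projection, turned by a quarter and bent so that the twist
    region is vertical and the clasp becomes monotone. *)
Definition straighten (p : sp) : sp := (p.1.2, - p.1.1 + bend p.1.2, p.2).

Lemma isotopic_straighten K : isotopic K (straighten @` K).
Proof.
have c : continuous (fun q : R * R => bend q.1).
  by have := @pl_continuous R 3 (lst [:: 1; 2; 3; 4]) (lst [:: 0; 1; 3; 15 / 4]); rewrite /bend => c; cont.
have := isotopic_trans (quarter_turn_z K) (shear_y (phi := fun x _ => bend x) _ c).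
by rewrite image_comp.
Qed.

Lemma straighten_segment (a b : sp) :
  (forall t, 0 <= t <= 1 -> bend (a.1.2 + t * (b.1.2 - a.1.2)) =
     bend a.1.2 + t * (bend b.1.2 - bend a.1.2)) ->
  straighten @` segment a b = segment (straighten a) (straighten b).
Proof.
move=> h; apply: image_segment => t t01; rewrite /straighten /=.
congr (_, _, _); rewrite /GRing.scale /= h //.
by rewrite -[t *: _]/(t * _); ring.
Qed.
End Plat.

Section TwistPlat.
Context {R : realType} (n : nat).
Notation sp := (R * R * R)%type.
Hypothesis n0 : (0 < n)%N.
Let n1 : (1 : R) <= n%:R. Proof. by rewrite ler1n. Qed.
Let m0 : (0 : R) <= (2 * n)%:R. Proof. by []. Qed.
Let nn : (2 * n)%:R = (2 : R) * n%:R. Proof. by rewrite natrM. Qed.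
Ltac slra := have ? := n1; have ? := m0; have ? := nn; lra.
Ltac nz := repeat (apply/andP; split);
  first [by [] | apply: lt0r_neq0; slra | apply: ltr0_neq0; slra].

Lemma scaleRE (a b : R) : a *: b = a * b.
Proof. by []. Qed.

Lemma straighten_lin (c d lo hi : R) (a b : sp) :
  (forall y, lo <= y <= hi -> bend y = c + d * y) ->
  lo <= a.1.2 <= hi -> lo <= b.1.2 <= hi ->
  straighten @` segment a b =
  segment (a.1.2, - a.1.1 + (c + d * a.1.2), a.2) (b.1.2, - b.1.1 + (c + d * b.1.2), b.2).
Proof.
move=> h ha hb; rewrite straighten_segment.
  by rewrite /straighten !h.
move=> t /andP[t0 t1].
rewrite (h _ ha) (h _ hb) h; first by ring.
move: ha hb => /andP[a0 a1] /andP[b0 b1]; apply/andP; split.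
  have -> : a.1.2 + t * (b.1.2 - a.1.2) = (1 - t) * a.1.2 + t * b.1.2 by ring.
  have -> : lo = (1 - t) * lo + t * lo by ring.
  by rewrite lerD // ler_wpM2l // subr_ge0.
have -> : a.1.2 + t * (b.1.2 - a.1.2) = (1 - t) * a.1.2 + t * b.1.2 by ring.
have -> : hi = (1 - t) * hi + t * hi by ring.
by rewrite lerD // ler_wpM2l // subr_ge0.
Qed.

Definition straighten_p0 := @straighten_lin 0 0 0 1.
Definition straighten_p1 := @straighten_lin (-1) 1 1 2.
Definition straighten_p2 := @straighten_lin (-3) 2 2 3.
Definition straighten_p3 := @straighten_lin (3 / 4) (3 / 4) 3 4.

Lemma segment_eq (a b a' b' : sp) : a = a' -> b = b' -> segment a b = segment a' b'.
Proof. by move=> -> ->. Qed.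

Ltac pts := apply: segment_eq; (congr (_, _, _)); rewrite /=; first [by field | field; nz].
Ltac p0 := rewrite straighten_p0 /=; [pts | move=> y yab; rewrite (bend0 n0); lra | lra | lra].
Ltac p1 := rewrite straighten_p1 /=; [pts | move=> y yab; rewrite (bend1 n0); lra | lra | lra].
Ltac p2 := rewrite straighten_p2 /=; [pts | move=> y yab; rewrite (bend2 n0); lra | lra | lra].
Ltac p3 := rewrite straighten_p3 /=; [pts | move=> y yab; rewrite (bend3 n0); lra | lra | lra].

Lemma straighten_half_twist k : (k < 2 * n)%N ->
  straighten @` half_twist (1 : R) k =
  strand (xA n) (gA n) (- k.+1%:R) (- k%:R) `|` strand (xB n) (gB n) (- k.+1%:R) (- k%:R).
Proof.
move=> kn; rewrite /half_twist /raised_edge /flat_edge ?image_setU.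
have kS : k.+1%:R = k%:R + 1 :> R by rewrite natr1.
have k0 : (0 : R) <= k%:R by [].
have kn' : (k%:R : R) + 1 <= (2 * n)%:R by rewrite natr1 ler_nat.
set z : sp := (_, 1).
have zE : z = (k%:R + 2^-1, 2^-1, 1) by rewrite /z /=; congr (_, _, _);
  rewrite /GRing.scale /= ?kS; field.
rewrite {}zE kS.
have -> : straighten @` segment (k%:R, 0, 0) (k%:R + 2^-1, 2^-1, 1 : R) =
   segment (0, - k%:R, 0) (2^-1, - k%:R - 2^-1, 1 : R) by p0.
have -> : straighten @` segment (k%:R + 2^-1, 2^-1, 1 : R) (k%:R + 1, 1, 0) =
   segment (2^-1, - k%:R - 2^-1, 1 : R) (1, - k%:R - 1, 0) by p0.
have -> : straighten @` segment (k%:R, 1, 0) (k%:R + 1, 0, 0 : R) =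
   segment (1, - k%:R, 0) (0, - k%:R - 1, 0 : R) by p0.
rewrite opprD.
have up (f g : R -> R) :
    (forall y : R, - k%:R - 1 <= y <= - k%:R -> f y = - y - k%:R) ->
    (forall y : R, - k%:R - 1 <= y <= - k%:R -> g y = tent (- y - k%:R)) ->
    strand f g (- k%:R - 1) (- k%:R) =
    segment (0, - k%:R, 0) (2^-1, - k%:R - 2^-1, 1 : R) `|`
    segment (2^-1, - k%:R - 2^-1, 1 : R) (1, - k%:R - 1, 0).
  move=> hf hg; rewrite (@strand_cat _ _ _ _ (- k%:R - 2^-1)); [|lra|lra].
  rewrite setUC; congr (_ `|` _); rewrite segmentC; apply: strand_eq_segment.
  - lra.
  - by move=> y yab; rewrite hf; [field; nz | lra].
  - move=> y yab; rewrite hg /tent; last by lra.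
    by rewrite ler0_norm; [field; nz | lra].
  - lra.
  - by move=> y yab; rewrite hf; [field; nz | lra].
  - move=> y yab; rewrite hg /tent; last by lra.
    by rewrite ger0_norm; [field; nz | lra].
have down (f g : R -> R) :
    (forall y : R, - k%:R - 1 <= y <= - k%:R -> f y = 1 - (- y - k%:R)) ->
    (forall y : R, - k%:R - 1 <= y <= - k%:R -> g y = 0) ->
    strand f g (- k%:R - 1) (- k%:R) =
    segment (1, - k%:R, 0) (0, - k%:R - 1, 0 : R).
  move=> hf hg; rewrite segmentC; apply: strand_eq_segment.
  - lra.
  - by move=> y yab; rewrite hf; [field; nz | lra].
  - by move=> y yab; rewrite hg //; ring.
have kk (y : R) : - k%:R - 1 <= y <= - k%:R -> k%:R <= - y <= k.+1%:R by rewrite kS; lra.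
have ez (y : R) : - k%:R - 1 <= y <= - k%:R -> - (2 * n)%:R <= y <= 0 by lra.
have [ok|ok] := boolP (odd k).
  rewrite setUC (up (xB n)) 1?(down (xA n)) //.
  - by move=> y yk; rewrite (xA_braid n0) ?(ez y) // (zig_piece kn (kk y yk)) ok.
  - by move=> y yk; rewrite (gA_piece n0 kn (kk y yk)) ok.
  - move=> y yk; rewrite (xB_braid n0) ?(zig_piece kn (kk y yk)) ?ok; first by ring.
    by lra.
  - by move=> y yk; rewrite (gB_piece n0 kn (kk y yk)) ok.
rewrite (up (xA n)) 1?(down (xB n)) //.
- move=> y yk; rewrite (xB_braid n0) ?(zig_piece kn (kk y yk)) ?(negbTE ok) //.
  by lra.
- by move=> y yk; rewrite (gB_piece n0 kn (kk y yk)) (negbTE ok).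
- by move=> y yk; rewrite (xA_braid n0) ?(ez y) // (zig_piece kn (kk y yk)) (negbTE ok).
- by move=> y yk; rewrite (gA_piece n0 kn (kk y yk)) (negbTE ok).
Qed.

Lemma strand_braid (f g : R -> R) (m : nat) : (0 < m)%N ->
  strand f g (- m%:R) 0 =
  \bigcup_(k in `I_m) strand f g (- k.+1%:R) (- k%:R).
Proof.
move=> mp; apply/seteqP; split=> [[[x y] z] [/= yab -> ->]|[[x y] z] [k /= km [/= yab -> ->]]].
  have [|k km ky] := @knots_piece R m (fun i => i%:R) (- y) mp; first by rewrite /=; lra.
  by exists k => //; split=> //=; lra.
split=> //=; have : k.+1%:R <= m%:R :> R by rewrite ler_nat.
have : 0 <= k%:R :> R by [].
by lra.
Qed.

Lemma straighten_twist_knot :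
  straighten @` (twist_knot false (2 * n) : set sp) = plat n.
Proof.
have n2 : (0 < 2 * n)%N by rewrite muln_gt0.
rewrite /twist_knot !image_setU image_bigcup.
rewrite (eq_bigcupr (F := fun k => straighten @` half_twist 1 k)
   (G := fun k => strand (xA n) (gA n) (- k.+1%:R) (- k%:R) `|`
      strand (xB n) (gB n) (- k.+1%:R) (- k%:R))); last first.
  by move=> k kn; exact: straighten_half_twist.
rewrite bigcupU -!strand_braid // /clasp /closing_arcs /raised_edge /flat_edge ?image_setU.
set z1 : sp := (_, 1); set z2 : sp := (_, 1).
have z1E : z1 = (2^-1, 5 / 2, 1).
  by rewrite /z1 /=; congr (_, _, _); rewrite /= ?scaleRE; field.
have z2E : z2 = (2^-1, 7 / 2, 1).
  by rewrite /z2 /=; congr (_, _, _); rewrite /= ?scaleRE; field.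
rewrite {}z1E {}z2E.
pose m : R := (2 * n)%:R; rewrite -/m.
have mE : m = 2 * n%:R by rewrite /m nn.
have mp : 0 <= m by rewrite /m.
have -> : straighten @` segment (0, 4, 0) (1, 3, 0 : R) = segment (4, 15 / 4, 0) (3, 2, 0 : R) by p3.
have -> : straighten @` segment (1, 3, 0) (2^-1, 5 / 2, 1 : R) = segment (3, 2, 0) (5 / 2, 3 / 2, 1 : R) by p2.
have -> : straighten @` segment (2^-1, 5 / 2, 1) (0, 2, 0 : R) = segment (5 / 2, 3 / 2, 1) (2, 1, 0 : R) by p2.
have -> : straighten @` segment (1, 4, 0) (2^-1, 7 / 2, 1 : R) = segment (4, 11 / 4, 0) (7 / 2, 23 / 8, 1 : R) by p3.
have -> : straighten @` segment (2^-1, 7 / 2, 1) (0, 3, 0 : R) = segment (7 / 2, 23 / 8, 1) (3, 3, 0 : R) by p3.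
have -> : straighten @` segment (0, 3, 0) (1, 2, 0 : R) = segment (3, 3, 0) (2, 0, 0 : R) by p2.
have -> : straighten @` segment (0, 1, 0) (0, 2, 0 : R) = segment (1, 0, 0) (2, 1, 0 : R) by p1.
have -> : straighten @` segment (0, 0, 0) (-1, 2, 0 : R) =
    segment (0, 0, 0) (1, 2^-1, 0 : R) `|` segment (1, 2^-1, 0) (2, 2, 0 : R).
  rewrite (@segment_cat _ _ _ _ 2^-1); last by lra.
  rewrite image_setU (_ : _ + 2^-1 *: _ = (- 2^-1, 1, 0)); last first.
    by congr (_, _, _); rewrite /= ?scaleRE; field.
  by congr (_ `|` _); [p0 | p1].
have -> : straighten @` segment (-1, 2, 0) (0, 4, 0 : R) =
    segment (2, 2, 0) (3, 7 / 2, 0 : R) `|` segment (3, 7 / 2, 0) (4, 15 / 4, 0 : R).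
  rewrite (@segment_cat _ _ _ _ 2^-1); last by lra.
  rewrite image_setU (_ : _ + 2^-1 *: _ = (- 2^-1, 3, 0)); last first.
    by congr (_, _, _); rewrite /= ?scaleRE; field.
  by congr (_ `|` _); [p2 | p3].
have -> : straighten @` segment (m, 1, 0) (1, 2, 0 : R) = segment (1, - m, 0) (2, 0, 0 : R) by p1.
have -> : straighten @` segment (m, 0, 0) (m + 1, 2, 0 : R) =
    segment (0, - m, 0) (1, - m - 2^-1, 0 : R) `|` segment (1, - m - 2^-1, 0) (2, - m, 0 : R).
  rewrite (@segment_cat _ _ _ _ 2^-1); last by lra.
  rewrite image_setU (_ : _ + 2^-1 *: _ = (m + 2^-1, 1, 0)); last first.
    by congr (_, _, _); rewrite /= ?scaleRE; field.
  by congr (_ `|` _); [p0 | p1].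
have -> : straighten @` segment (m + 1, 2, 0) (1, 4, 0 : R) =
    segment (2, - m, 0) (3, 2 - n%:R, 0 : R) `|` segment (3, 2 - n%:R, 0) (4, 11 / 4, 0 : R).
  rewrite (@segment_cat _ _ _ _ 2^-1); last by lra.
  rewrite image_setU (_ : _ + 2^-1 *: _ = (n%:R + 1, 3, 0)); last first.
    by congr (_, _, _); rewrite /= ?scaleRE ?mE; field.
  by rewrite mE; congr (_ `|` _); [p2 | p3].
rewrite /plat -/m.
have SA0 : strand (xA n) (gA n) (- m - 2^-1) (- m) =
    segment (0, - m, 0) (1, - m - 2^-1, 0 : R).
  rewrite segmentC; apply: strand_eq_segment; [lra | move=> y yab..].
    by rewrite xA_low // -/m; field; nz.
  by rewrite (gA_out n0); [ring |  left; rewrite -/m; lra].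
have SA1 : strand (xA n) (gA n) 0 2^-1 = segment (0, 0, 0) (1, 2^-1, 0 : R).
  apply: strand_eq_segment; [lra | move=> y yab..].
    by rewrite (xA_up0 n0) //; field; nz.
  by rewrite (gA_out n0); [ring |  right; lra].
have SA2 : strand (xA n) (gA n) 2^-1 2 = segment (1, 2^-1, 0) (2, 2, 0 : R).
  apply: strand_eq_segment; [lra | move=> y yab..].
    by rewrite (xA_up1 n0) //; [field; nz | lra].
  by rewrite (gA_out n0); [ring |  right; lra].
have SA3 : strand (xA n) (gA n) 2 (7 / 2) = segment (2, 2, 0) (3, 7 / 2, 0 : R).
  apply: strand_eq_segment; [lra | move=> y yab..].
    by rewrite (xA_up1 n0) //; [field; nz | lra].
  by rewrite (gA_out n0); [ring |  right; lra].
have SA4 : strand (xA n) (gA n) (7 / 2) (15 / 4) = segment (3, 7 / 2, 0) (4, 15 / 4, 0 : R).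
  apply: strand_eq_segment; [lra | move=> y yab..].
    by rewrite (xA_up2 n0) //; field; nz.
  by rewrite (gA_out n0); [ring |  right; lra].
have SB1 : strand (xB n) (gB n) 0 1 = segment (1, 0, 0) (2, 1, 0 : R).
  apply: strand_eq_segment; [lra | move=> y yab..].
    by rewrite (xB_up0 n0) //; [field; nz | lra].
  by rewrite (gB_up0 n0) //; ring.
have SB2 : strand (xB n) (gB n) 1 (3 / 2) = segment (5 / 2, 3 / 2, 1) (2, 1, 0 : R).
  rewrite segmentC; apply: strand_eq_segment; [lra | move=> y yab..].
    by rewrite (xB_up0 n0) //; [field; nz | lra].
  by rewrite (gB_up1 n0) //; field; nz.
have SB3 : strand (xB n) (gB n) (3 / 2) 2 = segment (3, 2, 0) (5 / 2, 3 / 2, 1 : R).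
  rewrite segmentC; apply: strand_eq_segment; [lra | move=> y yab..].
    by rewrite (xB_up0 n0) //; [field; nz | lra].
  by rewrite (gB_up2 n0) //; field; nz.
have SB4 : strand (xB n) (gB n) 2 (15 / 4) = segment (4, 15 / 4, 0) (3, 2, 0 : R).
  rewrite segmentC; apply: strand_eq_segment; [lra | move=> y yab..].
    by rewrite (xB_up1 n0) //; field; nz.
  by rewrite (gB_up3 n0) //; [ring | lra].
have SR0 : strand (xr n) (fun=> 0) (- m) 0 = segment (1, - m, 0) (2, 0, 0 : R).
  apply: strand_eq_segment; [slra | move=> y yab..]; last by ring.
  by rewrite xr0 // -/m mE; field; nz.
have SR1 : strand (xr n) (fun=> 0) 0 3 = segment (3, 3, 0) (2, 0, 0 : R).
  rewrite segmentC; apply: strand_eq_segment; [lra | move=> y yab..]; last by ring.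
  by rewrite (xr1 n0) //; field; nz.
have SS0 : strand (xs n) gs (- m - 2^-1) (- m) =
    segment (1, - m - 2^-1, 0) (2, - m, 0 : R).
  apply: strand_eq_segment; [lra | move=> y yab..].
    by rewrite (xs0 n0) // -/m; field; nz.
  by rewrite (gs0 n0); [ring | lra].
have SS1 : strand (xs n) gs (- m) (2 - n%:R) = segment (2, - m, 0) (3, 2 - n%:R, 0 : R).
  apply: strand_eq_segment; [slra | move=> y yab..].
    by rewrite (xs1 n0) // ?mE; field; nz.
  by rewrite (gs0 n0); [ring | slra].
have SS2 : strand (xs n) gs (2 - n%:R) (11 / 4) = segment (3, 2 - n%:R, 0) (4, 11 / 4, 0 : R).
  apply: strand_eq_segment; [slra | move=> y yab..].
    by rewrite (xs2 n0) //; field; nz.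
  by rewrite (gs0 n0); [ring | lra].
have SS3 : strand (xs n) gs (11 / 4) (23 / 8) = segment (4, 11 / 4, 0) (7 / 2, 23 / 8, 1 : R).
  apply: strand_eq_segment; [lra | move=> y yab..].
    by rewrite (xs3 n0) //; [field; nz | lra].
  by rewrite (gs1 n0) //; field; nz.
have SS4 : strand (xs n) gs (23 / 8) 3 = segment (7 / 2, 23 / 8, 1) (3, 3, 0 : R).
  apply: strand_eq_segment; [lra | move=> y yab..].
    by rewrite (xs3 n0) //; [field; nz | lra].
  by rewrite (gs2 n0) //; field; nz.
rewrite (@strand_cat _ (xA n) _ (- m - 2^-1) (- m) (15 / 4)); [|slra|slra].
rewrite (@strand_cat _ (xA n) _ (- m) (0) (15 / 4)); [|slra|slra].
rewrite (@strand_cat _ (xA n) _ (0) (2^-1) (15 / 4)); [|slra|slra].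
rewrite (@strand_cat _ (xA n) _ (2^-1) (2) (15 / 4)); [|slra|slra].
rewrite (@strand_cat _ (xA n) _ (2) (7 / 2) (15 / 4)); [|slra|slra].
rewrite (@strand_cat _ (xB n) _ (- m) (0) (15 / 4)); [|slra|slra].
rewrite (@strand_cat _ (xB n) _ (0) (1) (15 / 4)); [|slra|slra].
rewrite (@strand_cat _ (xB n) _ (1) (3 / 2) (15 / 4)); [|slra|slra].
rewrite (@strand_cat _ (xB n) _ (3 / 2) (2) (15 / 4)); [|slra|slra].
rewrite (@strand_cat _ (xr n) _ (- m) (0) (3)); [|slra|slra].
rewrite (@strand_cat _ (xs n) _ (- m - 2^-1) (- m) (3)); [|slra|slra].
rewrite (@strand_cat _ (xs n) _ (- m) (2 - n%:R) (3)); [|slra|slra].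
rewrite (@strand_cat _ (xs n) _ (2 - n%:R) (11 / 4) (3)); [|slra|slra].
rewrite (@strand_cat _ (xs n) _ (11 / 4) (23 / 8) (3)); [|slra|slra].
rewrite SA0 SA1 SA2 SA3 SA4 SB1 SB2 SB3 SB4 SR0 SR1 SS0 SS1 SS2 SS3 SS4.
by apply/seteqP; split=> p; rewrite /setU /=; tauto.
Qed.

Lemma isotopic_twist_knot : isotopic ((twist_knot false (2 * n) : set sp)) (plat n).
Proof. by rewrite -straighten_twist_knot; exact: isotopic_straighten. Qed.
End TwistPlat.

Section Unravel.
Context {R : realType} (n : nat).
Notation sp := (R * R * R)%type.
Variables (de yL yE yR : R) (fA fB Psi : R -> R).
Implicit Types s t x y z d u g : R.
Hypothesis n0 : (0 < n)%N.
Hypothesis de_gt0 : 0 < de.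
Hypothesis de_le : de <= 60^-1.
Hypothesis yEL : yE - yL = 3 / 4 * (4 + de).
Hypothesis yER : yE < yR.
Hypothesis yR0 : yR < 0.
Hypothesis yRL : yR - yL <= 11.
Hypothesis cfA : continuous fA.
Hypothesis cfB : continuous fB.
Hypothesis cPsi : continuous Psi.
Hypothesis fA_lo : forall y : R, yL <= y <= yE -> fA y = - 4 + 4 / 3 * (y - yL).
Hypothesis fA_mid : forall y : R, yE <= y <= 10 -> 0 <= fA y <= de.
Hypothesis fA_near : forall y : R, 9 <= y <= 19 / 2 -> fA y <= 4 / 3 * (19 / 2 - y).
Hypothesis fB_top : forall y : R, 0 <= y <= 62 / 5 -> fB y = fA y.
Hypothesis fB_cross : forall k (y : R), (k < 2 * n)%N -> `|Psi y + k%:R + 2^-1| <= 8^-1 ->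
  if odd k then fB y <= - (de / 4) else 5 / 4 * de <= fB y.
Hypothesis fB_bound : forall y : R, yR <= y <= 0 -> - 1 <= fB y <= 4.
Hypothesis fB_low : forall y : R, 0 <= Psi y + 2 * n%:R <= 4^-1 ->
  fB y = 4 - 16 * (Psi y + 2 * n%:R).
Hypothesis fB_below : forall y : R, y <= yR -> fB y = 4.
Hypothesis Psi_lt : forall y z, y < z -> Psi y < Psi z.
Hypothesis Psi_low : forall y : R, yL <= y <= yR ->
  Psi y + 2 * n%:R + 2^-1 = (y - yL) / (2 * (yR - yL)).
Hypothesis Psi_up : forall y : R, 0 <= y <= 19 / 2 -> Psi y = 6 / 19 * y.
Hypothesis Psi_up' : forall y : R, 19 / 2 <= y <= 62 / 5 ->
  Psi y = 3 + 15 / 58 * (y - 19 / 2).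
Hypothesis Psi_bound : exists M : R, forall y, `|Psi y - y| <= M.

Definition rise (d y : R) : R := d - 2 * d * Num.max 0 (y - 9).

Definition fade (y : R) : R := clamp 0 1 (2 - 16 * `|Psi y + 2 * n%:R|).

Definition offset (x y : R) : R :=
  fA y + (fB y - fA y) * fade y * clamp 0 1 (2 * x - 2^-1).

Definition dB (y : R) : R := - fB y + offset (xB n (Psi y)) y.
Definition dr (y : R) : R := rise (-4) y + offset (xr n (Psi y)) y.
Definition ds (y : R) : R := rise 4 y + offset (xs n (Psi y)) y.

Lemma Psi_le (y z : R) : y <= z -> Psi y <= Psi z.
Proof. by rewrite le_eqVlt => /orP[/eqP -> //|/Psi_lt/ltW]. Qed.

Lemma time_le_inv (y z : R) : Psi y <= Psi z -> y <= z.
Proof. by move=> h; rewrite leNgt; apply/negP => /Psi_lt; rewrite ltNge h. Qed.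

Lemma Psi_R : Psi yR = - (2 * n)%:R.
Proof.
have h : yR - yL != 0 by rewrite subr_eq0 gt_eqF //; move: yEL de_gt0 yER; lra.
have := @Psi_low yR; rewrite lexx andbT => /(_ _).
have -> : yL <= yR by move: yEL de_gt0 yER; lra.
move=> /(_ isT) E; have : (yR - yL) / (2 * (yR - yL)) = 2^-1 by field.
by move: E; rewrite natrM; lra.
Qed.

Lemma Psi_L : Psi yL = - (2 * n)%:R - 2^-1.
Proof.
have := @Psi_low yL; rewrite lexx /= subrr mul0r => /(_ _).
have -> : yL <= yR by move: yEL de_gt0 yER; lra.
by move=> /(_ isT); rewrite natrM; lra.
Qed.

Lemma Psi_tip : Psi (62 / 5) = 15 / 4.
Proof. by rewrite Psi_up'; [field | lra]. Qed.

Lemma Psi_0 : Psi 0 = 0.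
Proof. by rewrite Psi_up ?mulr0 //; lra. Qed.

Lemma braid_cases (s : R) : - (2 * n)%:R <= s <= 0 -> exists k, exists t : R,
  [/\ (k < 2 * n)%N, 0 <= t <= 1, s = - k%:R - t,
      zig n s = (if odd k then 1 - t else t) &
      (gA n s = (if odd k then 0 else tent t)) /\
      (gB n s = (if odd k then tent t else 0))].
Proof.
move=> h; have n2 : (0 < 2 * n)%N by rewrite muln_gt0.
have [|k kn ks] := @knots_piece R (2 * n) (fun i => i%:R) (- s) n2; first by rewrite /=; lra.
exists k, (- s - k%:R); split=> //.
- by move: ks; rewrite -natr1; lra.
- by ring.
- exact: zig_piece.
- by rewrite (gA_piece n0 kn ks) (gB_piece n0 kn ks).
Qed.

Lemma zig_end (s : R) : 0 <= s + (2 * n)%:R <= 1 -> zig n s = s + (2 * n)%:R.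
Proof.
move=> h; have n2 : (0 < 2 * n)%N by rewrite muln_gt0.
have kn : ((2 * n).-1 < 2 * n)%N by rewrite prednK.
have E : (2 * n).-1%:R = (2 * n)%:R - 1 :> R.
  by rewrite -[in RHS](prednK n2) -natr1 addrK.
rewrite (zig_piece kn) E ?prednK //; last by lra.
have -> : odd (2 * n).-1.
  by rewrite -[odd _]negbK -[~~ odd _]/(odd (2 * n).-1.+1) prednK // oddM.
by ring.
Qed.

Lemma fade_off (y : R) : 8^-1 <= `|Psi y + 2 * n%:R| -> fade y = 0.
Proof. by move=> h; rewrite /fade clamp_lo //; lra. Qed.

Lemma fade_on (y : R) : `|Psi y + 2 * n%:R| <= 16^-1 -> fade y = 1.
Proof. by move=> h; rewrite /fade clamp_hi //; lra. Qed.

Lemma fade01 (y : R) : 0 <= fade y <= 1.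
Proof. by rewrite /fade /clamp le_min ler01 le_max lexx /= ge_min lexx. Qed.

Lemma fade_pos (y : R) : 0 <= Psi y -> fade y = 0.
Proof.
move=> h; apply: fade_off; rewrite ger0_norm.
  by have : (1 : R) <= n%:R; [rewrite ler1n | lra].
by rewrite addr_ge0 // mulr_ge0.
Qed.

Lemma range_R (y : R) : yR <= y -> - (2 * n)%:R <= Psi y.
Proof. by rewrite -Psi_R; exact: Psi_le. Qed.

Lemma range_L (y : R) : yL <= y -> - (2 * n)%:R - 2^-1 <= Psi y.
Proof. by rewrite -Psi_L; exact: Psi_le. Qed.

Lemma range_tip (y : R) : y <= 62 / 5 -> Psi y <= 15 / 4.
Proof. by rewrite -Psi_tip; exact: Psi_le. Qed.

Lemma Psi_top : Psi (19 / 2) = 3.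
Proof. by rewrite Psi_up; [field | lra]. Qed.

Lemma range_top (y : R) : y <= 19 / 2 -> Psi y <= 3.
Proof. by rewrite -Psi_top; exact: Psi_le. Qed.

Lemma Psi_ge0 (y : R) : (0 <= Psi y) = (0 <= y).
Proof.
by apply/idP/idP => h; [apply: time_le_inv; rewrite Psi_0 | rewrite -Psi_0; exact: Psi_le].
Qed.

Lemma zig01 (s : R) : 0 <= zig n s <= 1.
Proof.
case: (lerP s (- (2 * n)%:R)) => h; first by rewrite zig_hi // lexx ler01.
case: (lerP 0 s) => h'; first by rewrite zig_lo // lexx ler01.
have [|k [t [_ t01 _ -> _]]] := @braid_cases s; first by rewrite !ltW.
by case: ifP => _; lra.
Qed.

Lemma offset_A (y : R) : yL <= y <= 62 / 5 -> offset (xA n (Psi y)) y = fA y.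
Proof.
move=> /andP[yl yt]; rewrite /offset.
have [h|h] := lerP 8^-1 `|Psi y + 2 * n%:R|; first by rewrite fade_off // mulr0 mul0r addr0.
rewrite (_ : clamp 0 1 _ = 0) ?mulr0 ?addr0 // clamp_lo //.
have nn : (2 * n)%:R = (2 : R) * n%:R by rewrite natrM.
have n1 : (1 : R) <= n%:R by rewrite ler1n.
move: h; rewrite ltr_norml => h; have lo := range_L yl.
case: (lerP (Psi y) (- (2 * n)%:R)) => h'.
  by rewrite xA_low ?lo //; lra.
rewrite (xA_braid n0); last by lra.
by rewrite zig_end; lra.
Qed.

Lemma offset_1 (x y : R) : 3 / 4 <= x -> offset x y = fA y + (fB y - fA y) * fade y.
Proof. by move=> h; rewrite /offset (clamp_hi (y := _ - _)) ?mulr1 //; lra. Qed.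

Lemma dB_eq (y : R) : yR <= y <= 62 / 5 -> dB y = (fA y - fB y) * (1 - fade y).
Proof.
move=> /andP[yl yt]; rewrite /dB.
have nn : (2 * n)%:R = (2 : R) * n%:R by rewrite natrM.
have n1 : (1 : R) <= n%:R by rewrite ler1n.
have [h|h] := lerP 8^-1 `|Psi y + 2 * n%:R|.
  by rewrite /offset fade_off //; ring.
have lo := range_R yl; move: h; rewrite ltr_norml => h.
rewrite offset_1; first by ring.
by rewrite (xB_braid n0) ?zig_end; lra.
Qed.

Lemma xr_ge (s : R) : - (2 * n)%:R <= s <= 0 -> xr n s = 1 + (s + (2 * n)%:R) / (2 * n)%:R.
Proof.
move=> h; rewrite xr0 //; field.
by rewrite pnatr_eq0 -lt0n.
Qed.

Lemma xr_ge1 (s : R) : - (2 * n)%:R <= s <= 3 -> 1 <= xr n s.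
Proof.
move=> h; case: (lerP s 0) => s0; last by rewrite (xr1 n0); lra.
by rewrite xr_ge ?lerDl ?divr_ge0 //; lra.
Qed.

Lemma xs_up (s : R) : 0 <= s <= 11 / 4 -> 8 / 3 + s / 3 <= xs n s.
Proof.
move=> h; have n1 : (1 : R) <= n%:R by rewrite ler1n.
have nn : (2 * n)%:R = (2 : R) * n%:R by rewrite natrM.
have n12 : n%:R = 1 :> R \/ (2 : R) <= n%:R.
  by case: (n) n0 => [//|[|k]] _; [left | right; rewrite ler_nat].
case: (lerP s (2 - n%:R)) => h'.
  rewrite (xs1 n0); last by lra.
  case: n12 => E; first by rewrite E (_ : 1 + 2 = 3 :> R); [lra | ring].
  have -> : s = 0 by lra.
  have E2 : n%:R = 2 :> R by lra.
  by rewrite E2 (_ : 2 + 2 = 4 :> R); [lra | ring].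
rewrite (xs2 n0); last by lra.
have d0 : 0 < n%:R + 3 / 4 :> R by lra.
suff : (s - 1) / 3 <= (s + n%:R - 2) / (n%:R + 3 / 4) by lra.
rewrite ler_pdivlMr // -subr_ge0.
have -> : s + n%:R - 2 - (s - 1) / 3 * (n%:R + 3 / 4) =
  ((11 / 4 - s) * (n%:R - 9 / 4) + (n%:R * 5 / 4 + 15 / 16)) / 3 by field.
rewrite divr_ge0 //; case: n12 => E; first by rewrite E; lra.
have [E2|E2] := lerP (9 / 4 : R) n%:R.
  have : 0 <= (11 / 4 - s) * (n%:R - 9 / 4) by rewrite mulr_ge0; lra.
  by lra.
have : 0 <= s * (9 / 4 - n%:R) by rewrite mulr_ge0; lra.
by lra.
Qed.

Lemma xs_braid (s : R) : - (2 * n)%:R <= s <= 0 -> 2 <= xs n s /\ xr n s + 2^-1 <= xs n s.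
Proof.
move=> h; have n1 : (1 : R) <= n%:R by rewrite ler1n.
have nn : (2 * n)%:R = (2 : R) * n%:R by rewrite natrM.
have n12 : n%:R = 1 :> R \/ (2 : R) <= n%:R.
  by case: (n) n0 => [//|[|k]] _; [left | right; rewrite ler_nat].
have xr2 : xr n s <= 2 by rewrite xr0 // gerDl pmulr_lle0 ?invr_gt0; lra.
case: (lerP s (2 - n%:R)) => h'; last first.
  rewrite (xs2 n0); last by lra.
  have : 0 <= (s + n%:R - 2) / (n%:R + 3 / 4) by rewrite divr_ge0; lra.
  by lra.
rewrite (xs1 n0) ?xr_ge //; last by lra.
have : 0 <= (s + 2 * n%:R) / (n%:R + 2) by rewrite divr_ge0; lra.
split; first by lra.
case: n12 => E.
  by move: nn h; rewrite E mulr1 => -> h; rewrite (_ : 1 + 2 = 3 :> R); [lra | ring].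
have : (s + (2 * n)%:R) / (2 * n)%:R <= (s + 2 * n%:R) / (n%:R + 2).
  rewrite nn ler_wpM2l //; first by lra.
  by rewrite lef_pV2 ?posrE; lra.
by lra.
Qed.

Lemma xs_ge1 (s : R) : - (2 * n)%:R - 2^-1 <= s <= 3 -> 1 <= xs n s.
Proof.
move=> h; case: (lerP s (- (2 * n)%:R)) => s0; first by rewrite (xs0 n0); lra.
case: (lerP s 0) => s1.
  by have [] := @xs_braid s; lra.
case: (lerP s (11 / 4)) => s2.
  by have := @xs_up s; lra.
by rewrite (xs3 n0); lra.
Qed.

Let n1 : (1 : R) <= n%:R. Proof. by rewrite ler1n. Qed.
Let nn : (2 * n)%:R = (2 : R) * n%:R. Proof. by rewrite natrM. Qed.

Definition avoids (x x0 z g g' : R) : Prop :=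
  [\/ `|g' - g| <= 100 * n%:R * `|x - x0|,
      `|g' - g| <= 20 / de * (Num.min g g' - z) |
      `|g' - g| <= 20 / de * (z - Num.max g g')].

Lemma avoids_refl x x0 z g : avoids x x0 z g g.
Proof. by apply: Or31; rewrite subrr normr0 !mulr_ge0. Qed.

Lemma avoids_x x x0 z g g' : `|g' - g| <= 100 * `|x - x0| -> avoids x x0 z g g'.
Proof.
move=> h; apply: Or31; apply: (le_trans h); rewrite -mulrA ler_pM2l //.
by rewrite ler_peMl.
Qed.

Lemma avoids_xn x x0 z g g' : `|g' - g| <= 50 -> 1 <= (2 * n)%:R * `|x - x0| ->
  avoids x x0 z g g'.
Proof.
move=> h h'; apply: Or31; apply: (le_trans h).
have -> : 100 * n%:R * `|x - x0| = 50 * ((2 * n)%:R * `|x - x0|) by rewrite nn; ring.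
by lra.
Qed.

Let below (d u : R) : d <= 5 -> de / 4 <= u -> d <= 20 / de * u.
Proof.
move=> h1 h2; apply: (le_trans h1).
have -> : 5 = 20 / de * (de / 4) by field; exact: lt0r_neq0.
by rewrite ler_pM2l // divr_gt0.
Qed.

Lemma avoids_below x x0 z g g' : `|g' - g| <= 5 -> z + de / 4 <= g ->
  z + de / 4 <= g' -> avoids x x0 z g g'.
Proof.
by move=> h h1 h2; apply: Or32; apply: below => //; rewrite lerBrDl le_min h1 h2.
Qed.

Lemma avoids_above x x0 z g g' : `|g' - g| <= 5 -> g + de / 4 <= z ->
  g' + de / 4 <= z -> avoids x x0 z g g'.
Proof.
move=> h h1 h2; apply: Or33; apply: below => //.
by rewrite lerBrDr addrC -lerBrDr ge_max !lerBrDr h1 h2.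
Qed.

Lemma tent01 t : 0 <= t <= 1 -> 0 <= tent t <= 1.
Proof. by rewrite /tent => h; case: (norm_cases (2 * t - 1)) => -[-> ?]; lra. Qed.

Lemma fA_bound y : yR <= y <= 10 -> 0 <= fA y <= de.
Proof. by move=> h; apply: fA_mid; move: yER; lra. Qed.

Lemma y_neg y : Psi y <= 0 -> y <= 0.
Proof. by move=> h; apply: time_le_inv; rewrite Psi_0. Qed.

Lemma y_le y s : 0 <= s <= 3 -> Psi y <= s -> y <= 19 / 6 * s.
Proof.
move=> h ys; case: (lerP y 0) => y0; first by lra.
have yt : y <= 19 / 2 by apply: time_le_inv; rewrite Psi_top; lra.
by move: ys; rewrite Psi_up; lra.
Qed.

Lemma y_ge y s : 0 <= s <= 3 -> s <= Psi y -> 19 / 6 * s <= y.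
Proof.
move=> h ys; apply: time_le_inv; rewrite Psi_up; lra.
Qed.

Lemma dB_up y : 0 <= y <= 62 / 5 -> dB y = 0.
Proof.
move=> h; rewrite dB_eq ?fB_top ?subrr ?mul0r //.
by move: yR0; lra.
Qed.

Lemma dB_bound y : yR <= y <= 62 / 5 -> `|dB y| <= 4 + de.
Proof.
move=> h; case: (lerP 0 y) => y0.
  by rewrite dB_up ?normr0; move: de_gt0; lra.
rewrite dB_eq // normrM (ger0_norm (_ : 0 <= 1 - _)); last by have := fade01 y; lra.
have h1 : 0 <= fA y <= de by apply: fA_bound; lra.
have h2 : -1 <= fB y <= 4 by apply: fB_bound; lra.
apply: (@le_trans _ _ (`|fA y - fB y|)).
  by rewrite ler_piMr //; have := fade01 y; lra.
by move: de_gt0; rewrite ler_norml; lra.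
Qed.

Lemma dr_eq y : yR <= y <= 19 / 2 ->
  dr y = rise (-4) y + fA y + (fB y - fA y) * fade y.
Proof.
move=> /andP[h1 h2]; rewrite /dr offset_1 ?addrA //.
have := range_R h1; have := range_top h2 => a b.
by have := @xr_ge1 (Psi y); lra.
Qed.

Lemma ds_eq y : yL <= y <= 19 / 2 ->
  ds y = rise 4 y + fA y + (fB y - fA y) * fade y.
Proof.
move=> /andP[h1 h2]; rewrite /ds offset_1 ?addrA //.
have := range_L h1; have := range_top h2 => a b.
by have := @xs_ge1 (Psi y); lra.
Qed.

Lemma rise_lo (d y : R) : y <= 9 -> rise d y = d.
Proof. by move=> h; rewrite /rise max_l ?mulr0 ?subr0 // subr_le0. Qed.

Lemma rise_hi (d y : R) : 9 <= y -> rise d y = d - 2 * d * (y - 9).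
Proof. by move=> h; rewrite /rise max_r // subr_ge0. Qed.

(** Near the bottom of the strands [B] and [r] the correction term is
    nonnegative and at most 4. *)
Lemma bump_range y : yR <= y -> 0 <= (fB y - fA y) * fade y <= 4.
Proof.
move=> h; have [f0|f0] := lerP 8^-1 `|Psi y + 2 * n%:R|.
  by rewrite fade_off // mulr0 lexx /=.
have lo := range_R h; move: f0; rewrite ltr_norml => f0.
have nn' := nn; have n1' := n1.
have E : fB y = 4 - 16 * (Psi y + 2 * n%:R) by apply: fB_low; lra.
have y0 : y <= 0 by apply: y_neg; lra.
have A : 0 <= fA y <= de by apply: fA_bound; lra.
have F := fade01 y; have D := de_le.
apply/andP; split; first by rewrite mulr_ge0; lra.
apply: (@le_trans _ _ (fB y - fA y)); last by lra.
by rewrite ler_piMr; lra.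
Qed.

Lemma cross_sign k t y : (k < 2 * n)%N -> Psi y = - k%:R - t -> `|t - 2^-1| <= 8^-1 ->
  yR <= y -> dB y = fA y - fB y /\
  if odd k then de / 4 <= dB y else dB y <= - (de / 4).
Proof.
move=> kn E t8 h.
have kn' : (k%:R : R) + 1 <= 2 * n%:R by rewrite natr1 -nn ler_nat.
have k0 : (0 : R) <= k%:R by [].
have y0 : y <= 0.
  by apply: y_neg; rewrite E; move: t8; rewrite ler_norml; lra.
have A : 0 <= fA y <= de by apply: fA_bound; lra.
have dE : dB y = fA y - fB y.
  rewrite dB_eq ?fade_off ?subr0 ?mulr1 //; last by lra.
  by rewrite E; move: t8; rewrite ler_norml => t8; rewrite ger0_norm; lra.
split=> //; rewrite dE; have := @fB_cross k y kn.
rewrite E (_ : - k%:R - t + k%:R + 2^-1 = - (t - 2^-1)); last by ring.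
by rewrite normrN => /(_ t8); case: (odd k); lra.
Qed.

Lemma xA_cases s : - (2 * n)%:R <= s <= 0 -> xA n s = zig n s /\ xB n s = 1 - zig n s.
Proof. by move=> h; rewrite (xA_braid n0) // (xB_braid n0) //; case/andP: h. Qed.

Lemma xr_n s : - (2 * n)%:R <= s <= 0 -> (2 * n)%:R * (xr n s - 1) = s + (2 * n)%:R.
Proof.
move=> h; rewrite xr_ge // addrC addKr mulrC divfK //.
by rewrite pnatr_eq0 -lt0n muln_gt0.
Qed.

Lemma pos_n (u : R) : 0 <= u -> 0 <= (2 * n)%:R * u. Proof. by move=> h; rewrite mulr_ge0. Qed.

Lemma dist_half t : `|1 - t - t| = 2 * `|t - 2^-1|.
Proof.
by case: (norm_cases (1 - t - t)) => -[-> ?];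
   case: (norm_cases (t - 2^-1)) => -[-> ?]; lra.
Qed.

Lemma dist_AB k t s : s = - k%:R - t -> - (2 * n)%:R <= s <= 0 ->
  zig n s = (if odd k then 1 - t else t) -> `|xA n s - xB n s| = 2 * `|t - 2^-1|.
Proof.
move=> E h Z; have [XA XB] := xA_cases h; rewrite XA XB Z.
rewrite -dist_half; case: (odd k); first by congr `|_|; ring.
by rewrite -normrN; congr `|_|; ring.
Qed.

Lemma near_half t : `|t - 2^-1| <= 8^-1 -> 3 / 4 <= tent t.
Proof.
by rewrite /tent; case: (norm_cases (2 * t - 1)) => -[-> ?];
   case: (norm_cases (t - 2^-1)) => -[-> ?]; lra.
Qed.

Lemma move_A_B y : yR <= y <= 62 / 5 ->
  avoids (xB n (Psi y)) (xA n (Psi y)) (dB y) 0 (gA n (Psi y)).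
Proof.
move=> /andP[h1 h2]; case: (lerP 0 (Psi y)) => s0.
  by rewrite (gA_out n0); [exact: avoids_refl | right].
have := range_R h1 => s1.
have [|k [t [kn t01 E Z [GA _]]]] := @braid_cases (Psi y); first by lra.
have [|XA XB] := @xA_cases (Psi y); first by lra.
have [c|c] := lerP (8^-1) `|t - 2^-1|.
  apply: avoids_x; rewrite GA subr0 distrC (@dist_AB k t) //; last by lra.
  move: c; set q := `|t - _| => c.
  by have := tent01 t01; case: (odd k) => ?; rewrite ?normr0 ?ger0_norm; lra.
have [_] := cross_sign kn E (ltW c) h1; rewrite GA; case: (odd k) => dd.
  exact: avoids_refl.
have T := tent01 t01.
by apply: avoids_below; rewrite ?subr0 ?ger0_norm; lra.
Qed.

Lemma move_A_r y : yR <= y <= 19 / 2 ->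
  avoids (xr n (Psi y)) (xA n (Psi y)) (dr y) 0 (gA n (Psi y)).
Proof.
move=> /andP[h1 h2]; case: (lerP 0 (Psi y)) => s0.
  by rewrite (gA_out n0); [exact: avoids_refl | right].
have := range_R h1 => s1; have nn' := nn; have n1' := n1.
have [|k [t [kn t01 E Z [GA _]]]] := @braid_cases (Psi y); first by lra.
have [|XA XB] := @xA_cases (Psi y); first by lra.
rewrite GA; have [ok|ok] := boolP (odd k); first exact: avoids_refl.
have T := tent01 t01.
apply: avoids_xn; first by rewrite subr0 ger0_norm; lra.
have kn2 : (k.+2 <= 2 * n)%N.
  move: kn; rewrite leq_eqVlt => /orP[/eqP kk|//].
  by move: ok; rewrite -[odd k]negbK -[~~ odd k]/(odd k.+1) kk oddM.
have kn3 : (k%:R : R) + 2 <= (2 * n)%:R by rewrite -natrD ler_nat addn2.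
have X := @xr_n (Psi y); rewrite XA Z (negbTE ok).
apply: (@le_trans _ _ ((2 * n)%:R * (xr n (Psi y) - t))); last first.
  by rewrite ler_wpM2l // ler_norm.
have -> : (2 * n)%:R * (xr n (Psi y) - t) =
   (2 * n)%:R * (xr n (Psi y) - 1) + (2 * n)%:R * (1 - t) by ring.
rewrite X; last by lra.
have : 1 * (1 - t) <= (2 * n)%:R * (1 - t) by rewrite ler_wpM2r; lra.
by lra.
Qed.

Lemma move_A_s y : yL <= y <= 19 / 2 ->
  avoids (xs n (Psi y)) (xA n (Psi y)) (ds y) 0 (gA n (Psi y)).
Proof.
move=> /andP[h1 h2]; case: (lerP 0 (Psi y)) => s0.
  by rewrite (gA_out n0); [exact: avoids_refl | right].
case: (lerP (Psi y) (- (2 * n)%:R)) => s1.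
  by rewrite (gA_out n0); [exact: avoids_refl | left].
have [|k [t [kn t01 E Z [GA _]]]] := @braid_cases (Psi y); first by lra.
have [|XA XB] := @xA_cases (Psi y); first by lra.
have [|x2 _] := @xs_braid (Psi y); first by lra.
apply: avoids_x; rewrite subr0 XA; have := zig01 (Psi y); have := tent01 t01.
by rewrite GA; case: (odd k) => ? ?; rewrite ?normr0 ?ger0_norm; lra.
Qed.

Lemma gB_bound s : - (2 * n)%:R <= s -> 0 <= gB n s <= 1.
Proof.
move=> h; case: (lerP s 0) => s0.
  have [|k [t [kn t01 E Z [_ ->]]]] := @braid_cases s; first by lra.
  by have := tent01 t01; case: (odd k); lra.
case: (lerP s 1) => s1; first by rewrite (gB_up0 n0); lra.
case: (lerP s (3 / 2)) => s2; first by rewrite (gB_up1 n0); lra.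
case: (lerP s 2) => s3; first by rewrite (gB_up2 n0); lra.
by rewrite (gB_up3 n0); lra.
Qed.

Lemma move_B_A y : yR <= y <= 62 / 5 ->
  avoids (xA n (Psi y)) (xB n (Psi y)) (gA n (Psi y)) (dB y) (gB n (Psi y)).
Proof.
move=> /andP[h1 h2]; have := range_R h1 => s1; have GB := gB_bound s1.
have D := de_gt0; have D' := de_le.
case: (lerP 0 (Psi y)) => s0.
  have y0 : 0 <= y by rewrite -Psi_ge0.
  rewrite dB_up ?y0 //; case: (lerP (Psi y) 1) => s2.
    by rewrite (gB_up0 n0) ?s0 //; exact: avoids_refl.
  case: (lerP 2 (Psi y)) => s3; first by rewrite (gB_up3 n0) //; exact: avoids_refl.
  apply: avoids_x; rewrite subr0 (xA_up1 n0) ?(xB_up0 n0); [|lra..].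
  by rewrite ger0_norm ?ler0_norm; lra.
have [|k [t [kn t01 E Z [GA GBE]]]] := @braid_cases (Psi y); first by lra.
have B := @dB_bound y; have {}B : `|gB n (Psi y) - dB y| <= 5 + 4^-1.
  apply: (le_trans (ler_normB _ _)); rewrite ger0_norm; last by lra.
  by have := B; rewrite h1 h2 => /(_ isT); lra.
have [c|c] := lerP (8^-1) `|t - 2^-1|.
  by apply: avoids_x; rewrite (@dist_AB k t) //; lra.
have [dE] := cross_sign kn E (ltW c) h1.
have nh := near_half (ltW c).
have y0 : y <= 0 by apply: y_neg; lra.
have A : 0 <= fA y <= de by apply: fA_bound; lra.
have F : -1 <= fB y <= 4 by apply: fB_bound; lra.
rewrite GA GBE; have T := tent01 t01; case: (odd k) => dd.
  by apply: avoids_below; [rewrite ler_norml | |]; lra.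
by apply: avoids_above; [rewrite ler_norml | |]; lra.
Qed.

Lemma gap_Br s : - (2 * n)%:R <= s <= 0 ->
  (s + (2 * n)%:R <= 1 -> s + (2 * n)%:R <= xr n s - xB n s) /\
  (1 <= s + (2 * n)%:R -> 1 <= (2 * n)%:R * (xr n s - xB n s)).
Proof.
move=> h; have [XA XB] := xA_cases h; have Z := zig01 s; have X := xr_n h.
have p : 0 <= (s + (2 * n)%:R) / (2 * n)%:R by rewrite divr_ge0; lra.
split=> h1.
  by rewrite XB zig_end ?xr_ge //; lra.
have : 0 <= (2 * n)%:R * (1 - xB n s) by rewrite pos_n // XB; lra.
by lra.
Qed.

(** [B] and [r] leave their common lowest point in different directions, so
    that a displacement vanishing linearly there can be accommodated. *)
Lemma avoids_Br s z g g' : - (2 * n)%:R <= s <= 0 -> `|g' - g| <= 6 ->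
  (s + (2 * n)%:R <= 16^-1 -> `|g' - g| <= 16 * (s + (2 * n)%:R)) ->
  avoids (xr n s) (xB n s) z g g' /\ avoids (xB n s) (xr n s) z g g'.
Proof.
move=> h g5 gs; have [G1 G2] := gap_Br h.
case: (lerP (s + (2 * n)%:R) 1) => t1.
  have {}G1 := G1 t1.
  have ga : `|xr n s - xB n s| = xr n s - xB n s by rewrite ger0_norm; lra.
  suff : `|g' - g| <= 100 * `|xr n s - xB n s|.
    by move=> H; split; apply: avoids_x => //; rewrite (distrC (xB n s)).
  rewrite ga; case: (lerP (s + (2 * n)%:R) 16^-1) => t2; last by lra.
  by have := gs t2; lra.
have {}G2 := G2 (ltW t1).
have {}G2 : 1 <= (2 * n)%:R * `|xr n s - xB n s|.
  by apply: (le_trans G2); rewrite ler_wpM2l // ler_norm.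
by split; apply: avoids_xn; rewrite ?(distrC (xB n s)) //; lra.
Qed.

Lemma move_B_r y : yR <= y <= 19 / 2 ->
  avoids (xr n (Psi y)) (xB n (Psi y)) (dr y) (dB y) (gB n (Psi y)).
Proof.
move=> /andP[h1 h2]; have := range_R h1 => s1; have GB := gB_bound s1.
have D := de_gt0; have D' := de_le.
case: (lerP 0 (Psi y)) => s0.
  have y0 : 0 <= y by rewrite -Psi_ge0.
  rewrite dB_up ?y0 //; last by lra.
  case: (lerP (Psi y) 1) => s2.
    by rewrite (gB_up0 n0) ?s0 //; exact: avoids_refl.
  case: (lerP 2 (Psi y)) => s3; first by rewrite (gB_up3 n0) //; exact: avoids_refl.
  have y2 : y <= 19 / 6 * 2 by apply: y_le; lra.
  have A : 0 <= fA y <= de by apply: fA_bound; lra.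
  have z : dr y = -4 + fA y.
    by rewrite dr_eq ?h1 // fade_pos // mulr0 addr0 rise_lo //; lra.
  by apply: avoids_below; rewrite ?subr0 ?ger0_norm; lra.
have B := @dB_bound y; have {}B : `|gB n (Psi y) - dB y| <= 6.
  apply: (le_trans (ler_normB _ _)); rewrite ger0_norm; last by lra.
  by have := B; rewrite h1 => /(_ _); lra.
apply: (avoids_Br _ _ B _).1; first by lra.
move=> tau; have nn' := nn; have n1' := n1.
rewrite dB_eq ?fade_on; [|rewrite ger0_norm; lra|lra].
rewrite subrr mulr0 subr0.
have n2 : (0 < 2 * n)%N by rewrite muln_gt0.
have kn : ((2 * n).-1 < 2 * n)%N by rewrite prednK.
have E : (2 * n).-1%:R = (2 * n)%:R - 1 :> R.
  by rewrite -[in RHS](prednK n2) -natr1 addrK.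
have ks : (2 * n).-1%:R <= - Psi y <= (2 * n).-1.+1%:R by rewrite prednK // E; lra.
have ok : odd (2 * n).-1.
  by rewrite -[odd _]negbK -[~~ odd _]/(odd (2 * n).-1.+1) prednK // oddM.
rewrite (gB_piece n0 kn ks) ok E /tent.
rewrite [`|2 * _ - 1|]ger0_norm; last by lra.
by rewrite ger0_norm; lra.
Qed.

Lemma move_B_s y : yR <= y <= 19 / 2 ->
  avoids (xs n (Psi y)) (xB n (Psi y)) (ds y) (dB y) (gB n (Psi y)).
Proof.
move=> /andP[h1 h2]; have := range_R h1 => s1; have GB := gB_bound s1.
have D := de_gt0; have D' := de_le.
case: (lerP 0 (Psi y)) => s0.
  have y0 : 0 <= y by rewrite -Psi_ge0.
  rewrite dB_up ?y0 //; last by lra.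
  case: (lerP (Psi y) 1) => s2.
    by rewrite (gB_up0 n0) ?s0 //; exact: avoids_refl.
  case: (lerP 2 (Psi y)) => s3; first by rewrite (gB_up3 n0) //; exact: avoids_refl.
  have y2 : y <= 19 / 6 * 2 by apply: y_le; lra.
  have A : 0 <= fA y <= de by apply: fA_bound; lra.
  have z : ds y = 4 + fA y.
    rewrite ds_eq ?h2 ?andbT ?fade_pos ?mulr0 ?addr0 ?rise_lo //; first by lra.
    by have := yEL; have := yER; lra.
  by apply: avoids_above; rewrite ?subr0 ?ger0_norm; lra.
have B := @dB_bound y; have {}B : `|gB n (Psi y) - dB y| <= 6.
  apply: (le_trans (ler_normB _ _)); rewrite ger0_norm; last by lra.
  by have := B; rewrite h1 => /(_ _); lra.
have [|XA XB] := @xA_cases (Psi y); first by lra.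
have [|x2 _] := @xs_braid (Psi y); first by lra.
apply: avoids_x; rewrite XB; have Z := zig01 (Psi y).
by rewrite [`|xs n _ - _|]ger0_norm; lra.
Qed.

Lemma dr_bound y : yR <= y <= 19 / 2 -> - 4 <= dr y <= de /\
  (y <= 9 -> 0 <= y -> dr y = - 4 + fA y).
Proof.
move=> h; have D := de_gt0; have D' := de_le; have h0 := yER.
have A : 0 <= fA y <= de.
  by case/andP: h => h1 h2; apply: fA_bound; lra.
case/andP: (h) => h1 h2; have F := bump_range h1; rewrite dr_eq //.
case: (lerP 0 y) => y0.
  rewrite fade_pos ?Psi_ge0 // mulr0 addr0; split; last first.
    by move=> y9 _; rewrite rise_lo.
  case: (lerP y 9) => y9; first by rewrite rise_lo //; lra.
  by rewrite rise_hi; lra.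
rewrite rise_lo; last by lra.
split; last by [].
have F01 := fade01 y.
have G : -1 <= fB y <= 4 by apply: fB_bound; lra.
apply/andP; split; first by lra.
have : (4 - fB y) * fade y + (fB y - fA y) * fade y <= (4 - fA y) * 1.
  have -> : (4 - fB y) * fade y + (fB y - fA y) * fade y = (4 - fA y) * fade y by ring.
  by rewrite ler_wpM2l; lra.
have : 0 <= (4 - fB y) * fade y by rewrite mulr_ge0; lra.
by lra.
Qed.

Lemma ds_low y : yR <= y <= 9 -> 4 <= ds y <= 9.
Proof.
move=> /andP[h1 h2]; have D := de_gt0; have D' := de_le.
have h0 := yER; have h3 := yEL.
have A : 0 <= fA y <= de by apply: fA_bound; lra.
have := bump_range h1; rewrite ds_eq ?rise_lo //; lra.
Qed.

Lemma move_r_A y : yR <= y <= 19 / 2 ->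
  avoids (xA n (Psi y)) (xr n (Psi y)) (gA n (Psi y)) (dr y) 0.
Proof.
move=> /andP[h1 h2]; have s1 := range_R h1; have s2 := range_top h2.
have D' := de_le; have D := de_gt0.
have [] := @dr_bound y; rewrite ?h1 // => B _.
have {}B : `|0 - dr y| <= 5 by rewrite ler_norml; lra.
case: (lerP 0 (Psi y)) => s0.
  apply: avoids_x; apply: (le_trans B); rewrite distrC (xr1 n0); last by lra.
  case: (lerP (Psi y) 2^-1) => s3; first by rewrite (xA_up0 n0) ?ger0_norm; lra.
  by rewrite (xA_up1 n0) ?ger0_norm; lra.
apply: avoids_xn; first by lra.
have [|XA XB] := @xA_cases (Psi y); first by lra.
have Z := zig01 (Psi y); have X : (2 * n)%:R * (xr n (Psi y) - 1) = Psi y + (2 * n)%:R by apply: xr_n; lra.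
rewrite distrC; apply: (@le_trans _ _ ((2 * n)%:R * (xr n (Psi y) - xA n (Psi y)))); last first.
  by rewrite ler_wpM2l // ler_norm.
have -> : (2 * n)%:R * (xr n (Psi y) - xA n (Psi y)) =
   (2 * n)%:R * (xr n (Psi y) - 1) + (2 * n)%:R * (1 - xA n (Psi y)) by ring.
rewrite X XA; have nn' := nn; have n1' := n1.
case: (lerP (Psi y + (2 * n)%:R) 1) => t1; last first.
  have : 0 <= (2 * n)%:R * (1 - zig n (Psi y)) by apply: pos_n; lra.
  by lra.
rewrite zig_end; last by lra.
have : 1 * (1 - (Psi y + (2 * n)%:R)) <= (2 * n)%:R * (1 - (Psi y + (2 * n)%:R)).
  by rewrite ler_wpM2r; lra.
by lra.
Qed.

Lemma move_r_B y : yR <= y <= 19 / 2 ->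
  avoids (xB n (Psi y)) (xr n (Psi y)) (gB n (Psi y)) (dr y) 0.
Proof.
move=> /andP[h1 h2]; have s1 := range_R h1; have s2 := range_top h2.
have D' := de_le; have D := de_gt0.
have [] := @dr_bound y; rewrite ?h1 // => B B0.
have {}B' : `|0 - dr y| <= 5 by rewrite ler_norml; lra.
case: (lerP 0 (Psi y)) => s0; last first.
  apply: (avoids_Br _ _ (_ : _ <= 6) _).2; [lra|lra|] => tau.
  have nn' := nn; have y0 : y <= 0 by apply: y_neg; lra.
  rewrite dr_eq ?h1 // rise_lo ?fade_on; [|rewrite ger0_norm; lra|lra].
  rewrite (@fB_low y); last by lra.
  by rewrite ler_norml; lra.
rewrite (xr1 n0) ?s0 //.
case: (lerP 2 (Psi y)) => s3.
  apply: avoids_x; apply: (le_trans B'); rewrite (xB_up1 n0); last by lra.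
  by rewrite ger0_norm; lra.
case: (lerP 8^-1 `|Psi y - 3 / 2|) => s4.
  apply: avoids_x; apply: (le_trans B'); rewrite (xB_up0 n0); last by lra.
  have -> : 1 + Psi y - (2 + Psi y / 3) = 2 / 3 * (Psi y - 3 / 2) by field.
  by rewrite normrM ger0_norm; lra.
have g : 3 / 4 <= gB n (Psi y).
  move: s4; rewrite ltr_norml => s4.
  case: (lerP (Psi y) (3 / 2)) => s5; first by rewrite (gB_up1 n0); lra.
  by rewrite (gB_up2 n0); lra.
have y2 : y <= 19 / 6 * 2 by apply: y_le; lra.
by apply: avoids_above; lra.
Qed.

Lemma rise_top y : 9 <= y <= 19 / 2 ->
  dr y = - 8 * (19 / 2 - y) + fA y /\ ds y = 8 * (19 / 2 - y) + fA y.
Proof.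
move=> h; have h0 := yER; have h3 := yEL; have h4 := yR0; have h5 := de_gt0.
have s : 0 <= Psi y by rewrite Psi_ge0; lra.
rewrite dr_eq ?ds_eq; [|lra..].
by rewrite fade_pos // mulr0 !addr0 !rise_hi; lra.
Qed.

Lemma move_r_s y : yR <= y <= 19 / 2 ->
  avoids (xs n (Psi y)) (xr n (Psi y)) (ds y) (dr y) 0.
Proof.
move=> /andP[h1 h2]; have s1 := range_R h1; have s2 := range_top h2.
have D' := de_le; have D := de_gt0.
have [] := @dr_bound y; rewrite ?h1 // => B B0.
case: (lerP y 9) => y9.
  have := @ds_low y; rewrite h1 y9 => /(_ isT) ?.
  by apply: avoids_above; rewrite ?ler_norml; lra.
have yy : Psi y = 6 / 19 * y by rewrite Psi_up; lra.
have A : 0 <= fA y <= de by apply: fA_bound; lra.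
have A' : fA y <= 4 / 3 * (19 / 2 - y) by apply: fA_near; lra.
have [|-> _] := @rise_top y; first by lra.
apply: avoids_x; rewrite (xs3 n0) ?(xr1 n0) ?yy; [|lra..].
by rewrite [leRHS](_ : _ = 100 * (13 / 3 * (3 - 6 / 19 * y))) ?ler_norml; [lra|congr (_ * _); rewrite ger0_norm; lra].
Qed.

Lemma gs_bound s : s <= 3 -> 0 <= gs s <= 1 /\ gs s <= 8 * (3 - s).
Proof.
move=> h; case: (lerP s (11 / 4)) => s0; first by rewrite (gs0 n0); lra.
case: (lerP s (23 / 8)) => s1; first by rewrite (gs1 n0); lra.
by rewrite (gs2 n0); lra.
Qed.

Lemma move_s_A y : yL <= y <= 19 / 2 ->
  avoids (xA n (Psi y)) (xs n (Psi y)) (gA n (Psi y)) (ds y) (gs (Psi y)).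
Proof.
move=> /andP[h1 h2]; have s1 := range_L h1; have s2 := range_top h2.
have D' := de_le; have D := de_gt0; have nn' := nn; have n1' := n1.
have e1 := yEL; have e2 := yER; have e3 := yRL.
apply: avoids_x; case: (lerP yR y) => yr; last first.
  have sR : Psi y <= - (2 * n)%:R by rewrite -Psi_R; exact/ltW/Psi_lt.
  have yR0' := yR0.
  have -> : xA n (Psi y) = 2 * (- Psi y - (2 * n)%:R) by apply: (xA_low n0); lra.
  have -> : xs n (Psi y) = 2 + 2 * (Psi y + (2 * n)%:R) by apply: (xs0 n0); lra.
  have -> : gs (Psi y) = 0 by apply: (gs0 n0); lra.
  have -> : ds y = 4 + fA y + (4 - fA y) * fade y.
    by rewrite ds_eq ?rise_lo ?fB_below; lra.
  have P : Psi y + 2 * n%:R + 2^-1 = (y - yL) / (2 * (yR - yL)) by apply: Psi_low; lra.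
  have P1 : y - yL <= 22 * (Psi y + 2 * n%:R + 2^-1).
    rewrite P mulrA ler_pdivlMr; last by lra.
    by rewrite mulrC ler_wpM2r; lra.
  rewrite [`|_ * _ - _|]ler0_norm; last by lra.
  have A : 0 <= 4 + fA y <= 4 / 3 * (y - yL).
    case: (lerP y yE) => ye; first by rewrite fA_lo; lra.
    have : 0 <= fA y <= de by apply: fA_mid; lra.
    by lra.
  have F := fade01 y.
  have [t0|t0] := lerP 8^-1 `|Psi y + 2 * n%:R|.
    by rewrite fade_off // ler_norml; lra.
  move: t0; rewrite ltr_norml => t0.
  have fA4 : -4 <= fA y <= 4.
    case: (lerP y yE) => ye; first by rewrite fA_lo; lra.
    have : 0 <= fA y <= de by apply: fA_mid; lra.
    by lra.
  have : 0 <= (4 - fA y) * fade y by rewrite mulr_ge0; lra.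
  have : (4 - fA y) * fade y <= 8 * 1 by rewrite ler_pM; lra.
  by rewrite ler_norml; lra.
have s3 := range_R yr.
have [|GS _] := @gs_bound (Psi y); first by lra.
have DS : `|gs (Psi y) - ds y| <= 10.
  case: (lerP y 9) => y9.
    by have := @ds_low y; rewrite yr y9 => /(_ isT); rewrite ler_norml; lra.
  have [|_ ->] := @rise_top y; first by lra.
  have : 0 <= fA y <= de by apply: fA_bound; lra.
  by rewrite ler_norml; lra.
apply: (le_trans DS); rewrite distrC.
case: (lerP (Psi y) 0) => s0.
  have [|XA _] := @xA_cases (Psi y); first by lra.
  have Z := zig01 (Psi y); have [|? _] := @xs_braid (Psi y); first by lra.
  by rewrite XA ger0_norm; lra.
case: (lerP (Psi y) (11 / 4)) => s4.
  have X : 8 / 3 + Psi y / 3 <= xs n (Psi y) by apply: xs_up; lra.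
  case: (lerP (Psi y) 2^-1) => s5; first by rewrite (xA_up0 n0) ?ger0_norm; lra.
  by rewrite (xA_up1 n0) ?ger0_norm; lra.
by rewrite (xA_up1 n0) ?(xs3 n0) ?ger0_norm; lra.
Qed.

Lemma ds_bound y : yR <= y <= 19 / 2 -> `|gs (Psi y) - ds y| <= 10.
Proof.
move=> /andP[yr h2]; have D := de_gt0; have D' := de_le.
have s2 := range_top h2; have h0 := yER.
have [|GS _] := @gs_bound (Psi y); first by lra.
case: (lerP y 9) => y9.
  by have := @ds_low y; rewrite yr y9 => /(_ isT); rewrite ler_norml; lra.
have [|_ ->] := @rise_top y; first by lra.
have : 0 <= fA y <= de by apply: fA_bound; lra.
by rewrite ler_norml; lra.
Qed.

Lemma move_s_B y : yR <= y <= 19 / 2 ->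
  avoids (xB n (Psi y)) (xs n (Psi y)) (gB n (Psi y)) (ds y) (gs (Psi y)).
Proof.
move=> /andP[h1 h2]; have s1 := range_R h1; have s2 := range_top h2.
have D' := de_le; have D := de_gt0; have h0 := yER.
have DS : `|gs (Psi y) - ds y| <= 10 by apply: ds_bound; lra.
case: (lerP (Psi y) (11 / 4)) => s4.
  apply: avoids_x; apply: (le_trans DS); rewrite distrC.
  case: (lerP (Psi y) 0) => s0.
    have [|_ XB] := @xA_cases (Psi y); first by lra.
    have Z := zig01 (Psi y); have [|? _] := @xs_braid (Psi y); first by lra.
    by rewrite XB ger0_norm; lra.
  have X : 8 / 3 + Psi y / 3 <= xs n (Psi y) by apply: xs_up; lra.
  case: (lerP (Psi y) 2) => s5; first by rewrite (xB_up0 n0) ?ger0_norm; lra.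
  by rewrite (xB_up1 n0) ?ger0_norm; lra.
have [c|c] := lerP 32^-1 `|Psi y - 23 / 8|.
  apply: avoids_x; apply: (le_trans DS); rewrite (xB_up1 n0) ?(xs3 n0); [|lra..].
  have -> : 3 + 4 / 7 * (Psi y - 2) - (3 + 4 * (3 - Psi y)) = 32 / 7 * (Psi y - 23 / 8) by field.
  by rewrite normrM ger0_norm; lra.
move: c; rewrite ltr_norml => c.
have g : 3 / 4 <= gs (Psi y) <= 1.
  by case: (lerP (Psi y) (23 / 8)) => s5; [rewrite (gs1 n0) | rewrite (gs2 n0)]; lra.
have y1 : 19 / 6 * (23 / 8 - 32^-1) <= y by apply: y_ge; lra.
have y2 : y <= 19 / 6 * (23 / 8 + 32^-1) by apply: y_le; lra.
have [|_ e] := @rise_top y; first by lra.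
have A : 0 <= fA y <= de by apply: fA_bound; lra.
by rewrite (gB_up3 n0); [apply: avoids_below; rewrite ?ler_norml; lra | lra].
Qed.

Lemma move_s_r y : yR <= y <= 19 / 2 ->
  avoids (xr n (Psi y)) (xs n (Psi y)) 0 (ds y) (gs (Psi y)).
Proof.
move=> /andP[h1 h2]; have s1 := range_R h1; have s2 := range_top h2.
have D' := de_le; have D := de_gt0; have h0 := yER.
have DS : `|gs (Psi y) - ds y| <= 10 by apply: ds_bound; lra.
apply: avoids_x; rewrite (distrC (xr n _)); case: (lerP (Psi y) (11 / 4)) => s4.
  apply: (le_trans DS); case: (lerP (Psi y) 0) => s0.
    have [|_ ?] := @xs_braid (Psi y); first by lra.
    by rewrite ger0_norm; lra.
  have X : 8 / 3 + Psi y / 3 <= xs n (Psi y) by apply: xs_up; lra.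
  by rewrite (xr1 n0) ?ger0_norm; lra.
have [|GS GS'] := @gs_bound (Psi y); first by lra.
rewrite (xr1 n0) ?(xs3 n0); [|lra..].
have -> : 3 + 4 * (3 - Psi y) - (2 + Psi y / 3) = 13 / 3 * (3 - Psi y) by field.
rewrite [leRHS](_ : _ = 100 * (13 / 3 * (3 - Psi y))); last first.
  by congr (_ * _); rewrite ger0_norm; lra.
case: (lerP y 9) => y9.
  have := @ds_low y; rewrite h1 y9 => /(_ isT) S.
  have : Psi y <= 6 / 19 * 9 by rewrite -Psi_up; [exact: Psi_le | lra].
  by rewrite ler_norml; lra.
have [|_ ->] := @rise_top y; first by lra.
have yy : Psi y = 6 / 19 * y by rewrite Psi_up; lra.
have A : 0 <= fA y <= de by apply: fA_bound; lra.
have A' : fA y <= 4 / 3 * (19 / 2 - y) by apply: fA_near; lra.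
by rewrite yy in GS GS' *; rewrite ler_norml; lra.
Qed.

Lemma xA_continuous : continuous (xA n : R -> R).
Proof. by rewrite /xA /zig; have c := @pl_continuous R; cont; exact: c. Qed.

Lemma xB_continuous : continuous (xB n : R -> R).
Proof. by rewrite /xB /zig; have c := @pl_continuous R; cont; exact: c. Qed.

Lemma xr_continuous : continuous (xr n : R -> R).
Proof. exact: pl_continuous. Qed.

Lemma xs_continuous : continuous (xs n : R -> R).
Proof. exact: pl_continuous. Qed.

Lemma gA_continuous : continuous (gA n : R -> R).
Proof. by rewrite /gA; have c := @pl_continuous R; cont; exact: c. Qed.

Lemma gB_continuous : continuous (gB n : R -> R).
Proof. by rewrite /gB; have c := @pl_continuous R; cont; exact: c. Qed.

Lemma gs_continuous : continuous (gs : R -> R).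
Proof. exact: pl_continuous. Qed.

Let xA' y := xA n (Psi y).
Let xB' y := xB n (Psi y).
Let xr' y := xr n (Psi y).
Let xs' y := xs n (Psi y).
Let gA' y := gA n (Psi y).
Let gB' y := gB n (Psi y).
Let gs' y := gs (Psi y).

Let cxA : continuous xA'. Proof. exact: (cont_comp xA_continuous cPsi). Qed.
Let cxB : continuous xB'. Proof. exact: (cont_comp xB_continuous cPsi). Qed.
Let cxr : continuous xr'. Proof. exact: (cont_comp xr_continuous cPsi). Qed.
Let cxs : continuous xs'. Proof. exact: (cont_comp xs_continuous cPsi). Qed.
Let cgA : continuous gA'. Proof. exact: (cont_comp gA_continuous cPsi). Qed.
Let cgB : continuous gB'. Proof. exact: (cont_comp gB_continuous cPsi). Qed.
Let cgs : continuous gs'. Proof. exact: (cont_comp gs_continuous cPsi). Qed.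

Lemma offset_continuous : continuous (fun q : R * R => offset q.1 q.2).
Proof.
by rewrite /offset /fade /clamp; have c1 := cfA; have c2 := cfB; have c3 := cPsi; cont.
Qed.

Let coff (f : R -> R) : continuous f -> continuous (fun y => offset (f y) y).
Proof.
move=> cf; rewrite /offset /fade /clamp.
by have c1 := cfA; have c2 := cfB; have c3 := cPsi; cont.
Qed.

Let cdB : continuous dB.
Proof.
rewrite /dB; apply: contD; first by have c := cfB; cont.
exact: (coff cxB).
Qed.

Let crise d : continuous (rise d). Proof. by rewrite /rise; cont. Qed.

Let cdr : continuous dr.
Proof. by rewrite /dr; apply: contD; [exact: crise | exact: (coff cxr)]. Qed.

Let cds : continuous ds.
Proof. by rewrite /ds; apply: contD; [exact: crise | exact: (coff cxs)]. Qed.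

Lemma strand_ext (f f' h h' : R -> R) (a b : R) :
  (forall y, a <= y <= b -> f y = f' y) -> (forall y, a <= y <= b -> h y = h' y) ->
  strand f h a b = strand f' h' a b.
Proof.
by move=> e1 e2; apply/seteqP; split=> -[[x y] z] [/= yab -> ->]; split=> //=; rewrite ?e1 ?e2.
Qed.

Lemma strand_shear (phi : R -> R -> R) (f h : R -> R) (a b : R) :
  (fun p : sp => (p.1, p.2 + phi p.1.1 p.1.2)) @` strand f h a b =
  strand f (fun y => h y + phi (f y) y) a b.
Proof.
apply/seteqP; split=> [_ [[[x y] z] [/= yab -> ->] <-]|[[x y] z] [/= yab -> ->]] //.
by exists (f y, y, h y).
Qed.

Lemma strand_reparam (f h : R -> R) (a b : R) : a <= b ->
  (fun p : sp => (p.1.1, Psi p.1.2, p.2)) @`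
    strand (fun y => f (Psi y)) (fun y => h (Psi y)) a b =
  strand f h (Psi a) (Psi b).
Proof.
move=> ab; apply/seteqP; split=> [_ [[[x y] z] [/= yab -> ->] <-]|[[x s] z] [/= sab -> ->]].
  by split=> //=; case/andP: yab => ya yb; rewrite !Psi_le.
have [||c cab <-] := @IVT R Psi a b s ab.
- by apply: continuous_subspaceT; exact: cPsi.
- by rewrite min_l ?max_r ?Psi_le.
by exists (f (Psi c), c, h (Psi c)) => //; split=> //=; rewrite in_itv in cab.
Qed.

Let yLt : yL <= 62 / 5. Proof. by have := yEL; have := yER; have := yR0; have := de_gt0; lra. Qed.
Let yRt : yR <= 62 / 5. Proof. by have := yR0; lra. Qed.
Let yRL' : yL <= yR. Proof. by have := yEL; have := yER; have := de_gt0; lra. Qed.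
Let yRt' : yR <= 19 / 2. Proof. by have := yR0; lra. Qed.
Let yLt' : yL <= 19 / 2. Proof. by have := yEL; have := yER; have := yR0; have := de_gt0; lra. Qed.
Let NN : 0 < 100 * n%:R :> R. Proof. by have := n1; lra. Qed.
Let LL : 0 < 20 / de. Proof. by rewrite divr_gt0. Qed.

Definition diagram_strands : set sp :=
  strand xA' (fun y => - fA y) yL (62 / 5) `|`
  (strand xB' (fun y => - fB y) yR (62 / 5) `|`
   (strand xr' (rise (-4)) yR (19 / 2) `|` strand xs' (rise 4) yL (19 / 2))).

Lemma isotopic_shear_strands : isotopic diagram_strands
  (strand xA' (fun=> 0) yL (62 / 5) `|`
   (strand xB' dB yR (62 / 5) `|`
    (strand xr' dr yR (19 / 2) `|` strand xs' ds yL (19 / 2)))).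
Proof.
have := shear_z diagram_strands offset_continuous.
rewrite /diagram_strands !image_setU !strand_shear.
rewrite (_ : strand xA' (fun y => - fA y + offset (xA' y) y) _ _ = strand xA' (fun=> 0) yL (62 / 5)); first by move=> h; exact: h.
by apply: strand_ext => // y yab; rewrite offset_A // addNr.
Qed.

Let swap13 (a b c d : set sp) : b `|` (a `|` (c `|` d)) = c `|` (a `|` (b `|` d)).
Proof. by rewrite predeqE => x; rewrite /setU /=; tauto. Qed.

Let swap14 (a b c d : set sp) : c `|` (a `|` (b `|` d)) = d `|` (a `|` (b `|` c)).
Proof. by rewrite predeqE => x; rewrite /setU /=; tauto. Qed.

Lemma isotopic_push_strands : isotopic
  (strand xA' (fun=> 0) yL (62 / 5) `|`
   (strand xB' dB yR (62 / 5) `|`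
    (strand xr' dr yR (19 / 2) `|` strand xs' ds yL (19 / 2))))
  (strand xA' gA' yL (62 / 5) `|`
   (strand xB' gB' yR (62 / 5) `|`
    (strand xr' (fun=> 0) yR (19 / 2) `|` strand xs' gs' yL (19 / 2)))).
Proof.
have e1 := yEL; have e2 := yER; have e3 := de_gt0; have e4 := yR0; have nn' := nn.
have n1' := n1.
have c0 : continuous ((fun=> 0) : R -> R) by move=> T; exact: cvg_cst.
have R0 : dB yR = 0 /\ dr yR = 0.
  have F : fade yR = 1 by rewrite fade_on // Psi_R nn' addNr normr0.
  rewrite dB_eq ?dr_eq ?F ?rise_lo ?fB_below; lra.
have [t1 t2] : dr (19 / 2) = 0 /\ ds (19 / 2) = 0.
  have := @fA_near (19 / 2); have := @fA_bound (19 / 2).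
  by have [|-> ->] := @rise_top (19 / 2); lra.
have l0 : ds yL = 0.
  rewrite ds_eq ?rise_lo ?fA_lo ?fade_off ?mulr0 ?addr0; [lra | | lra..].
  by rewrite Psi_L nn' ler0_norm; lra.
apply: isotopic_trans.
  apply: (@isotopic_push _ xA' (fun=> 0) gA' _ _ _ _ _ cxA c0 cgA yLt NN LL).
  - by rewrite /gA' Psi_L (gA_out n0) //; left; lra.
  - by rewrite /gA' Psi_tip (gA_out n0) //; right; lra.
  move=> x y z [[/= yab -> ->]|[[/= yab -> ->]|[/= yab -> ->]]] _.
  - exact: move_A_B.
  - exact: move_A_r.
  - exact: move_A_s.
rewrite setUCA; apply: isotopic_trans.
  apply: (@isotopic_push _ xB' dB gB' _ _ _ _ _ cxB cdB cgB yRt NN LL).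
  - rewrite R0.1 /gB' Psi_R (gB_low n0); last by lra.
    rewrite opprK pl_hi /=; [|exact: half_knots|by rewrite !natrM; lra].
    by rewrite (_ : (4 * n) %% 4 = 0)%N // modnMr.
  - rewrite dB_up; last by lra.
    by rewrite /gB' Psi_tip (gB_up3 n0) //; lra.
  move=> x y z [[/= yab -> ->]|[[/= yab -> ->]|[/= yab -> ->]]] yab'.
  - exact: move_B_A.
  - exact: move_B_r.
  - by apply: move_B_s; lra.
rewrite swap13; apply: isotopic_trans.
  apply: (@isotopic_push _ xr' dr (fun=> 0) _ _ _ _ _ cxr cdr c0 yRt' NN LL).
  - by rewrite R0.2.
  - by rewrite t1.
  move=> x y z [[/= yab -> ->]|[[/= yab -> ->]|[/= yab -> ->]]] yab'.
  - exact: move_r_A.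
  - exact: move_r_B.
  - exact: move_r_s.
rewrite swap14; apply: isotopic_trans.
  apply: (@isotopic_push _ xs' ds gs' _ _ _ _ _ cxs cds cgs yLt' NN LL).
  - by rewrite l0 /gs' Psi_L (gs0 n0) //; lra.
  - by rewrite t2 /gs' Psi_top (gs2 n0) ?subrr ?mulr0 //; lra.
  move=> x y z [[/= yab -> ->]|[[/= yab -> ->]|[/= yab -> ->]]] yab'.
  - exact: move_s_A.
  - by apply: move_s_B; lra.
  - by apply: move_s_r; lra.
rewrite [X in isotopic X]swap14 swap13 setUCA.
exact: isotopic_refl.
Qed.

Lemma isotopic_straight_strands : isotopic diagram_strands (plat n : set sp).
Proof.
apply: isotopic_trans isotopic_shear_strands _.
apply: isotopic_trans isotopic_push_strands _.
apply: isotopic_trans.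
  apply: (@isotopic_along_y _ (fun p : sp => Psi p.1.2)).
  - by have c := cPsi; cont.
  - by move=> x z y y' /=; exact: Psi_lt.
  - by move=> x z; exact: Psi_bound.
rewrite !image_setU /=.
rewrite (@strand_reparam (xA n) (gA n) _ _ yLt) (@strand_reparam (xB n) (gB n) _ _ yRt).
rewrite (@strand_reparam (xr n) (fun=> 0) _ _ yRt') (@strand_reparam (xs n) gs _ _ yLt').
rewrite Psi_L Psi_R Psi_tip Psi_top; exact: isotopic_refl.
Qed.

Definition cap (z : R) : R :=
  xr n (Psi (9 + (4 + Num.min z 0) / 8)) + xs n (Psi (9 + (4 - Num.max z 0) / 8)) - 3.

Definition cap_strand : set sp :=
  [set p | [/\ -4 <= p.2 <= 4, p.1.2 = 9 & p.1.1 = cap p.2]].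

Definition polygon_strands : set sp :=
  strand xA' (fun y => - fA y) yL (62 / 5) `|`
  (strand xB' (fun y => - fB y) yR (62 / 5) `|`
   (strand xr' (fun=> -4) yR 9 `|` (strand xs' (fun=> 4) yL 9 `|` cap_strand))).

Lemma cap_neg z : z <= 0 -> cap z = xr' (9 + (4 + z) / 8).
Proof.
move=> h; rewrite /cap min_l // max_r // subr0.
rewrite (_ : 9 + 4 / 8 = 19 / 2 :> R); last by field.
by rewrite Psi_top (xs3 n0) ?subrr ?mulr0 ?addr0 ?addrK; [|lra].
Qed.

Lemma cap_pos z : 0 <= z -> cap z = xs' (9 + (4 - z) / 8).
Proof.
move=> h; rewrite /cap min_r // max_l // addr0.
rewrite (_ : 9 + 4 / 8 = 19 / 2 :> R); last by field.
rewrite Psi_top (xr1 n0) ?divff //; last by lra.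
by rewrite /xs' (_ : 2 + 1 = 3 :> R) ?(addrC 3) ?addrK //; ring.
Qed.

Let swap (p : sp) : sp := (p.1.1, p.2, p.1.2).
Let cswap : continuous swap. Proof. by rewrite /swap; cont. Qed.
Let swapK : cancel swap swap. Proof. by move=> [[x y] z]. Qed.

Lemma cap_continuous : continuous cap.
Proof. by rewrite /cap; have c1 := xr_continuous; have c2 := xs_continuous; have c3 := cPsi; cont. Qed.

Lemma top_gap y z : 71 / 8 <= y <= 77 / 8 -> -de <= z <= 0 ->
  4^-1 <= `|xA' y - cap z| /\ 4^-1 <= `|xB' y - cap z|.
Proof.
move=> hy hz; have D := de_le; have D0 := de_gt0.
rewrite cap_neg; last by lra.
rewrite /xr' Psi_up ?(xr1 n0); [|lra..].
have P : 14 / 5 <= Psi y <= 61 / 20.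
  by case: (lerP y (19 / 2)) => h; [rewrite Psi_up | rewrite Psi_up']; lra.
rewrite /xA' /xB' (xA_up1 n0) ?(xB_up1 n0); [|lra..].
by split; [rewrite ler0_norm | rewrite ger0_norm]; lra.
Qed.

Lemma isotopic_polygon_strands : isotopic polygon_strands (plat n : set sp).
Proof.
have e1 := yEL; have e2 := yER; have e3 := de_gt0; have e4 := yR0; have e5 := de_le.
apply: isotopic_trans isotopic_straight_strands.
pose rest : set sp := strand xA' (fun y => - fA y) yL (62 / 5) `|`
  (strand xB' (fun y => - fB y) yR (62 / 5) `|`
   (strand xr' (fun=> -4) yR 9 `|` strand xs' (fun=> 4) yL 9)).
have E1 : swap @` polygon_strands = strand cap (fun=> 9) (-4) 4 `|` swap @` rest.
  rewrite /polygon_strands /rest !image_setU setUA [RHS]setUC -!setUA.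
  do 4!congr (_ `|` _).
  apply/seteqP; split=> [_ [[[x y] z] [/= h -> ->] <-] //|[[x z] y] [/= h -> ->]].
  by exists (cap z, 9, z).
have E2 : swap @` (strand cap (fun z => 9 + (4 - `|z|) / 8) (-4) 4 `|` swap @` rest) =
    diagram_strands.
  rewrite image_setU image_comp (_ : (swap \o swap) @` rest = rest); last first.
    by rewrite -[RHS]image_id; apply: eq_imagel => p _ /=; rewrite swapK.
  apply/seteqP; split.
    move=> p [[[[x z] y] [/= h -> ->] <-]|].
      rewrite /swap /=; case: (lerP 0 z) => z0; right; right; [right|left].
      - split=> /=; first by rewrite ger0_norm; lra.
          by rewrite cap_pos ?ger0_norm.
        by rewrite rise_hi ?ger0_norm; lra.
      rewrite ler0_norm; last by lra.
      split=> /=; first by lra.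
        by rewrite cap_neg ?opprK //; lra.
      by rewrite rise_hi; lra.
    case: p => [[x y] z]; rewrite /rest /diagram_strands.
    case=> [|[|[|]]] /=; [by left|by right; left| |].
    - by case=> /= h -> ->; right; right; left; split=> //=; [lra|rewrite rise_lo; lra].
    - by case=> /= h -> ->; right; right; right; split=> //=; [lra|rewrite rise_lo; lra].
  case=> [[x y] z]; rewrite /rest /diagram_strands.
  case=> [|[|[|]]]; [by right; left|by right; right; left| |] => -[/= h -> ->].
  - case: (lerP y 9) => y9.
      by right; right; right; left; split=> //=; [lra|rewrite rise_lo].
    left; exists (xr' y, rise (-4) y, y) => //.
    rewrite rise_hi; last by lra.
    split=> /=; first by lra.
      rewrite cap_neg; last by lra.
      by congr (xr' _); field.
    by rewrite ler0_norm; lra.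
  - case: (lerP y 9) => y9.
      by right; right; right; right; split=> //=; [lra|rewrite rise_lo].
    left; exists (xs' y, rise 4 y, y) => //.
    rewrite rise_hi; last by lra.
    split=> /=; first by lra.
      rewrite cap_pos; last by lra.
      by congr (xs' _); field.
    by rewrite ger0_norm; lra.
rewrite -E2; apply: (isotopic_conj_can cswap cswap swapK swapK).
rewrite E1; apply: (@isotopic_push _ cap (fun=> 9) _ _ _ 10 4).
- exact: cap_continuous.
- by move=> T; exact: cvg_cst.
- by cont.
- by lra.
- by lra.
- by lra.
- by rewrite ler0_norm; lra.
- by rewrite ger0_norm; lra.
move=> x z y [[[x' y'] z'] h [<- <- <-]] hz.
set d : R := (4 - `|z'|) / 8.
have d0 : 0 <= d <= 2^-1 by rewrite /d; case: (norm_cases z') => -[-> ?]; lra.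
have -> : `|9 + d - 9| = d by rewrite (addrC 9) addrK ger0_norm; lra.
rewrite (min_l (_ : 9 <= 9 + d)) ?(max_r (_ : 9 <= 9 + d)); [|lra..].
have side : yL <= y' <= 62 / 5 -> z' = - fA y' ->
    4^-1 <= `|x' - cap z'| \/ ~ (71 / 8 <= y' <= 77 / 8) ->
    [\/ d <= 10 * `|x' - cap z'|, d <= 4 * (9 - y') | d <= 4 * (y' - (9 + d))].
  move=> hy -> H; case: (lerP y' (71 / 8)) => h1; first by apply: Or32; lra.
  case: (lerP (77 / 8) y') => h2; first by apply: Or33; lra.
  by apply: Or31; case: H => H; lra.
have mid t : 71 / 8 <= t <= 77 / 8 -> 0 <= fA t <= de by move=> ?; apply: fA_mid; lra.
case: h => [|[|[|]]] [/= h xE zE].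
- apply: side => //; case: (boolP (71 / 8 <= y' <= 77 / 8)) => hy; [left | by right; apply/negP].
  by have m := mid _ hy; rewrite xE zE; have [|] := @top_gap y' (- fA y') hy; lra.
- case: (boolP (71 / 8 <= y' <= 77 / 8)) => hy.
    apply: side; [lra| |left].
      by rewrite zE fB_top; lra.
    have m := mid _ hy; rewrite xE zE fB_top; last by lra.
    by have [|] := @top_gap y' (- fA y') hy; lra.
  case: (lerP y' (71 / 8)) => h1; first by apply: Or32; lra.
  by apply: Or33; move: hy; rewrite negb_and -!ltNge => /orP; lra.
- by apply: Or31; rewrite /d zE ler0_norm; [rewrite opprK subrr mul0r mulr_ge0|lra].
- by apply: Or31; rewrite /d zE ger0_norm; [rewrite subrr mul0r mulr_ge0|lra].
Qed.
End Unravel.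

Section Ribbon.
Context {R : realType} (n : nat).
Implicit Types x y z s t : R.

Definition fine : nat := 20 * n ^ 2.
Definition de : R := (3 * fine%:R)^-1.
Definition sg : R := 3 / 4 * de.
Definition nA : nat := (80 * fine).+1.
Definition nB : nat := (40 * fine).+1.
Arguments nA : simpl never.
Arguments nB : simpl never.
Definition fx (j : nat) : R := if odd j then - (1 + j./2%:R) else 2 + j./2%:R.
Definition fy (j : nat) : R := - ((j%:R + 1) * (j%:R + 4) / 2 * sg).
Arguments fx : simpl never.
Arguments fy : simpl never.
Definition yE : R := 10 - nA%:R * sg.
Definition yL : R := yE - 3 / 4 * (4 + de).
Definition yF : R := fy (2 * n).-1.
Definition yR : R := yF - 3 / 4 * (4 + n%:R * de).
Definition tip : plane R := (16 / 5, 62 / 5).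

Definition va (k : nat) : plane R :=
  if k is j.+1 then
    if (j <= nA)%N then (de * (~~ odd j)%:R, 10 - (nA%:R - j%:R) * sg) else tip
  else (-4, yL).

Definition vb (k : nat) : plane R :=
  if k is j.+1 then
    if (j < nB)%N then (de * (odd j)%:R, 10 - j%:R * sg)
    else if (j - nB < 2 * n)%N then (fx (j - nB) * de, fy (j - nB)) else (4, yR)
  else tip.

Definition mB : nat := (nB + 2 * n).+1.

Definition fA (y : R) : R := pl nA.+2 (fun k => (va k).2) (fun k => (va k).1) y.
Definition fB (y : R) : R := pl mB (fun k => - (vb k).2) (fun k => (vb k).1) (- y).

Definition time_knots (k : nat) : R :=
  if k is k'.+3 then
    if (k' < 2 * n)%N then - fy k'
    else nth 0 [:: - yF + n%:R * sg; - yR; - yL] (k' - 2 * n)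
  else nth 0 [:: - (62 / 5); - (19 / 2); 0] k.
Definition time_values (k : nat) : R :=
  if k is k'.+3 then
    if (k' < 2 * n)%N then k'%:R + 2^-1
    else nth 0 [:: 2 * n%:R - 4^-1; 2 * n%:R; 2 * n%:R + 2^-1] (k' - 2 * n)
  else nth 0 [:: - (15 / 4); - 3; 0] k.
Definition Psi (y : R) : R := - pl_line (2 * n + 5) time_knots time_values (- y).

Hypothesis n0 : (0 < n)%N.

Lemma n1 : (1 : R) <= n%:R. Proof. by rewrite ler1n. Qed.

Lemma fineE : fine%:R = 20 * n%:R ^+ 2 :> R.
Proof. by rewrite /fine natrM natrX. Qed.

Lemma fine_ge : (20 : R) <= fine%:R.
Proof.
rewrite fineE; have : (1 : R) <= n%:R ^+ 2 by rewrite exprn_ege1 ?n1.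
by lra.
Qed.

Lemma de_gt0 : 0 < de.
Proof. by rewrite /de invr_gt0; have := fine_ge; lra. Qed.

Lemma de_le : de <= 60^-1.
Proof. by rewrite /de lef_pV2 ?posrE; have := fine_ge; lra. Qed.

Lemma sgE : sg = 3 / 4 * de. Proof. by []. Qed.

Lemma fine_sg : fine%:R * sg = 4^-1.
Proof. rewrite /sg /de; field; apply: lt0r_neq0; have := fine_ge; lra. Qed.

Lemma nAE : nA%:R = 80 * fine%:R + 1 :> R.
Proof. by rewrite /nA -natr1 natrM. Qed.

Lemma nBE : nB%:R = 40 * fine%:R + 1 :> R.
Proof. by rewrite /nB -natr1 natrM. Qed.

Lemma nA_sg : nA%:R * sg = 20 + sg.
Proof. by rewrite nAE mulrDl mul1r -mulrA fine_sg; lra. Qed.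

Lemma nB_sg : nB%:R * sg = 10 + sg.
Proof. by rewrite nBE mulrDl mul1r -mulrA fine_sg; lra. Qed.

Lemma odd_nA : odd nA. Proof. by rewrite /nA /= oddM. Qed.
Lemma odd_nB : odd nB. Proof. by rewrite /nB /= oddM. Qed.

Lemma yEE : yE = - 10 - sg. Proof. by rewrite /yE nA_sg; ring. Qed.

Lemma n_de : n%:R * de <= 60^-1 /\ n%:R ^+ 2 * de = 60^-1.
Proof.
have h : n%:R ^+ 2 * de = 60^-1.
  by rewrite /de fineE; field; rewrite pnatr_eq0 -lt0n.
split=> //; rewrite -h expr2 ler_wpM2r ?ler_peMl ?n1 //; exact/ltW/de_gt0.
Qed.

Lemma yFE : yF = - ((2 * n%:R ^+ 2 + 3 * n%:R) * sg).
Proof.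
rewrite /yF /fy; have -> : (2 * n).-1%:R = 2 * n%:R - 1 :> R.
  by rewrite -natrM -[in RHS](prednK (_ : (0 < 2 * n)%N)) ?muln_gt0 // -natr1 addrK.
by field.
Qed.

Lemma yF_bound : - 16^-1 <= yF <= - (5 * sg).
Proof.
have [h1 h2] := n_de; have d := de_gt0; have h := n1.
have e : n%:R * sg = 3 / 4 * (n%:R * de) by rewrite sgE; ring.
have e2 : n%:R ^+ 2 * sg = 3 / 4 * (n%:R ^+ 2 * de) by rewrite sgE; ring.
rewrite yFE (_ : _ * sg = 2 * (n%:R ^+ 2 * sg) + 3 * (n%:R * sg)); last by ring.
rewrite e e2 h2.
have h3 : de <= n%:R * de by rewrite ler_peMl // ltW.
rewrite sgE; apply/andP; split; first by lra.
have : 60^-1 * 1 >= n%:R * de by lra.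
rewrite -h2; have : n%:R * de <= n%:R ^+ 2 * de.
  by rewrite expr2 ler_wpM2r ?ler_peMl // ltW.
by lra.
Qed.

Lemma yR_bound : -3 - 10^-1 <= yR <= - 3.
Proof.
have := yF_bound; have [h1 _] := n_de; have d := de_gt0; have := n1; rewrite /yR sgE.
have : 0 <= n%:R * de by rewrite mulr_ge0 // ltW.
by lra.
Qed.

Lemma yE_lt : yE < yR.
Proof. by rewrite yEE sgE; have := yR_bound; have := de_gt0; have := de_le; lra. Qed.

Lemma yL_bound : -13 - 10^-1 <= yL <= -13.
Proof. by rewrite /yL yEE sgE; have := de_gt0; have := de_le; lra. Qed.

Lemma yRL : yR - yL <= 11.
Proof. by have := yR_bound; have := yL_bound; lra. Qed.

Definition slope (k : nat) : R := if odd k then - (4 / 3) else 4 / 3.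

Lemma va_mid j : (j <= nA)%N ->
  va j.+1 = (de * (~~ odd j)%:R, 10 - (nA%:R - j%:R) * sg).
Proof. by rewrite /va => ->. Qed.

Lemma va_last : va nA.+2 = tip. Proof. by rewrite /va ltnn. Qed.

Lemma vb_mid j : (j < nB)%N -> vb j.+1 = (de * (odd j)%:R, 10 - j%:R * sg).
Proof. by rewrite /vb => ->. Qed.

Lemma vb_fold j : (j < 2 * n)%N -> vb (nB + j).+1 = (fx j * de, fy j).
Proof.
rewrite /vb (_ : (nB + j < nB)%N = false); first by rewrite addKn => ->.
by apply/negbTE; rewrite -leqNgt leq_addr.
Qed.

Lemma vb_last : vb mB = (4, yR).
Proof.
rewrite /vb /mB (_ : (nB + 2 * n < nB)%N = false) ?addKn ?ltnn //.
by apply/negbTE; rewrite -leqNgt leq_addr.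
Qed.

Lemma va_step k : (k < nA.+2)%N -> (va k).2 < (va k.+1).2 /\
  (va k.+1).1 - (va k).1 = slope k * ((va k.+1).2 - (va k).2).
Proof.
have d := de_gt0; have e := sgE; case: k => [_|j].
  by rewrite va_mid // /= subr0 /slope /= -/yE /yL; lra.
rewrite !ltnS leq_eqVlt => /orP[/eqP ->|jN].
  by rewrite va_last va_mid // /slope oddS odd_nA /tip /= /fst /snd; lra.
rewrite (va_mid (ltnW jN)) (va_mid jN) /slope !oddS -(natr1 j).
by case: (odd j) => /=; lra.
Qed.

Lemma fx_step j : fx j.+1 - fx j = - (slope j * (3 / 4 * (j%:R + 3))).
Proof.
have E : j%:R = (odd j)%:R + 2 * j./2%:R :> R.
  by rewrite -natrM mul2n -natrD odd_double_half.
rewrite E /fx /slope oddS -uphalfE uphalf_half natrD.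
by case: (odd j) => /=; field.
Qed.

Lemma fy_step j : fy j.+1 - fy j = - (j%:R + 3) * sg.
Proof. by rewrite /fy -natr1; field. Qed.

Lemma fx_last : fx (2 * n).-1 = - n%:R.
Proof.
have := odd_double_half (2 * n).-1; rewrite /fx.
have -> : odd (2 * n).-1 = true.
  by rewrite -[odd _]negbK -[~~ odd _]/(odd (2 * n).-1.+1) prednK ?muln_gt0 // oddM.
move=> /(congr1 S); rewrite prednK ?muln_gt0 // => E.
have : ((2 * n).-1./2).+1 = n by apply: double_inj; rewrite doubleS -[in RHS]mul2n; exact: E.
by move=> {2}<-; rewrite -natr1; ring.
Qed.

Lemma vb_step k : (k < mB)%N -> (vb k.+1).2 < (vb k).2 /\
  (vb k.+1).1 - (vb k).1 = slope k * ((vb k.+1).2 - (vb k).2).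
Proof.
have d := de_gt0; have e := sgE; case: k => [_|j].
  by rewrite vb_mid // /slope /tip /=; lra.
rewrite ltnS => jm; case: (ltnP j.+1 nB) => jB.
  by rewrite !vb_mid ?(ltnW jB) // /slope !oddS -(natr1 j); case: (odd j) => /=; lra.
move: jB; rewrite leq_eqVlt => /orP[/eqP jB|jB].
  have h0 : (0 < 2 * n)%N by rewrite muln_gt0.
  have := vb_fold h0; rewrite addn0 jB => ->.
  rewrite (@vb_mid j) ?jB // /slope !oddS.
  have := odd_nB; rewrite jB oddS => /negbTE ->.
  have := nB_sg; rewrite jB -(natr1 j) /fx /fy /=; lra.
have [i E] : exists i, j = (nB + i)%N by exists (j - nB)%N; rewrite subnKC.
rewrite {}E in jm jB *.
have odi : odd (nB + i).+1 = odd i by rewrite oddS oddD odd_nB negbK.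
have {}jm : (i < 2 * n)%N by rewrite -(ltn_add2l nB).
rewrite (vb_fold jm); case: (ltnP i.+1 (2 * n)) => i1.
  have V := vb_fold i1; rewrite addnS in V; rewrite V /slope odi /fst /snd.
  have a := fx_step i; have b := fy_step i; move: a; rewrite /slope.
  have i3 : 0 < (i%:R + 3) * sg by rewrite mulr_gt0 ?ltr_wpDl //; lra.
  rewrite -mulrBl => ->; rewrite b; split; first by lra.
  by case: (odd i); rewrite sgE; field.
have {i1} Ei : i = (2 * n).-1.
  by apply/eqP; rewrite -eqSS prednK ?muln_gt0 // eqn_leq jm i1.
have -> : (nB + i).+2 = mB by rewrite /mB -addnS Ei prednK ?muln_gt0.
rewrite vb_last /slope odi /fst /snd Ei fx_last -/yF /yR.
have -> : odd (2 * n).-1 by rewrite -[odd _]negbK -[~~ odd _]/(odd (2 * n).-1.+1) prednK ?muln_gt0 // oddM.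
have nd : 0 <= n%:R * de by rewrite mulr_ge0 // ltW.
by lra.
Qed.

Lemma va_knots k : (k < nA.+2)%N -> (va k).2 < (va k.+1).2.
Proof. by case/va_step. Qed.

Lemma vb_knots k : (k < mB)%N -> - (vb k).2 < - (vb k.+1).2.
Proof. by move=> /vb_step[h _]; rewrite ltrN2. Qed.

Lemma fA_piece k y : (k < nA.+2)%N -> (va k).2 <= y <= (va k.+1).2 ->
  fA y = (va k).1 + slope k * (y - (va k).2).
Proof.
move=> km h; have [lt E] := va_step km.
rewrite /fA (pl_at (fun k => (va k).1) va_knots km h) E mulfK //.
by rewrite subr_eq0 gt_eqF.
Qed.

Lemma fB_piece k y : (k < mB)%N -> (vb k.+1).2 <= y <= (vb k).2 ->
  fB y = (vb k).1 + slope k * (y - (vb k).2).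
Proof.
move=> km h; have [lt E] := vb_step km.
have h' : - (vb k).2 <= - y <= - (vb k.+1).2 by rewrite !lerN2 andbC.
rewrite /fB (pl_at (fun k => (vb k).1) vb_knots km h') E !opprK.
by field; rewrite addrC subr_eq0 gt_eqF.
Qed.

Lemma fA_lo y : yL <= y <= yE -> fA y = - 4 + 4 / 3 * (y - yL).
Proof.
by move=> h; rewrite (@fA_piece 0) // va_mid // /= subr0.
Qed.

Definition tooth (j : nat) (y : R) : R :=
  de * (odd j)%:R + slope j.+1 * (y - (10 - j%:R * sg)).

Lemma tooth_bound j y : 10 - j.+1%:R * sg <= y <= 10 - j%:R * sg -> 0 <= tooth j y <= de.
Proof.
by rewrite /tooth /slope oddS -(natr1 j) sgE; case: (odd j) => /=; lra.
Qed.

Lemma fA_tooth j y : (j < nA)%N -> 10 - j.+1%:R * sg <= y <= 10 - j%:R * sg ->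
  fA y = tooth j y.
Proof.
move=> jN h; have jN' : (nA - j = (nA - j.+1).+1)%N by rewrite subnSK.
have [v1 v2] : va (nA - j) = (de * (~~ odd j)%:R, 10 - j.+1%:R * sg) /\
    va (nA - j).+1 = (de * (odd j)%:R, 10 - j%:R * sg).
  split; [rewrite [in LHS]jN'|]; rewrite va_mid ?leq_subr //.
    by rewrite oddB // odd_nA oddS natrB // (_ : nA%:R - (_ - _) = j.+1%:R) ?negbK //; ring.
  by rewrite oddB ?(ltnW jN) // odd_nA natrB ?(ltnW jN) // (_ : nA%:R - (_ - _) = j%:R) ?negbK //; ring.
rewrite (@fA_piece (nA - j)) ?v1 ?v2 //; last by rewrite ltnS (leq_trans (leq_subr _ _)).
rewrite /= /tooth /slope oddS oddB ?(ltnW jN) // odd_nA -(natr1 j) sgE.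
by case: (odd j) => /=; lra.
Qed.

Lemma tooth_ex (m : nat) y : (0 < m)%N -> 10 - m%:R * sg <= y <= 10 ->
  exists2 j, (j < m)%N & 10 - j.+1%:R * sg <= y <= 10 - j%:R * sg.
Proof.
move=> m0 h; have [|j jm hj] := @knots_piece R m (fun j => - (10 - j%:R * sg)) (- y) m0.
  by rewrite mul0r subr0 !lerN2 andbC.
by exists j => //; rewrite -!(lerN2 y) -!(lerN2 _ y) andbC.
Qed.

Lemma fA_mid y : yE <= y <= 10 -> 0 <= fA y <= de.
Proof.
move=> /(@tooth_ex nA y (ltn0Sn _))[j jN h].
by rewrite (fA_tooth jN h) tooth_bound.
Qed.

Lemma fA_near y : 9 <= y <= 19 / 2 -> fA y <= 4 / 3 * (19 / 2 - y).
Proof.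
move=> h; have s := sgE; have d := de_gt0; have fs := fine_sg.
case: (lerP y (19 / 2 - sg)) => y1.
  have : 0 <= fA y <= de by apply: fA_mid; have := yE_lt; have := yR_bound; lra.
  by lra.
have E : (2 * fine)%:R * sg = 2^-1 by rewrite natrM -mulrA fs; field.
rewrite (@fA_tooth (2 * fine)).
- rewrite /tooth /slope oddS oddM /= E; lra.
- by rewrite /nA ltnS leq_mul2r orbT.
- by rewrite -(natr1 (2 * fine)) mulrDl E mul1r; lra.
Qed.

Lemma fB_tooth j y : (j.+1 < nB)%N -> 10 - j.+1%:R * sg <= y <= 10 - j%:R * sg ->
  fB y = tooth j y.
Proof.
move=> jN h; rewrite (@fB_piece j.+1); first by rewrite vb_mid ?(ltnW jN).
  by rewrite /mB ltnS (leq_trans (ltnW jN)) ?leq_addr.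
by rewrite !vb_mid ?(ltnW jN).
Qed.

Lemma fB_top y : 0 <= y <= 62 / 5 -> fB y = fA y.
Proof.
move=> h; case: (lerP y 10) => y10.
  have f0 : (0 < 40 * fine)%N by rewrite -(ltr_nat R) natrM; have := fine_ge; lra.
  have [|j jN hj] := @tooth_ex (40 * fine) y f0.
    by rewrite natrM -mulrA fine_sg; lra.
  rewrite (@fB_tooth j) // (@fA_tooth j) //.
  by apply: (leq_trans jN); rewrite /nA (leq_trans _ (leqnSn _)) // leq_mul2r orbT.
rewrite (@fB_piece 0) ?vb_mid //; last by rewrite /tip /=; lra.
rewrite (@fA_piece nA.+1) ?va_last ?va_mid //; last by rewrite /tip /= subrr; lra.
by rewrite /slope oddS odd_nA /=; rewrite /tip /=; lra.
Qed.

Lemma time_knots_low i : time_knots (2 * n + i).+3 = nth 0 [:: - yF + n%:R * sg; - yR; - yL] i.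
Proof. by rewrite /time_knots ltnNge leq_addr /= addKn. Qed.

Lemma time_values_low i : time_values (2 * n + i).+3 =
  nth 0 [:: 2 * n%:R - 4^-1; 2 * n%:R; 2 * n%:R + 2^-1] i.
Proof. by rewrite /time_values ltnNge leq_addr /= addKn. Qed.

Lemma time_knots_low' i : time_knots (2 * n + i).+4 = nth 0 [:: - yF + n%:R * sg; - yR; - yL] i.+1.
Proof. by rewrite -addnS time_knots_low. Qed.

Lemma time_values_low' i : time_values (2 * n + i).+4 =
  nth 0 [:: 2 * n%:R - 4^-1; 2 * n%:R; 2 * n%:R + 2^-1] i.+1.
Proof. by rewrite -addnS time_values_low. Qed.

Let n2 : (0 < 2 * n)%N. Proof. by rewrite muln_gt0. Qed.
Let n2E : (2 * n).-1%:R = 2 * n%:R - 1 :> R.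
Proof. by rewrite -natrM -[in RHS](prednK n2) -natr1 addrK. Qed.

Lemma knots_index (P : nat -> Prop) : P 0%N -> P 1%N -> P 2%N ->
  (forall j, (j.+1 < 2 * n)%N -> P j.+3) -> P (2 * n).-1.+3 ->
  P (2 * n + 0).+3 -> P (2 * n + 1).+3 -> forall k, (k < 2 * n + 5)%N -> P k.
Proof.
move=> p0 p1 p2 pj pf q0 q1 [|[|[|j]]] //; rewrite !addnS !ltnS.
rewrite leq_eqVlt => /orP[/eqP ->|]; first by rewrite -addnS.
rewrite ltnS leq_eqVlt => /orP[/eqP ->|] //.
rewrite addn0 -(prednK n2) ltnS leq_eqVlt => /orP[/eqP ->|jn] //.
by apply: pj; rewrite -(prednK n2) ltnS.
Qed.

Lemma nsg_gt0 : 0 < n%:R * sg.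
Proof. by rewrite mulr_gt0 ?sgE ?mulr_gt0 ?de_gt0 //; have := n1; lra. Qed.

Lemma fy0 : fy 0 = - (2 * sg). Proof. by rewrite /fy; field. Qed.

Lemma yF_low : yF - n%:R * sg = yR + 3.
Proof. by rewrite /yR sgE; field. Qed.

Lemma time_knots_lt k : (k < 2 * n + 5)%N -> time_knots k < time_knots k.+1.
Proof.
have s := nsg_gt0; have d := de_gt0; have e := sgE; have bR := yR_bound; have bL := yL_bound.
have low := yF_low.
move: k; apply: knots_index => [| | |j jn| | |]; rewrite ?time_knots_low ?time_knots_low' /=.
- by lra.
- by lra.
- by rewrite n2 fy0; lra.
- rewrite jn (ltnW jn); have := fy_step j.
  have : 0 < (j%:R + 3) * sg by rewrite mulr_gt0 ?ltr_wpDl //; lra.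
  by lra.
- rewrite prednK // ltnn leqnn subnn -/yF /=; lra.
- by lra.
- by lra.
Qed.

Lemma time_values_lt k : (k < 2 * n + 5)%N -> time_values k < time_values k.+1.
Proof.
move: k; apply: knots_index => [| | |j jn| | |]; rewrite ?time_values_low ?time_values_low' /=.
- by lra.
- by lra.
- by rewrite n2; lra.
- by rewrite jn (ltnW jn) -(natr1 j); lra.
- rewrite prednK // ltnn leqnn subnn n2E /=; lra.
- by lra.
- by lra.
Qed.

Lemma Psi_lt y z : y < z -> Psi y < Psi z.
Proof.
move=> h; rewrite /Psi ltrN2; apply: pl_line_lt; rewrite ?ltrN2 //.
- exact: time_knots_lt.
- exact: time_values_lt.
Qed.

Lemma Psi_bound : exists M, forall y, `|Psi y - y| <= M.
Proof.
have [M h] := pl_line_bound time_knots_lt time_values_lt.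
by exists M => y; have := h (- y); rewrite /Psi -normrN opprB addrC.
Qed.

Lemma Psi_continuous : continuous Psi.
Proof. by rewrite /Psi; have c := @pl_line_continuous R (2 * n + 5) time_knots time_values; cont; exact: c. Qed.

Lemma Psi_piece k y : (k < 2 * n + 5)%N -> time_knots k <= - y <= time_knots k.+1 ->
  Psi y = - (time_values k + (time_values k.+1 - time_values k) /
    (time_knots k.+1 - time_knots k) * (- y - time_knots k)).
Proof.
move=> km /andP[h1 h2]; rewrite /Psi pl_lineE.
  by rewrite (pl_at _ time_knots_lt km) ?h1.
apply/andP; split.
  by apply: le_trans h1; apply: (knots_le time_knots_lt); rewrite /= ltnW.
by apply: (le_trans h2); apply: (knots_le time_knots_lt); rewrite km /=.
Qed.

Lemma Psi_up y : 0 <= y <= 19 / 2 -> Psi y = 6 / 19 * y.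
Proof.
by move=> h; rewrite (@Psi_piece 1) /=; [field | rewrite addnC | lra].
Qed.

Lemma Psi_up' y : 19 / 2 <= y <= 62 / 5 -> Psi y = 3 + 15 / 58 * (y - 19 / 2).
Proof.
by move=> h; rewrite (@Psi_piece 0) /=; [field | rewrite addnC | lra].
Qed.

Lemma Psi_V y : - (2 * sg) <= y <= 0 -> Psi y * (4 * sg) = y.
Proof.
move=> h; rewrite (@Psi_piece 2) /=; [|by rewrite addnC| by rewrite n2 fy0; lra].
by rewrite n2 fy0; field; apply: lt0r_neq0; have := de_gt0; rewrite sgE; lra.
Qed.

Lemma Psi_fold j y t : (j.+1 < 2 * n)%N -> y = fy j - t * (j%:R + 3) * sg -> 0 <= t <= 1 ->
  Psi y = - (j%:R + 2^-1) - t.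
Proof.
move=> jn -> t01; have st := fy_step j.
have s0 : 0 < (j%:R + 3) * sg.
  by rewrite mulr_gt0 ?ltr_wpDl //; have := de_gt0; rewrite sgE; lra.
have t1 : 0 <= t * ((j%:R + 3) * sg) <= (j%:R + 3) * sg.
  by rewrite mulr_ge0 ?ler_piMl ?(ltW s0) //; case/andP: t01.
rewrite (@Psi_piece j.+3) /= ?jn ?(ltnW jn).
- have -> : - fy j.+1 - - fy j = (j%:R + 3) * sg by lra.
  rewrite -(natr1 j); field.
  by rewrite -negb_or -mulf_eq0 mulrC lt0r_neq0.
- by move: jn; clear; lia.
- by lra.
Qed.

Lemma Psi_E y : yR <= y <= yF -> y <= yR + 3 -> Psi y + 2 * n%:R = (y - yR) / 12.
Proof.
have s := nsg_gt0; have l := yF_low; move=> h h3.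
rewrite (@Psi_piece (2 * n + 0).+3); last by rewrite time_knots_low time_knots_low' /=; lra.
  rewrite time_knots_low time_knots_low' time_values_low time_values_low' /=.
  have -> : - yR - (- yF + n%:R * sg) = 3 by lra.
  by lra.
by move: n2; clear; lia.
Qed.

Lemma Psi_E' y : yR + 3 <= y <= yF ->
  (Psi y + 2 * n%:R - 2^-1) * (4 * (n%:R * sg)) = y - yF.
Proof.
have s := nsg_gt0; have l := yF_low; move=> h.
have K1 : time_knots (2 * n).-1.+3 = - yF by rewrite /time_knots prednK // leqnn.
have V1 : time_values (2 * n).-1.+3 = 2 * n%:R - 2^-1.
  by rewrite /time_values prednK // leqnn n2E; lra.
have K2 : time_knots (2 * n).-1.+4 = - yF + n%:R * sg.
  by have := time_knots_low 0; rewrite addn0 -{1}(prednK n2).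
have V2 : time_values (2 * n).-1.+4 = 2 * n%:R - 4^-1.
  by have := time_values_low 0; rewrite addn0 -{1}(prednK n2).
rewrite (@Psi_piece (2 * n).-1.+3) ?K1 ?K2 ?V1 ?V2; [|by move: n2; lia|by lra].
have -> : - yF + n%:R * sg - - yF = n%:R * sg by lra.
by field; rewrite -negb_or -mulf_eq0 mulrC lt0r_neq0.
Qed.

Lemma Psi_low y : yL <= y <= yR -> Psi y + 2 * n%:R + 2^-1 = (y - yL) / (2 * (yR - yL)).
Proof.
have a := yR_bound; have b := yL_bound; move=> h.
rewrite (@Psi_piece (2 * n + 1).+3); last by rewrite time_knots_low time_knots_low' /=; lra.
  rewrite time_knots_low time_knots_low' time_values_low time_values_low' /=.
  by field; apply: lt0r_neq0; lra.
by move: n2; clear; lia.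
Qed.

Lemma fB_below y : y <= yR -> fB y = 4.
Proof.
by move=> h; rewrite /fB (pl_hi _ vb_knots) vb_last //= lerN2.
Qed.

Lemma nB_index : vb nB = (0, 0).
Proof.
rewrite vb_mid // oddM /= mulr0 natrM -mulrA fine_sg; congr (_, _).
by field.
Qed.

Lemma fB_V y : - (2 * sg) <= y <= 0 -> fB y = - (4 / 3 * y).
Proof.
have f := vb_fold n2; rewrite addn0 fy0 in f.
move=> h; rewrite (@fB_piece nB) ?nB_index ?f //.
- by rewrite /slope odd_nB /=; ring.
- by rewrite /mB ltnS leq_addr.
Qed.

Lemma fB_fold j y t : (j.+1 < 2 * n)%N -> y = fy j - t * (j%:R + 3) * sg -> 0 <= t <= 1 ->
  fB y = (fx j + t * (fx j.+1 - fx j)) * de.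
Proof.
move=> jn -> t01; have st := fy_step j.
have s0 : 0 < (j%:R + 3) * sg.
  by rewrite mulr_gt0 ?ltr_wpDl //; have := de_gt0; rewrite sgE; lra.
have t1 : 0 <= t * ((j%:R + 3) * sg) <= (j%:R + 3) * sg.
  by rewrite mulr_ge0 ?ler_piMl ?(ltW s0) //; case/andP: t01.
have v := vb_fold jn; rewrite addnS in v.
rewrite (@fB_piece (nB + j).+1) ?v ?(vb_fold (ltnW jn)).
- rewrite /slope oddS oddD odd_nB negbK /= fx_step /slope sgE.
  by case: (odd j); field.
- by rewrite /mB ltnS ltn_add2l ltnW.
- by rewrite /=; lra.
Qed.

Lemma fB_E y : yR <= y <= yF -> fB y = - n%:R * de - 4 / 3 * (y - yF).
Proof.
have E : (2 * n).-1.+1 = (2 * n)%N by rewrite prednK.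
have v : vb (nB + (2 * n).-1).+1 = (- n%:R * de, yF) by rewrite vb_fold ?prednK // fx_last.
move=> h; rewrite (@fB_piece (nB + (2 * n).-1).+1) ?v.
- rewrite /slope oddS oddD odd_nB negbK -[odd _]negbK -oddS E oddM /=; ring.
- by rewrite /mB ltnS -addnS E.
- by rewrite -addnS E -[(nB + 2 * n).+1]/mB vb_last.
Qed.

Lemma fold_ex y : yF <= y <= - (2 * sg) -> exists j, exists t : R,
  [/\ (j.+1 < 2 * n)%N, 0 <= t <= 1 & y = fy j - t * (j%:R + 3) * sg].
Proof.
have m0 : (0 < (2 * n).-1)%N by move: n2; lia.
move=> h; have [|j jm hj] := @knots_piece R (2 * n).-1 (fun j => - fy j) (- y) m0.
  by rewrite fy0 -/yF !lerN2 andbC.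
have s0 : 0 < (j%:R + 3) * sg.
  by rewrite mulr_gt0 ?ltr_wpDl //; have := de_gt0; rewrite sgE; lra.
have st := fy_step j.
exists j, ((fy j - y) / ((j%:R + 3) * sg)); split; first by move: jm; clear; lia.
  by rewrite divr_ge0 ?ler_pdivrMr //; lra.
by rewrite -mulrA divfK ?lt0r_neq0 //; ring.
Qed.

Lemma low_ex y : yR <= y <= 0 -> [\/ - (2 * sg) <= y <= 0,
  exists j, exists t : R, [/\ (j.+1 < 2 * n)%N, 0 <= t <= 1 & y = fy j - t * (j%:R + 3) * sg] |
  yR <= y <= yF].
Proof.
move=> h; case: (lerP (- (2 * sg)) y) => h1; first by apply: Or31; lra.
case: (lerP yF y) => h2; last by apply: Or33; lra.
by apply: Or32; apply: fold_ex; lra.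
Qed.

Lemma fx_fold j t : 0 <= t <= 1 ->
  fx j + t * (fx j.+1 - fx j) = if odd j then - (1 + j./2%:R) + t * (j%:R + 3)
                                else 2 + j./2%:R - t * (j%:R + 3).
Proof. by move=> t01; rewrite fx_step /fx /slope; case: (odd j); field. Qed.

Lemma half_real j : j%:R = (odd j)%:R + 2 * j./2%:R :> R.
Proof. by rewrite -natrM mul2n -natrD odd_double_half. Qed.

Lemma Psi_at_yR : Psi yR = - (2 * n%:R).
Proof.
have := yF_low; have := nsg_gt0; have := @Psi_E yR.
by rewrite subrr mul0r lexx /= => h a b; have := h _ _; lra.
Qed.

Lemma Psi_at_0 : Psi 0 = 0. Proof. by rewrite Psi_up ?mulr0 //; lra. Qed.

Lemma Psi_le_inv y z : Psi y <= Psi z -> y <= z.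
Proof. by move=> h; rewrite leNgt; apply/negP => /Psi_lt; rewrite ltNge h. Qed.

Lemma fB_cross k y : (k < 2 * n)%N -> `|Psi y + k%:R + 2^-1| <= 8^-1 ->
  if odd k then fB y <= - (de / 4) else 5 / 4 * de <= fB y.
Proof.
have d := de_gt0; have s := sgE.
move=> kn; rewrite ler_norml => hk.
have kn' : (k%:R : R) + 1 <= 2 * n%:R by rewrite natr1 -natrM ler_nat.
have k0 : (0 : R) <= k%:R by [].
have y0 : y <= 0 by apply: Psi_le_inv; rewrite Psi_at_0; lra.
have yr : yR <= y by apply: Psi_le_inv; rewrite Psi_at_yR; lra.
have [|yV|[j [t [jn t01 Ey]]]|yE'] := @low_ex y; first by rewrite yr.
- have P := Psi_V yV.
  have P1 : -1 <= 2 * Psi y by rewrite -(ler_pM2r (_ : 0 < 2 * sg)); lra.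
  have k00 : k = 0%N by apply/eqP; rewrite -leqn0 -ltnS -(ltr_nat R); lra.
  rewrite k00 in hk *; rewrite fB_V // -P s.
  have : 3 / 8 * de <= - Psi y * de by rewrite ler_pM2r //; lra.
  by rewrite /=; lra.
- rewrite (Psi_fold jn Ey t01) in hk; rewrite (fB_fold jn Ey t01) (fx_fold _ t01).
  have : (k == j) || (k == j.+1).
    have : (k < j.+2)%N by rewrite -(ltr_nat R) -(natr1 j.+1) -(natr1 j); lra.
    have : (j < k.+1)%N by rewrite -(ltr_nat R) -(natr1 k); lra.
    by clear; lia.
  have h0 : (0 : R) <= j./2%:R by []. have j0 : (0 : R) <= j%:R by [].
  case/orP => /eqP Ek; rewrite Ek -?(natr1 j) in hk *.
    have B : t * (j%:R + 3) <= 8^-1 * (j%:R + 3) by rewrite ler_wpM2r; lra.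
    have := half_real j; move: B; case: (odd j) => /= B E.
      by rewrite (_ : - (de / 4) = - 4^-1 * de) ?ler_pM2r //; [lra|field].
    by rewrite ler_pM2r //; lra.
  have B : 7 / 8 * (j%:R + 3) <= t * (j%:R + 3) by rewrite ler_wpM2r; lra.
  rewrite oddS; have := half_real j; move: B; case: (odd j) => /= B E.
    by rewrite ler_pM2r //; lra.
  by rewrite (_ : - (de / 4) = - 4^-1 * de) ?ler_pM2r //; [lra|field].
have nd : 0 < n%:R * de by rewrite mulr_gt0 //; have := n1; lra.
have nd1 : de <= n%:R * de by rewrite ler_peMl ?n1 // ltW.
case: (lerP (yR + 3) y) => y3; last first.
  by have := Psi_E yE' (ltW y3); lra.
have P : (Psi y + 2 * n%:R - 2^-1) * (4 * (n%:R * sg)) = y - yF by apply: Psi_E'; lra.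
have k1 : (2 * n < k.+2)%N.
  rewrite -(ltr_nat R) natrM -(natr1 k.+1) -(natr1 k).
  have : (Psi y + 2 * n%:R - 2^-1) * (4 * (n%:R * sg)) <= 0 by rewrite P; lra.
  by rewrite pmulr_lle0; [lra | have := nsg_gt0; lra].
have Ek : (k%:R : R) = 2 * n%:R - 1.
  have -> : k = (2 * n).-1 by move: k1 kn; clear; lia.
  exact: n2E.
have -> : odd k by move: k1 kn; clear; lia.
rewrite fB_E // -P s.
have : -8^-1 * (n%:R * de) <= (Psi y + 2 * n%:R - 2^-1) * (n%:R * de).
  by rewrite ler_pM2r //; lra.
by lra.
Qed.

Lemma fB_low y : 0 <= Psi y + 2 * n%:R <= 4^-1 -> fB y = 4 - 16 * (Psi y + 2 * n%:R).
Proof.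
move=> h; have l := yF_low; have s := nsg_gt0.
have yr : yR <= y by apply: Psi_le_inv; rewrite Psi_at_yR; lra.
have P3 : Psi (yR + 3) + 2 * n%:R = 4^-1 by rewrite Psi_E; lra.
have y3 : y <= yR + 3 by apply: Psi_le_inv; lra.
have Y : yR = yF - 3 / 4 * (4 + n%:R * de) by [].
have b := yF_bound; rewrite (@Psi_E y) ?fB_E; lra.
Qed.

Lemma fx_bound j : (j < 2 * n)%N -> - n%:R <= fx j <= n%:R + 1.
Proof.
move=> jn; have h : (j./2 < n)%N by move: jn; clear; lia.
have {}h : (j./2%:R : R) + 1 <= n%:R by rewrite natr1 ler_nat.
have h0 : (0 : R) <= j./2%:R by [].
by rewrite /fx; case: (odd j) => /=; lra.
Qed.

Lemma fB_bound y : yR <= y <= 0 -> - 1 <= fB y <= 4.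
Proof.
move=> h; have d := de_gt0; have d' := de_le; have s := sgE; have [nd _] := n_de.
have nd0 : 0 <= n%:R * de by rewrite mulr_ge0 // ltW.
have := low_ex h; case=> [yV|[j [t [jn t01 Ey]]]|yE'].
- by rewrite fB_V //; lra.
- rewrite (fB_fold jn Ey t01); have b := fx_bound jn; have a := fx_bound (ltnW jn).
  have : - n%:R * de <= (fx j + t * (fx j.+1 - fx j)) * de <= (n%:R + 1) * de; last by lra.
  rewrite !ler_pM2r //.
  have -> : fx j + t * (fx j.+1 - fx j) = (1 - t) * fx j + t * fx j.+1 by ring.
  have u : 0 <= 1 - t by lra.
  have v : 0 <= t by lra.
  case/andP: a => /(ler_wpM2l u) a1 /(ler_wpM2l u) a2.
  case/andP: b => /(ler_wpM2l v) b1 /(ler_wpM2l v) b2.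
  by lra.
by have Y : yR = yF - 3 / 4 * (4 + n%:R * de); [| rewrite fB_E //; have := yF_bound; lra].
Qed.

Lemma fA_continuous : continuous fA. Proof. exact: pl_continuous. Qed.

Lemma fB_continuous : continuous fB.
Proof. by rewrite /fB; have c := @pl_continuous R; cont; exact: c. Qed.

Lemma isotopic_core_plat :
  isotopic (polygon_strands n yL yR fA fB Psi) (plat n : set (R * R * R)).
Proof.
apply: (isotopic_polygon_strands n0 de_gt0 de_le _ yE_lt _ yRL fA_continuous fB_continuous
  Psi_continuous fA_lo fA_mid fA_near fB_top fB_cross fB_bound fB_low fB_below Psi_lt
  Psi_low Psi_up Psi_up' Psi_bound).
- by rewrite /yL; lra.
- by have := yR_bound; lra.
Qed.
End Ribbon.

Section Directions.
Context {R : realType} (D : knot_diagram R).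
Local Notation I := 'I_(nedges D).
Variables (u : I -> plane R) (l : I -> R).
Hypothesis step : forall i : I, vertex (ordS i) = vertex i + l i *: u i.
Hypothesis l_gt0 : forall i, 0 < l i.
Hypothesis u1 : forall i, dot (u i) (u i) = 1.
Hypothesis u_turn : forall i, u (ordS i) != u i.

Lemma edge_length_unit (i : I) : edge_length i = l i.
Proof.
rewrite /edge_length step addrC addKr /enorm.
have -> : dot (l i *: u i) (l i *: u i) = l i ^+ 2 * dot (u i) (u i).
  by rewrite /dot /GRing.scale /= /GRing.scale /=; ring.
by rewrite u1 mulr1 sqrtr_sqr ger0_norm // ltW.
Qed.

Lemma direction_unit (i : I) : direction i = u i.
Proof.
rewrite /direction edge_length_unit step addrC addKr scalerA mulVf ?scale1r //.
exact: lt0r_neq0.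
Qed.

Lemma start_normal_unit (i : I) : start_normal i = u i - u (ord_pred i).
Proof.
rewrite /start_normal !direction_unit -{1}(ord_predK i).
by rewrite (negbTE (u_turn _)).
Qed.

Lemma end_normal_unit (i : I) : end_normal i = u (ordS i) - u i.
Proof. by rewrite /end_normal !direction_unit (negbTE (u_turn _)). Qed.
End Directions.

Inductive piece := Right | Top | Left | Up of nat | Down of nat.

Arguments va : simpl never.
Arguments vb : simpl never.

Section Pieces.
Context {R : realType} (n : nat).
Local Notation de := (@de R n).
Local Notation sg := (@sg R n).
Local Notation nA := (nA n).
Local Notation nB := (nB n).
Local Notation mB := (mB n).
Local Notation yE := (@yE R n).
Local Notation yL := (@yL R n).
Local Notation yF := (@yF R n).
Local Notation yR := (@yR R n).
Local Notation va := (@va R n).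
Local Notation vb := (@vb R n).
Local Notation fx := (@fx R).
Implicit Types (e f : piece) (p : plane R) (x y : R).

Definition next e : piece :=
  match e with
  | Right => Top | Top => Left | Left => Up 0
  | Up k => if (k <= nA)%N then Up k.+1 else Down 0
  | Down k => if (k.+1 < mB)%N then Down k.+1 else Right
  end.

Definition valid e : bool :=
  match e with Up k => (k < nA.+2)%N | Down k => (k < mB)%N | _ => true end.

Definition src e : plane R :=
  match e with
  | Right => (4, yR) | Top => (4, 9) | Left => (-4, 9)
  | Up k => va k | Down k => vb k
  end.

Definition dir e : plane R :=
  match e with
  | Right => (0, 1) | Top => (-1, 0) | Left => (0, -1)
  | Up k => (if odd k then - (4 / 5) else 4 / 5, 3 / 5)
  | Down k => (if odd k then 4 / 5 else - (4 / 5), - (3 / 5))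
  end.

Definition len e : R :=
  match e with
  | Right => 9 - yR | Top => 8 | Left => 9 - yL
  | Up k => 5 / 3 * ((va k.+1).2 - (va k).2)
  | Down k => 5 / 3 * ((vb k).2 - (vb k.+1).2)
  end.

Definition nrm e : plane R :=
  match e with
  | Right => (- (4 / 5), 8 / 5) | Top => (-1, -1) | Left => (1, -1)
  | Up 0 => (4 / 5, 8 / 5)
  | Up k => (if odd k then - (8 / 5) else 8 / 5, 0)
  | Down 0 => (- (8 / 5), - (6 / 5))
  | Down k => (if odd k then 8 / 5 else - (8 / 5), 0)
  end.

Hypothesis n0 : (0 < n)%N.

Lemma plane_eq p q : p.1 = q.1 -> p.2 = q.2 -> p = q.
Proof. by case: p q => [a b] [c d] /= -> ->. Qed.

Lemma valid_next e : valid e -> valid (next e).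
Proof.
case: e => [| | |k|k] //= v; first by case: ifP => //=; rewrite !ltnS.
by case: ifP.
Qed.

Lemma len_gt0 e : valid e -> 0 < len e.
Proof.
have a := yR_bound n0 : _ <= yR <= _; have b := yL_bound n0 : _ <= yL <= _.
case: e => [| | |k|k] //= v; try lra.
  by have [lt _] := @va_step R n n0 k v; lra.
by have [lt _] := @vb_step R n n0 k v; lra.
Qed.

Lemma dir_unit e : dot (dir e) (dir e) = 1.
Proof. by case: e => [| | |k|k]; rewrite /dot /= ?(fun_if, mulr0); try case: (odd k); try field; ring. Qed.

Lemma src_next e : valid e -> src (next e) = src e + len e *: dir e.
Proof.
have vm : vb mB = (4, yR) := vb_last _.
have v0 : va 0 = (-4, yL) by [].
move=> v; apply: plane_eq; rewrite /GRing.add /GRing.scale /= /GRing.scale /=.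
- case: e v => [| | |k|k] //= v; try (by ring).
  + have [lt E] := @va_step R n n0 k v; have -> : (src (if (k <= nA)%N then Up k.+1 else Down 0)).1 = (va k.+1).1.
      case: ifP => //= k1; have -> : k = nA.+1 by move: v k1; clear; lia.
      by rewrite va_last.
    by move: E; rewrite /slope; case: (odd k); lra.
  + have [lt E] := @vb_step R n n0 k v; have -> : (src (if (k.+1 < mB)%N then Down k.+1 else Right)).1 = (vb k.+1).1.
      case: ifP => //= k1; have -> : k.+1 = mB by move: v k1; clear; lia.
      by rewrite vm.
    by move: E; rewrite /slope; case: (odd k); lra.
- case: e v => [| | |k|k] //= v; try (by ring).
  + have -> : (src (if (k <= nA)%N then Up k.+1 else Down 0)).2 = (va k.+1).2.
      case: ifP => //= k1; have -> : k = nA.+1 by move: v k1; clear; lia.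
      by rewrite va_last.
    by field.
  + have -> : (src (if (k.+1 < mB)%N then Down k.+1 else Right)).2 = (vb k.+1).2.
      case: ifP => //= k1; have -> : k.+1 = mB by move: v k1; clear; lia.
      by rewrite vm.
    by field.
Qed.

Lemma nrm_next e : valid e -> nrm (next e) = dir (next e) - dir e.
Proof.
have odd_mB : odd mB = false by rewrite /mB oddS oddD odd_nB oddM.
move=> v; case: e v => [| | |k|k] /= v; try (by apply: plane_eq => /=; ring || field).
- case: ifP => k1 /=.
    by apply: plane_eq; rewrite /=; case: (odd k) => /=; field.
  have -> : k = nA.+1 by move: v k1; clear; lia.
  by rewrite oddS odd_nA; apply: plane_eq => /=; field.
- case: ifP => k1 /=.
    by apply: plane_eq; rewrite /=; case: (odd k) => /=; field.
  have Ek : k.+1 = mB by move: v k1; clear; lia.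
  have -> : odd k = true by move: odd_mB; rewrite -Ek oddS; case: (odd k).
  by apply: plane_eq => /=; field.
Qed.

Lemma dir_turn e : valid e -> dir (next e) != dir e.
Proof.
move=> v; rewrite -subr_eq0 -nrm_next //; apply/eqP => E.
have : (nrm (next e)).1 = 0 by rewrite E.
by case: (next e) => [| | |[|k]|[|k]] /=; try lra; case: (~~ odd k); lra.
Qed.

Variable w : R.
Hypothesis w_le : w <= 15 / 2.

Definition region e p : Prop :=
  [/\ `|cross (dir e) (p - src e)| <= w / 2, 0 <= dot (p - src e) (nrm e) &
      0 <= dot (p - src (next e)) (nrm (next e))].

Definition tilt (k : nat) : R := if odd k then - (3 / 4) else 3 / 4.
Definition axisA k x : R := (va k).2 + tilt k * (x - (va k).1).
Definition axisB k x : R := (vb k).2 + tilt k * (x - (vb k).1).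

Lemma region_Right p : region Right p ->
  [/\ 4^-1 <= p.1 <= 31 / 4, p.1 + p.2 <= 13 & p.1 - 4 <= 2 * (p.2 - yR)].
Proof.
have h := w_le; case; rewrite /cross /dot /= ler_norml => h1 h2 h3.
by split; lra.
Qed.

Lemma region_Top p : region Top p ->
  [/\ 21 / 4 <= p.2 <= 51 / 4, p.1 + p.2 <= 13 & p.2 - p.1 <= 13].
Proof.
have h := w_le; case; rewrite /cross /dot /= ler_norml => h1 h2 h3.
by split; lra.
Qed.

Lemma region_Left p : region Left p ->
  [/\ - (31 / 4) <= p.1 <= - 4^-1, p.2 <= 13 + p.1 & 0 <= p.1 + 4 + 2 * (p.2 - yL)].
Proof.
have h := w_le; case; rewrite /cross /dot /= ler_norml => h1 h2 h3.
by split; lra.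
Qed.

Lemma near_axis (s : bool) (a b x y : R) :
  `|cross (if s then - (4 / 5) else 4 / 5, 3 / 5) (x - a, y - b)| <= w / 2 ->
  - (75 / 16) <= y - (b + (if s then - (3 / 4) else 3 / 4) * (x - a)) <= 75 / 16.
Proof. by have h := w_le; rewrite /cross /= ler_norml; case: s; lra. Qed.

Lemma region_axisA k p : region (Up k) p ->
  - (75 / 16) <= p.2 - axisA k p.1 <= 75 / 16.
Proof. by case=> h _ _; exact: (near_axis h). Qed.

Lemma region_axisB k p : region (Down k) p ->
  - (75 / 16) <= p.2 - axisB k p.1 <= 75 / 16.
Proof.
case=> h _ _; apply: (@near_axis (odd k) (vb k).1); move: h.
by rewrite -normrN /cross /=; case: (odd k); congr (_ <= _); congr (`|_|); ring.
Qed.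

Lemma nrm_Up k p : dot (p - va k.+1) (nrm (Up k.+1)) =
  (if odd k then 8 / 5 else - (8 / 5)) * (p.1 - (va k.+1).1).
Proof. by rewrite /dot /= if_neg; case: (odd k); ring. Qed.

Lemma nrm_Down k p : dot (p - vb k.+1) (nrm (Down k.+1)) =
  (if odd k then - (8 / 5) else 8 / 5) * (p.1 - (vb k.+1).1).
Proof. by rewrite /dot /= if_neg; case: (odd k); ring. Qed.

Lemma va1 k : (k <= nA)%N -> (va k.+1).1 = de * (~~ odd k)%:R.
Proof. by move=> h; rewrite va_mid. Qed.

Lemma va2 k : (k <= nA)%N -> (va k.+1).2 = 10 - (nA%:R - k%:R) * sg.
Proof. by move=> h; rewrite va_mid. Qed.

Lemma region_Up0 p : region (Up 0) p ->
  [/\ 0 <= p.1 + 4 + 2 * (p.2 - yL), p.1 <= de & axisA 0 p.1 = yE + 3 / 4 * (p.1 - de)].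
Proof.
case=> _; rewrite (nrm_Up 0) va1 // {1}/dot /= => h1 h2; split; try lra.
by rewrite /axisA /tilt (_ : va 0 = (-4, yL)) // /yL /=; lra.
Qed.

Lemma region_Up k p : (k < nA)%N -> region (Up k.+1) p ->
  0 <= p.1 <= de /\ (va k.+1).2 <= axisA k.+1 p.1 <= (va k.+2).2.
Proof.
have d := de_gt0 n0 : 0 < de; have s := sgE n : sg = _.
move=> kN [_]; rewrite [next _]/= kN !nrm_Up !va1 ?(ltnW kN) // /axisA /tilt.
rewrite !va2 ?va1 ?(ltnW kN) // !oddS -(natr1 k).
by case: (odd k) => /= h1 h2; lra.
Qed.

Lemma region_UpLast p : region (Up nA.+1) p ->
  [/\ 0 <= p.1, 4 * p.1 + 3 * (p.2 - 10) <= 20 & axisA nA.+1 p.1 = 10 + 3 / 4 * p.1].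
Proof.
case=> _; rewrite [next _]/= ltnn nrm_Up va1 // odd_nA {1}/dot /= => h1 h2.
split; try lra.
by rewrite /axisA /tilt oddS odd_nA va2 // va1 // odd_nA /=; lra.
Qed.

Lemma region_Down0 p : region (Down 0) p ->
  [/\ 0 <= p.1, 4 * p.1 + 3 * (p.2 - 10) <= 20 & axisB 0 p.1 = 10 + 3 / 4 * p.1].
Proof.
have v : vb 1 = (0, 10) by rewrite vb_mid //= mulr0 mul0r subr0.
case=> _; rewrite [next _]/= nrm_Down v {1}/dot /= => h1 h2.
split; try lra.
by rewrite /axisB /tilt /=; lra.
Qed.

Lemma region_Down k p : (k.+1 < nB)%N -> region (Down k.+1) p ->
  0 <= p.1 <= de /\ (vb k.+2).2 <= axisB k.+1 p.1 <= (vb k.+1).2.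
Proof.
have d := de_gt0 n0 : 0 < de; have s := sgE n : sg = _.
move=> kN [_]; rewrite [next _]/= (_ : (k.+2 < mB)%N); last first.
  by move: kN; rewrite /mB; clear; lia.
rewrite !nrm_Down /axisB /tilt !vb_mid ?(ltnW kN) // !oddS -(natr1 k).
by case: (odd k) => /= h1 h2; lra.
Qed.

Let fold0 : vb nB.+1 = (2 * de, - (2 * sg)).
Proof.
have n2 : (0 < 2 * n)%N by rewrite muln_gt0.
by rewrite -[in LHS](addn0 nB) vb_fold // fy0 /fx /= addr0.
Qed.

Lemma region_Cross p : region (Down nB) p ->
  0 <= p.1 <= 2 * de /\ - (2 * sg) <= axisB nB p.1 <= 0.
Proof.
have d := de_gt0 n0 : 0 < de; have s := sgE n : sg = _.
have v : vb nB = (0, 0) := nB_index n0.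
case=> _; rewrite [next _]/= (_ : (nB.+1 < mB)%N); last first.
  by rewrite /mB; move: n0; clear; lia.
rewrite nrm_Down -[nB]/((40 * fine n).+1) nrm_Down /axisB /tilt oddS oddM /= -/nB v fold0 /=.
by lra.
Qed.

Lemma region_fold j p : (j.+1 < 2 * n)%N -> region (Down (nB + j).+1) p ->
  (if odd j then fx j * de <= p.1 <= fx j.+1 * de else fx j.+1 * de <= p.1 <= fx j * de) /\
  fy n j.+1 <= axisB (nB + j).+1 p.1 <= (fy n j : R).
Proof.
have d := de_gt0 n0 : 0 < de; have s := sgE n : sg = _.
have odd_nB := odd_nB n; move=> jn [_].
have v1 := @vb_fold R n j.+1 jn; rewrite addnS in v1.
have v0 := @vb_fold R n j (ltnW jn).
rewrite [next _]/= (_ : ((nB + j).+2 < mB)%N); last first.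
  by rewrite /mB; move: jn; clear; lia.
rewrite !nrm_Down /axisB /tilt v0 v1 oddS oddD odd_nB /=.
have a := @fx_step R j; have b := @fy_step R n j; rewrite s in b.
have jd : 0 <= j%:R * de by rewrite mulr_ge0 // ltW.
have E : fx j.+1 * de = fx j * de - slope j * (3 / 4 * (j%:R + 3)) * de.
  by rewrite -mulrBl -a addrC subrK.
move: E; rewrite /slope; case: (odd j) => /= E h1 h2; lra.
Qed.

Lemma region_last p : region (Down (nB + (2 * n).-1).+1) p ->
  [/\ - n%:R * de <= p.1, p.1 - 4 <= 2 * (p.2 - yR) &
      axisB (nB + (2 * n).-1).+1 p.1 = yF - 3 / 4 * (p.1 + n%:R * de)].
Proof.
have n2 : (0 < 2 * n)%N by rewrite muln_gt0.
have v0 := @vb_fold R n (2 * n).-1; rewrite prednK // leqnn fx_last // in v0.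
have {}v0 := v0 isT.
have od : odd (2 * n).-1 = true by move: n0; clear; lia.
have e : (nB + (2 * n).-1).+2 = mB by rewrite /mB -addnS prednK.
case=> _; rewrite [next _]/= e ltnn nrm_Down v0 oddD odd_nB od {1}/dot /= => h1 h2.
split; try lra.
by rewrite /axisB /tilt v0 oddS oddD odd_nB od /= -/yF; lra.
Qed.

Definition tipd p : R := Num.min 1 (4 - (4 * p.1 + 3 * (p.2 - 10)) / 5).
Definition slantR p : R := (13 - p.1 - p.2) / 20.
Definition slantL p : R := (13 + p.1 - p.2) / 20.

Definition wave (j : nat) (s : R) : R :=
  if odd j then - 1 + 4 * Num.min (s - fx j) (fx j.+1 - s)
  else - 1 - 4 * Num.min (s - fx j.+1) (fx j - s).

Definition hgt e p : R :=
  match e with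
  | Right => slantR p | Top => 0 | Left => slantL p
  | Up k => Num.max (- tipd p + (axisA k p.1 - p.2) / 100)
              (slantL p - 10 * (p.1 + 4 + 2 * (p.2 - yL)))
  | Down k =>
      if (k < nB)%N then tipd p + (axisB k p.1 - p.2) / 100
      else if k == nB then
        Num.min (1 + (axisB k p.1 - p.2) / 100) (- 1 + 4 * (2 - p.1 / de))
      else if (k - nB < 2 * n)%N then wave (k - nB.+1) (p.1 / de)
      else Num.min (- 1 + 4 * (p.1 / de + n%:R))
             (slantR p + 40 * n%:R * (2 * (p.2 - yR) - (p.1 - 4)))
  end.

Let d0 : 0 < de := de_gt0 n0.
Let d1 : de <= 60^-1 := de_le n0.
Let s0 : sg = 3 / 4 * de := sgE n.
Let bR : -3 - 10^-1 <= yR <= -3 := yR_bound n0.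
Let bL : -13 - 10^-1 <= yL <= -13 := yL_bound n0.
Let bF : - 16^-1 <= yF <= - (5 * sg) := yF_bound n0.
Let eE : yE = -10 - sg := yEE n0.
Let nde : n%:R * de <= 60^-1 := (n_de n0).1.
Let n1' : (1 : R) <= n%:R := n1 n0.

Lemma tipd_1 p : 4 * p.1 + 3 * (p.2 - 10) <= 15 -> tipd p = 1.
Proof. by move=> h; rewrite /tipd min_l //; lra. Qed.

Lemma tipd_ge p : 4 * p.1 + 3 * (p.2 - 10) <= 17 -> 1 / 2 <= tipd p <= 1.
Proof. by move=> h; rewrite /tipd le_min ge_min lexx /= andbT; lra. Qed.

Lemma tipd_fold p : 4 * p.1 + 3 * (p.2 - 10) <= 20 ->
  0 < tipd p \/ 4 * p.1 + 3 * (p.2 - 10) = 20.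
Proof.
case: (ltrgtP (4 * p.1 + 3 * (p.2 - 10)) 20) => // h _; [left | by right].
by rewrite /tipd lt_min; lra.
Qed.

Lemma tipd_le1 p : tipd p <= 1. Proof. by rewrite /tipd ge_min lexx. Qed.

Lemma va_range k : (k <= nA)%N -> yE <= (va k.+1).2 <= 10.
Proof.
have sp : 0 < sg by move: s0 d0; lra.
move=> h; rewrite va2 // /yE.
have h1 : 0 <= k%:R * sg by rewrite mulr_ge0 // ltW.
have : 0 <= (nA%:R - k%:R) * sg by rewrite mulr_ge0 ?subr_ge0 ?ler_nat // ltW.
by lra.
Qed.

Lemma vb_range k : (k < nB)%N -> 0 <= (vb k.+1).2 <= 10.
Proof.
have sp : 0 < sg by move: s0 d0; lra.
move=> h; rewrite vb_mid //=; have h1 : 0 <= k%:R * sg by rewrite mulr_ge0 // ltW.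
have : 0 <= (nB%:R - k.+1%:R) * sg by rewrite mulr_ge0 ?subr_ge0 ?ler_nat // ltW.
by rewrite -natr1 mulrBl mulrDl (nB_sg n0); lra.
Qed.

(** Where the strips lie. *)
Lemma win_Up0 p : region (Up 0) p -> [/\ p.1 <= 60^-1, p.2 <= - (21 / 4) & tipd p = 1].
Proof.
move=> r; have [h1 h2 h3] := region_Up0 r; have := region_axisA r; rewrite h3 => h4.
have := d0; have := d1; have := s0; have := eE => e1 e2 e3 e4.
by split; [lra | lra | apply: tipd_1; lra].
Qed.

Lemma win_Up k p : (k < nA)%N -> region (Up k.+1) p ->
  [/\ 0 <= p.1 <= 60^-1, -15 <= p.2 <= 59 / 4 &
      hgt (Up k.+1) p = - 1 + (axisA k.+1 p.1 - p.2) / 100].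
Proof.
move=> kN r; have [h1 h2] := region_Up kN r; have h3 := region_axisA r.
have := va_range (ltnW kN); have := va_range kN => v1 v2.
have := d0; have := d1; have := s0; have := eE => e1 e2 e3 e4.
have b := bL; split; [lra | lra |]; rewrite /hgt tipd_1; last by lra.
have y1 : yL + 3 / 4 * (4 + de) = yE by rewrite /yL; lra.
by rewrite max_l // /slantL; lra.
Qed.

Lemma win_UpLast p : region (Up nA.+1) p ->
  [/\ 0 <= p.1, 85 / 16 + 3 / 4 * p.1 <= p.2 & hgt (Up nA.+1) p =
    - tipd p + (10 + 3 / 4 * p.1 - p.2) / 100].
Proof.
move=> r; have [h1 h2 h3] := region_UpLast r; have := region_axisA r; rewrite h3 => h4.
have b := bL; have t := tipd_le1 p; split; [lra | lra |].
by rewrite /hgt h3 max_l // /slantL; lra.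
Qed.

Lemma win_Down0 p : region (Down 0) p ->
  [/\ 0 <= p.1, 85 / 16 + 3 / 4 * p.1 <= p.2 & hgt (Down 0) p =
    tipd p + (10 + 3 / 4 * p.1 - p.2) / 100].
Proof.
move=> r; have [h1 h2 h3] := region_Down0 r; have := region_axisB r; rewrite h3 => h4.
by split; [lra | lra |]; rewrite /hgt h3.
Qed.

Lemma win_Down k p : (k.+1 < nB)%N -> region (Down k.+1) p ->
  [/\ 0 <= p.1 <= 60^-1, - 5 <= p.2 <= 59 / 4 &
      hgt (Down k.+1) p = 1 + (axisB k.+1 p.1 - p.2) / 100].
Proof.
move=> kN r; have [h1 h2] := region_Down kN r; have h3 := region_axisB r.
have := vb_range (ltnW kN); have := vb_range kN => v1 v2.
have e1 := d1; split; [lra | lra |]; rewrite /hgt kN tipd_1 //; lra.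
Qed.

Lemma fy_le i k : (i <= k)%N -> fy n k <= fy n i :> R.
Proof.
move=> ik; rewrite /fy lerN2 ler_wpM2r //; first by move: s0 d0; lra.
have ik' : (i%:R : R) <= k%:R by rewrite ler_nat.
by rewrite ler_wpM2r // ler_pM ?addr_ge0 // lerD2r.
Qed.

Lemma win_Cross p : region (Down nB) p ->
  [/\ 0 <= p.1 / de <= 2, p.1 <= 30^-1, - 5 <= p.2 <= 5 & hgt (Down nB) p =
    Num.min (1 + (axisB nB p.1 - p.2) / 100) (- 1 + 4 * (2 - p.1 / de))].
Proof.
move=> r; have [h1 h2] := region_Cross r; have h3 := region_axisB r.
have e0 := d0; have e1 := d1; have e2 := s0; split; [|lra|lra|].
  by apply/andP; split; [apply: divr_ge0; lra | rewrite ler_pdivrMr; lra].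
by rewrite /hgt ltnn eqxx.
Qed.

Lemma win_fold j p : (j.+1 < 2 * n)%N -> region (Down (nB + j).+1) p ->
  [/\ (if odd j then fx j <= p.1 / de <= fx j.+1 else fx j.+1 <= p.1 / de <= fx j),
      - 30^-1 <= p.1 <= 30^-1, -5 <= p.2 <= 5 &
      hgt (Down (nB + j).+1) p = wave j (p.1 / de)].
Proof.
move=> jn r; have [h1 h2] := region_fold jn r; have h3 := region_axisB r.
have e0 := d0; have e1 := d1; have e2 := nde; have e3 := bF.
have y1 : fy n j <= 0 :> R.
  by apply: (le_trans (fy_le (leq0n j))); rewrite fy0; move: s0 e0; lra.
have y2 : yF <= fy n j.+1 by apply: fy_le; move: jn; clear; lia.
split.
- by move: h1; case: ifP => _ /andP[a b]; (apply/andP; split; [by rewrite ler_pdivlMr | by rewrite ler_pdivrMr]).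
- have a := @fx_bound R n _ jn; have b := @fx_bound R n _ (ltnW jn).
  have k1 : - (n%:R * de) <= fx j * de <= (n%:R + 1) * de by rewrite -mulNr !ler_pM2r.
  have k2 : - (n%:R * de) <= fx j.+1 * de <= (n%:R + 1) * de by rewrite -mulNr !ler_pM2r.
  by move: h1; case: ifP => _; lra.
- by lra.
rewrite /hgt ltnNge (leq_trans (leq_addr j nB) (leqnSn _)) /=.
rewrite gtn_eqF ?ltnS ?leq_addr // subSS addKn.
by rewrite -addnS addKn jn.
Qed.

Lemma win_last p : region (Down (nB + (2 * n).-1).+1) p ->
  [/\ - n%:R <= p.1 / de /\ - 60^-1 <= p.1, p.2 <= 5, p.1 - 4 <= 2 * (p.2 - yR),
      p.1 <= 30^-1 -> - 5 <= p.2 /\ 2^-1 <= 2 * (p.2 - yR) - (p.1 - 4) &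
      hgt (Down (nB + (2 * n).-1).+1) p = Num.min (- 1 + 4 * (p.1 / de + n%:R))
             (slantR p + 40 * n%:R * (2 * (p.2 - yR) - (p.1 - 4)))].
Proof.
move=> r; have [h1 h2 h3] := region_last r; have := region_axisB r; rewrite h3 => h4.
have n2 : (0 < 2 * n)%N by rewrite muln_gt0.
have e0 := d0; have e2 := nde; have e3 := bF; have e4 := s0.
have y1 : yR = yF - 3 / 4 * (4 + n%:R * de) by [].
have nd0 : 0 <= n%:R * de by rewrite mulr_ge0 // ltW.
split.
- by split; [rewrite ler_pdivlMr | lra].
- by lra.
- by [].
- by move=> x0; lra.
rewrite /hgt ltnNge (leq_trans (leq_addr _ nB) (leqnSn _)) /=.
rewrite gtn_eqF ?ltnS ?leq_addr // -addnS addKn prednK //.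
by rewrite ltnn.
Qed.

Definition fold_at e f p : Prop := f = next e /\ dot (p - src f) (nrm f) = 0.

Lemma sep_Right_Top p : region Right p -> region Top p ->
  0 < slantR p \/ fold_at Right Top p.
Proof.
move=> r _; have [_ h _] := region_Right r.
case: (ltrgtP (p.1 + p.2) 13) => // E; [by left; rewrite /slantR; lra | by lra |].
by right; split=> //; rewrite /dot /=; lra.
Qed.

Lemma sep_Left_Top p : region Left p -> region Top p ->
  0 < slantL p \/ fold_at Top Left p.
Proof.
move=> r _; have [_ h _] := region_Left r.
case: (ltrgtP p.2 (13 + p.1)) => // E; [by left; rewrite /slantL; lra | by lra |].
by right; split=> //; rewrite /dot /=; lra.
Qed.

Lemma sep_UpLast_Right p : region (Up nA.+1) p -> region Right p ->
  hgt (Up nA.+1) p < 0 <= slantR p.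
Proof.
move=> r r'; have [h1 h2 h3] := region_Right r'; have [g1 g2 ->] := win_UpLast r.
by rewrite tipd_1 /slantR; lra.
Qed.

Lemma sep_Right_Down0 p : region Right p -> region (Down 0) p ->
  slantR p < hgt (Down 0) p.
Proof.
move=> r r'; have [h1 h2 h3] := region_Right r; have [g1 g2 ->] := win_Down0 r'.
have := region_axisB r'; have [_ _ ->] := region_Down0 r' => h4.
by rewrite tipd_1 /slantR; lra.
Qed.

Lemma sep_Right_last p : region Right p -> region (Down (nB + (2 * n).-1).+1) p ->
  slantR p < hgt (Down (nB + (2 * n).-1).+1) p \/
  fold_at (Down (nB + (2 * n).-1).+1) Right p.
Proof.
move=> r r'; have [h1 h2 h3] := region_Right r; have [[g1 g2] g3 g4 _ ->] := win_last r'.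
have n2 : (0 < 2 * n)%N by rewrite muln_gt0.
case: (ltrgtP (p.1 - 4) (2 * (p.2 - yR))) => // E; [left | by lra |].
  rewrite lt_min; apply/andP; split.
    have : 15 <= p.1 / de.
      by rewrite ler_pdivlMr; have := d1; have := d0; lra.
    by have := n1'; have := bR; rewrite /slantR; lra.
  by rewrite ltrDl mulr_gt0 //; have := n1'; lra.
right; split; last by rewrite /dot /=; lra.
by rewrite /= -addnS prednK // -[(nB + 2 * n).+1]/mB ltnn.
Qed.

Lemma sep_Left_Up0 p : region Left p -> region (Up 0) p ->
  hgt (Up 0) p < slantL p \/ fold_at Left (Up 0) p.
Proof.
move=> r r'; have [h1 h2 h3] := region_Left r; have [g1 g2 g3] := win_Up0 r'.
have h4 := region_axisA r'.
case: (ltrgtP 0 (p.1 + 4 + 2 * (p.2 - yL))) => // E; [left | by lra |].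
  by rewrite /hgt g3 gt_max /slantL; apply/andP; split; lra.
by right; split=> //; rewrite /dot /=; lra.
Qed.

Lemma sep_Up_Top k p : (k <= nA)%N -> region (Up k.+1) p -> region Top p ->
  hgt (Up k.+1) p < 0.
Proof.
rewrite leq_eqVlt => /orP[/eqP -> | kN] r r'; have [h1 h2 h3] := region_Top r'.
  have [g1 g2 ->] := win_UpLast r.
  by have := @tipd_ge p; lra.
have [g1 g2 ->] := win_Up kN r; have [_ h] := region_Up kN r.
by have := region_axisA r; lra.
Qed.

Lemma sep_Top_Down k p : (k < nB)%N -> region (Down k) p -> region Top p ->
  0 < hgt (Down k) p.
Proof.
case: k => [_|k kN] r r'; have [h1 h2 h3] := region_Top r'.
  have [g1 g2 ->] := win_Down0 r; have := region_axisB r.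
  have [_ _ ->] := region_Down0 r.
  by have := @tipd_ge p; lra.
have [g1 g2 ->] := win_Down kN r; have := region_axisB r; lra.
Qed.

Lemma axisA_low k p : (k <= nA)%N -> region (Up k.+1) p ->
  (va k.+1).2 < axisA k.+1 p.1 \/ p.1 = (va k.+1).1.
Proof.
move=> kN r; have [E|ne] := eqVneq p.1 (va k.+1).1; [by right|left].
rewrite lt_neqAle; apply/andP; split; last first.
  move: kN r; rewrite leq_eqVlt => /orP[/eqP -> | kN] r.
    have [h1 _ ->] := region_UpLast r.
    by have := va_range (leqnn nA); lra.
  by have [_ /andP[]] := region_Up kN r.
rewrite /axisA -subr_eq0 opprD addNKr oppr_eq0 mulf_neq0 ?subr_eq0 //.
by rewrite /tilt; case: ifP => _; [rewrite oppr_eq0|]; rewrite lt0r_neq0 //; lra.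
Qed.

Lemma axisA_high k p : (k <= nA)%N -> region (Up k) p -> axisA k p.1 <= (va k.+1).2.
Proof.
case: k => [_|k kN] r; last by have [_ /andP[]] := region_Up kN r.
have [_ h ->] := region_Up0 r; have : (va 1).2 = yE by rewrite va2 // subr0.
by lra.
Qed.

Lemma axisA_lt k l p : (k < l)%N -> (l <= nA.+1)%N -> region (Up k) p -> region (Up l) p ->
  axisA k p.1 < axisA l p.1 \/ fold_at (Up k) (Up l) p.
Proof.
case: l => // l kl; rewrite ltnS => lN r r'; have kN : (k <= nA)%N := leq_trans (kl : (k <= l)%N) lN.
have h1 := axisA_high kN r; have h2 := axisA_low lN r'.
move: kl; rewrite ltnS leq_eqVlt => /orP[/eqP E | kl].
  rewrite -E in lN r' h2 *; case: h2 => [h2|h2]; first by left; apply: le_lt_trans h2.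
  by right; split; rewrite /= ?lN // nrm_Up h2 subrr mulr0.
left; have lt : (va k.+1).2 < (va l.+1).2.
  by apply: (knots_lt (m := nA.+2) (va_knots n0)); rewrite !ltnS kl leqW.
by apply: (le_lt_trans h1); case: h2 => h2; [apply: lt_trans lt h2 | rewrite /axisA h2 subrr mulr0 addr0].
Qed.

Lemma hgt_Up k p : (k <= nA)%N -> region (Up k.+1) p ->
  hgt (Up k.+1) p = - tipd p + (axisA k.+1 p.1 - p.2) / 100 /\
  (p.1 <= 60^-1 -> slantL p - 10 * (p.1 + 4 + 2 * (p.2 - yL)) < hgt (Up k.+1) p).
Proof.
rewrite leq_eqVlt => /orP[/eqP -> | kN] r.
  have [h1 h2 ->] := win_UpLast r; have [_ _ ->] := region_UpLast r; split=> // _.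
  have := tipd_le1 p; have := region_axisA r; have [_ _ ->] := region_UpLast r.
  by have := bL; rewrite /slantL; lra.
have [h1 h2 h3] := win_Up kN r; have := region_axisA r; have [_ h4] := region_Up kN r.
have v1 := va_range kN; have v2 := va_range (ltnW kN); move=> h5.
rewrite h3 tipd_1; last by lra.
split=> // _; have y1 : yL + 3 / 4 * (4 + de) = yE by rewrite /yL; lra.
by have := eE; have := s0; have := d0; have := d1; have := bL; rewrite /slantL; lra.
Qed.

Lemma sep_Up_Up k l p : (k < l)%N -> (l <= nA.+1)%N -> region (Up k) p -> region (Up l) p ->
  hgt (Up k) p < hgt (Up l) p \/ fold_at (Up k) (Up l) p.
Proof.
move=> kl lN r r'; case: (axisA_lt kl lN r r') => [h|]; [left | by right].
case: l kl lN r' h => // l kl lN r' h; have [g1 g2] := hgt_Up lN r'.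
case: k kl r h => [_|k kl] r h.
  have [h1 _ h3] := win_Up0 r.
  by rewrite {1}/hgt gt_max g2 // g1 ltrD2l ltr_pM2r ?ltrD2r ?invr_gt0 //; lra.
have [f1 _] := hgt_Up (leq_trans (ltnW kl) lN) r.
by rewrite f1 g1 ltrD2l ltr_pM2r ?ltrD2r ?invr_gt0 //; lra.
Qed.

Lemma axisB_high k p : (k < nB)%N -> region (Down k.+1) p ->
  axisB k.+1 p.1 < (vb k.+1).2 \/ p.1 = (vb k.+1).1.
Proof.
move=> kN r; have [E|ne] := eqVneq p.1 (vb k.+1).1; [by right|left].
rewrite lt_neqAle; apply/andP; split.
  rewrite /axisB -subr_eq0 addrAC subrr add0r mulf_neq0 ?subr_eq0 //.
  by rewrite /tilt; case: ifP => _; [rewrite oppr_eq0|]; rewrite lt0r_neq0 //; lra.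
move: kN r; rewrite leq_eqVlt => /orP[/eqP E | kN] r.
  by rewrite E in r *; have [_ /andP[_ h]] := region_Cross r; rewrite (nB_index n0).
by have [_ /andP[]] := region_Down kN r.
Qed.

Lemma axisB_low k p : (k < nB)%N -> region (Down k) p -> (vb k.+1).2 <= axisB k p.1.
Proof.
case: k => [_|k kN] r; last by have [_ /andP[]] := region_Down kN r.
have [h _ ->] := region_Down0 r; have : (vb 1).2 = 10 by rewrite vb_mid //= mul0r subr0.
by lra.
Qed.

Lemma axisB_lt k l p : (k < l)%N -> (l <= nB)%N -> region (Down k) p -> region (Down l) p ->
  axisB l p.1 < axisB k p.1 \/ fold_at (Down k) (Down l) p.
Proof.
case: l => // l kl lN r r'; have kN := leq_trans kl lN.
have h1 := axisB_low kN r; have h2 := axisB_high lN r'.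
have mN : (l.+1 < mB)%N by rewrite /mB; move: lN; clear; lia.
move: kl; rewrite ltnS leq_eqVlt => /orP[/eqP E | kl].
  rewrite -E in lN r' h2 mN *; case: h2 => [h2|h2]; first by left; apply: lt_le_trans h1.
  by right; split; rewrite /= ?mN // nrm_Down h2 subrr mulr0.
left; have lt : (vb l.+1).2 < (vb k.+1).2.
  rewrite -ltrN2; apply: (knots_lt (m := mB) (t := fun k => - (vb k).2) (vb_knots n0)).
  by rewrite !ltnS kl ltnW.
by apply: lt_le_trans h1; case: h2 => h2; [apply: lt_trans h2 lt | rewrite /axisB h2 subrr mulr0 addr0].
Qed.

Lemma hgt_Down k p : (k < nB)%N -> hgt (Down k) p = tipd p + (axisB k p.1 - p.2) / 100.
Proof. by rewrite /hgt => ->. Qed.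

Lemma sep_Down_Down k l p : (k < l)%N -> (l <= nB)%N -> region (Down k) p ->
  region (Down l) p -> hgt (Down l) p < hgt (Down k) p \/ fold_at (Down k) (Down l) p.
Proof.
move=> kl lN r r'; case: (axisB_lt kl lN r r') => [h|]; [left | by right].
rewrite (hgt_Down _ (leq_trans kl lN)); move: (lN); rewrite leq_eqVlt => /orP[/eqP E|lN'].
  rewrite E in kl r' h *; have [h1 h2 h3 ->] := win_Cross r'.
  rewrite gt_min; apply/orP; left.
  case: k kl r h => [_|k kl] r h; first by have [] := win_Down0 r; lra.
  have kl' : (k.+1 < nB)%N by [].
  have := region_axisB r; have [h4 _ _] := win_Down kl' r.
  by rewrite tipd_1; lra.
by rewrite hgt_Down // ltrD2l ltr_pM2r ?ltrD2r ?invr_gt0 //; lra.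
Qed.

Lemma fx_even j : ~~ odd j -> fx j = 2 + j./2%:R /\ fx j.+1 = - (1 + j./2%:R).
Proof.
move=> h; rewrite /fx (negbTE h) oddS h; split=> //.
by rewrite -uphalfE uphalf_half (negbTE h).
Qed.

Lemma fx_odd j : odd j -> fx j = - (1 + j./2%:R) /\ fx j.+1 = 3 + j./2%:R.
Proof.
move=> h; rewrite /fx h oddS h; split=> //=.
by rewrite uphalf_half h -natr1 /=; ring.
Qed.

Ltac mincase := match goal with |- context [Num.min ?a ?b] =>
  case: (min_cases a b) => -[-> ?] end.

Lemma min_ge (a b c : R) : c <= a -> c <= b -> c <= Num.min a b.
Proof. by move=> h1 h2; rewrite le_min h1. Qed.

Lemma wave_middle j (s : R) : 0 <= s <= 1 -> if odd j then 3 <= wave j s else wave j s <= - 5.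
Proof.
have h0 : (0 : R) <= j./2%:R by [].
move=> h; rewrite /wave; case: (boolP (odd j)) => o.
  have [-> ->] := fx_odd o.
  have : (1 : R) <= Num.min (s - - (1 + j./2%:R)) (3 + j./2%:R - s) by apply: min_ge; lra.
  by lra.
have [-> ->] := fx_even o.
have : (1 : R) <= Num.min (s - - (1 + j./2%:R)) (2 + j./2%:R - s) by apply: min_ge; lra.
by lra.
Qed.

Lemma time01 p : 0 <= p.1 <= de -> 0 <= p.1 / de <= 1.
Proof.
have e := d0; move=> h; apply/andP; split; first by apply: divr_ge0; lra.
by rewrite ler_pdivrMr; lra.
Qed.

Lemma mid_Up k p : (k < nA)%N -> region (Up k.+1) p ->
  [/\ 0 <= p.1 / de <= 1, p.1 <= 60^-1, -15 <= p.2 <= 59 / 4 &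
      - (21 / 20) <= hgt (Up k.+1) p <= - (19 / 20)].
Proof.
move=> kN r; have [h1 h2 ->] := win_Up kN r; have [/time01 h3 _] := region_Up kN r.
by have := region_axisA r; split; lra.
Qed.

Lemma mid_Down k p : (k.+1 < nB)%N -> region (Down k.+1) p ->
  [/\ 0 <= p.1 / de <= 1, p.1 <= 60^-1, -5 <= p.2 <= 59 / 4 &
      19 / 20 <= hgt (Down k.+1) p <= 21 / 20].
Proof.
move=> kN r; have [h1 h2 ->] := win_Down kN r; have [/time01 h3 _] := region_Down kN r.
by have := region_axisB r; split; lra.
Qed.

Lemma mid_Cross p : region (Down nB) p ->
  [/\ 0 <= p.1 / de <= 2, -1 <= hgt (Down nB) p <= 21 / 20,
      p.1 / de <= 1 -> 19 / 20 <= hgt (Down nB) p &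
      hgt (Down nB) p = -1 -> p.1 / de = 2].
Proof.
move=> r; have [h1 h2 h3 ->] := win_Cross r; have h4 := region_axisB r.
split=> //.
- by rewrite ge_min le_min; apply/andP; split; [lra | apply/orP; left; lra].
- by move=> h; rewrite le_min; lra.
- by mincase; lra.
Qed.

(** Near the braid the last strand is only limited by its first bound. *)
Lemma near_last p : region (Down (nB + (2 * n).-1).+1) p -> p.1 <= 30^-1 ->
  [/\ - n%:R <= p.1 / de, -5 <= p.2 <= 5 &
      hgt (Down (nB + (2 * n).-1).+1) p < 19 * n%:R ->
      hgt (Down (nB + (2 * n).-1).+1) p = -1 + 4 * (p.1 / de + n%:R)].
Proof.
move=> r x1; have [[h1 h2] h3 _ h4 ->] := win_last r.
have {}h4 := h4 x1; split=> //; first by lra.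
have e := n1'; have : 20 * n%:R <= 40 * n%:R * (2 * (p.2 - yR) - (p.1 - 4)).
  have -> : 20 * n%:R = 40 * n%:R * 2^-1 :> R by field.
  by rewrite ler_wpM2l; lra.
have sl : 0 <= slantR p by rewrite /slantR; lra.
by mincase; lra.
Qed.

Lemma ge_last p (c : R) : region (Down (nB + (2 * n).-1).+1) p -> p.1 <= 30^-1 ->
  c < 19 * n%:R -> c < -1 + 4 * (p.1 / de + n%:R) -> c < hgt (Down (nB + (2 * n).-1).+1) p.
Proof.
move=> r x1 h1 h2; rewrite ltNge; apply/negP => h.
have [_ _ H] := near_last r x1; have := H (le_lt_trans h h1).
by lra.
Qed.

Lemma sep_Up_Cross k p : (0 < k <= nA)%N -> region (Up k) p -> region (Down nB) p ->
  hgt (Up k) p < hgt (Down nB) p.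
Proof.
case: k => // k kN r r'; have [h1 _ _ h2] := mid_Up kN r.
by have [_ _ h3 _] := mid_Cross r'; have := h3 _; lra.
Qed.

Lemma sep_Up_fold k j p : (0 < k <= nA)%N -> (j.+1 < 2 * n)%N -> region (Up k) p ->
  region (Down (nB + j).+1) p ->
  if odd j then hgt (Up k) p < hgt (Down (nB + j).+1) p
  else hgt (Down (nB + j).+1) p < hgt (Up k) p.
Proof.
case: k => // k kN jn r r'; have [h1 _ _ h2] := mid_Up kN r.
by have [_ _ _ ->] := win_fold jn r'; have := wave_middle j h1; case: (odd j); lra.
Qed.

Lemma sep_Up_last k p : (0 < k <= nA)%N -> region (Up k) p ->
  region (Down (nB + (2 * n).-1).+1) p -> hgt (Up k) p < hgt (Down (nB + (2 * n).-1).+1) p.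
Proof.
case: k => // k kN r r'; have [h1 h2 _ h3] := mid_Up kN r; have e := n1'.
by apply: ge_last => //; lra.
Qed.

Lemma sep_Down_fold k j p : (0 < k < nB)%N -> (j.+1 < 2 * n)%N -> region (Down k) p ->
  region (Down (nB + j).+1) p ->
  if odd j then hgt (Down k) p < hgt (Down (nB + j).+1) p
  else hgt (Down (nB + j).+1) p < hgt (Down k) p.
Proof.
case: k => // k kN jn r r'; have [h1 _ _ h2] := mid_Down kN r.
by have [_ _ _ ->] := win_fold jn r'; have := wave_middle j h1; case: (odd j); lra.
Qed.

Lemma sep_Down_last k p : (0 < k < nB)%N -> region (Down k) p ->
  region (Down (nB + (2 * n).-1).+1) p -> hgt (Down k) p < hgt (Down (nB + (2 * n).-1).+1) p.
Proof.
case: k => // k kN r r'; have [h1 h2 _ h3] := mid_Down kN r; have e := n1'.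
by apply: ge_last => //; lra.
Qed.

Lemma sep_Up_Down k l p : (k <= nA)%N -> (l < nB)%N -> region (Up k.+1) p -> region (Down l) p ->
  hgt (Up k.+1) p < hgt (Down l) p \/ fold_at (Up k.+1) (Down l) p.
Proof.
move=> kN lN r r'; have [h1 _] := hgt_Up kN r; have g1 := region_axisB r'.
have g2 := region_axisA r.
have far : 4 * p.1 + 3 * (p.2 - 10) <= 15 ->
    hgt (Up k.+1) p < hgt (Down l) p.
  by move=> /tipd_1 t; rewrite h1 hgt_Down // t; lra.
case: l lN r' g1 far => [_|l lN] r' g1 far; last first.
  by have [_ ? ? _] := mid_Down lN r'; left; apply: far; lra.
move: kN r g2 h1 far; rewrite leq_eqVlt => /orP[/eqP -> | kN] r g2 h1 far; last first.
  by have [_ ? ? _] := mid_Up kN r; left; apply: far; lra.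
have [_ a1 a2] := region_UpLast r; have [_ b1 b2] := region_Down0 r'.
case: (tipd_fold a1) => [t|t]; [left|right].
  by rewrite h1 hgt_Down // a2 b2; lra.
by split; rewrite /= ?ltnn // /dot /=; lra.
Qed.

Lemma sep_Cross_fold j p : (j.+1 < 2 * n)%N -> region (Down nB) p ->
  region (Down (nB + j).+1) p ->
  (if odd j then hgt (Down nB) p < hgt (Down (nB + j).+1) p
   else hgt (Down (nB + j).+1) p < hgt (Down nB) p) \/
  fold_at (Down nB) (Down (nB + j).+1) p.
Proof.
move=> jn r r'; have [h1 h2 h3 h4] := mid_Cross r; have [g1 _ _ ->] := win_fold jn r'.
have h0 : (0 : R) <= j./2%:R by [].
rewrite /wave; move: g1; case: (boolP (odd j)) => o g1.
  left; have [e1 e2] := fx_odd o; rewrite e1 e2.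
  have [_ _ _ ->] := win_Cross r; have a := region_axisB r.
  rewrite gt_min; mincase; apply/orP; [left|right]; lra.
have [e1 e2] := fx_even o; rewrite e1 e2 in g1 *.
case: (ltrgtP (p.1 / de) (2 + j./2%:R)) => E; [left | by lra |].
  have : (0 : R) < Num.min (p.1 / de - - (1 + j./2%:R)) (2 + j./2%:R - p.1 / de).
    by rewrite lt_min; lra.
  by lra.
have hj : j./2%:R = 0 :> R by lra.
have j00 : j = 0%N.
  by move/eqP: hj; rewrite pnatr_eq0 => /eqP; move: o; clear; lia.
rewrite j00 addn0; right; split.
  by rewrite /= (_ : (nB.+1 < mB)%N) // /mB; move: n0; clear; lia.
rewrite nrm_Down fold0 /=; have -> : p.1 = 2 * de; last by rewrite subrr mulr0.
by rewrite -(divfK (lt0r_neq0 d0) p.1) E hj addr0.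
Qed.

Lemma sep_Cross_last p : region (Down nB) p -> region (Down (nB + (2 * n).-1).+1) p ->
  hgt (Down nB) p < hgt (Down (nB + (2 * n).-1).+1) p.
Proof.
move=> r r'; have [h1 h2 h3 h4] := mid_Cross r; have [_ x1 _ _] := win_Cross r.
by have e := n1'; apply: ge_last => //; lra.
Qed.

Lemma half_lt i j : (i < j)%N -> odd i = odd j -> (i./2%:R : R) + 1 <= j./2%:R.
Proof. by move=> ij o; rewrite natr1 ler_nat; move: ij o; clear; lia. Qed.

Lemma fold_atP j p : (j.+2 < 2 * n)%N -> p.1 / de = fx j.+1 ->
  fold_at (Down (nB + j).+1) (Down (nB + j.+1).+1) p.
Proof.
move=> jn E; split.
  by rewrite /= (_ : ((nB + j).+2 < mB)%N) ?addnS // /mB; move: jn; clear; lia.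
rewrite nrm_Down vb_fold 1?ltnW //= -(divfK (lt0r_neq0 d0) p.1) E.
by rewrite subrr mulr0.
Qed.

Lemma sep_fold_fold i j p : (i < j)%N -> (j.+1 < 2 * n)%N ->
  region (Down (nB + i).+1) p -> region (Down (nB + j).+1) p ->
  (if odd j then hgt (Down (nB + i).+1) p < hgt (Down (nB + j).+1) p
   else hgt (Down (nB + j).+1) p < hgt (Down (nB + i).+1) p) \/
  fold_at (Down (nB + i).+1) (Down (nB + j).+1) p.
Proof.
move=> ij jn r r'; have iN : (i.+1 < 2 * n)%N by apply: leq_ltn_trans jn; rewrite ltnW.
have [h1 _ _ ->] := win_fold iN r; have [g1 _ _ ->] := win_fold jn r'.
have i0 : (0 : R) <= i./2%:R by []. have j0 : (0 : R) <= j./2%:R by [].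
set s := p.1 / de in h1 g1 *; rewrite /wave.
have [oj|oj] := boolP (odd j); have [oi|oi] := boolP (odd i).
- have h := half_lt ij (etrans oi (esym oj)); left.
  have [-> ->] := fx_odd oi; have [-> ->] := fx_odd oj.
  by mincase; mincase; lra.
- rewrite oj (negbTE oi) in h1 g1.
  have [e1 e2] := fx_even oi; have [f1 f2] := fx_odd oj.
  rewrite e1 e2 f1 f2 in h1 g1 *.
  have [E|E] := eqVneq s (- (1 + i./2%:R)).
    have [lt|] := ltrP (- (1 + j./2%:R)) s.
      left; have : (0 : R) < Num.min (s - - (1 + j./2%:R)) (3 + j./2%:R - s).
        by rewrite lt_min; apply/andP; split; have : (i./2%:R : R) <= j./2%:R; [rewrite ler_nat; move: ij; clear; lia | lra | rewrite ler_nat; move: ij; clear; lia | lra].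
      have : (0 : R) <= Num.min (s - - (1 + i./2%:R)) (2 + i./2%:R - s) by apply: min_ge; lra.
      by lra.
    move=> le; right; have Eij : j = i.+1.
      have : i./2%:R = j./2%:R :> R by lra.
      by move/eqP; rewrite eqr_nat => /eqP; move: oi oj ij; clear; lia.
    by rewrite Eij in jn *; apply: fold_atP => //; rewrite e2.
  left; have Ei : - (1 + i./2%:R) < s by rewrite lt_neqAle eq_sym E; lra.
  have hj : (i./2%:R : R) <= j./2%:R by rewrite ler_nat; move: ij; clear; lia.
  have : (0 : R) < Num.min (s - - (1 + j./2%:R)) (3 + j./2%:R - s).
    by rewrite lt_min; lra.
  have : (0 : R) <= Num.min (s - - (1 + i./2%:R)) (2 + i./2%:R - s) by apply: min_ge; lra.
  by lra.
- rewrite oi (negbTE oj) in h1 g1.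
  have [e1 e2] := fx_odd oi; have [f1 f2] := fx_even oj.
  rewrite e1 e2 f1 f2 in h1 g1 *.
  have hj : (i./2%:R : R) + 1 <= j./2%:R.
    by rewrite natr1 ler_nat; move: ij oi oj; clear; lia.
  have [E|E] := eqVneq s (2 + j./2%:R).
    right; have Eij : j = i.+1.
      have : (i./2.+1)%:R = j./2%:R :> R by rewrite -natr1; lra.
      by move/eqP; rewrite eqr_nat => /eqP; move: oi oj ij; clear; lia.
    have E2 : s = 3 + i./2%:R by lra.
    by rewrite Eij in jn *; apply: fold_atP => //; rewrite e2.
  left; have Ej : s < 2 + j./2%:R by rewrite lt_neqAle E; lra.
  have : (0 : R) < Num.min (s - - (1 + j./2%:R)) (2 + j./2%:R - s).
    by rewrite lt_min; lra.
  have : (0 : R) <= Num.min (s - - (1 + i./2%:R)) (3 + i./2%:R - s) by apply: min_ge; lra.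
  by lra.
- have h : (i./2%:R : R) + 1 <= j./2%:R.
    by apply: half_lt => //; rewrite (negbTE oi) (negbTE oj).
  left; have [-> ->] := fx_even oi; have [-> ->] := fx_even oj.
  by mincase; mincase; lra.
Qed.

Lemma sep_fold_last j p : (j.+1 < 2 * n)%N -> region (Down (nB + j).+1) p ->
  region (Down (nB + (2 * n).-1).+1) p ->
  hgt (Down (nB + j).+1) p < hgt (Down (nB + (2 * n).-1).+1) p \/
  fold_at (Down (nB + j).+1) (Down (nB + (2 * n).-1).+1) p.
Proof.
move=> jn r r'; have [h1 /andP[_ h2] _ ->] := win_fold jn r.
have [lo _ _] := near_last r' h2; have e := n1'.
have h0 : (0 : R) <= j./2%:R by [].
rewrite /wave; move: h1; case: (boolP (odd j)) => o h1.
  have [e1 e2] := fx_odd o; rewrite e1 e2 in h1 *.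
  have hn : (j./2%:R : R) + 2 <= n%:R.
    by rewrite -natrD ler_nat; move: jn o; clear; lia.
  left; apply: ge_last => //.
    have : Num.min (p.1 / de - - (1 + j./2%:R)) (3 + j./2%:R - p.1 / de) <= 2 + j./2%:R.
      by mincase; lra.
    by lra.
  have : Num.min (p.1 / de - - (1 + j./2%:R)) (3 + j./2%:R - p.1 / de) <= p.1 / de - - (1 + j./2%:R).
    by rewrite ge_min lexx.
  by lra.
have [e1 e2] := fx_even o; rewrite e1 e2 in h1 *.
have : (0 : R) <= Num.min (p.1 / de - - (1 + j./2%:R)) (2 + j./2%:R - p.1 / de) by apply: min_ge; lra.
case: (ltrgtP (- n%:R) (p.1 / de)) => E m; [| by lra |].
  by left; apply: ge_last => //; lra.
have hn : (j./2%:R : R) + 1 <= n%:R by rewrite natr1 ler_nat; move: jn o; clear; lia.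
have E' : p.1 / de = - (1 + j./2%:R) by lra.
have jj : (2 * n).-1 = j.+1.
  have : (j./2.+1)%:R = n%:R :> R by rewrite -natr1; lra.
  by move/eqP; rewrite eqr_nat => /eqP; move: jn o; clear; lia.
right; split.
  by rewrite jj /= (_ : ((nB + j).+2 < mB)%N) ?addnS // /mB; move: jn; clear; lia.
rewrite jj nrm_Down vb_fold //= e2 -(divfK (lt0r_neq0 d0) p.1) E'.
by rewrite subrr mulr0.
Qed.

Lemma Down_cases k : (k < mB)%N -> [\/ (k < nB)%N, k = nB,
  exists2 j, (j.+1 < 2 * n)%N & k = (nB + j).+1 | k = (nB + (2 * n).-1).+1].
Proof.
rewrite /mB ltnS => kN; case: (ltngtP k nB) => [h|h|->]; [exact: Or41| |exact: Or42].
case: (ltnP (k - nB) (2 * n)) => h'; [apply: Or43|apply: Or44].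
  by exists (k - nB).-1; move: h h'; clear; lia.
by move: h h' kN n0; clear; lia.
Qed.

Lemma Up_cases k : (k < nA.+2)%N -> k = 0%N \/ exists2 i, (i <= nA)%N & k = i.+1.
Proof. by case: k => [|k] h; [left | right; exists k]. Qed.

Definition place e : nat :=
  match e with
  | Right => 0 | Top => 1 | Left => 2
  | Up k => k.+3 | Down k => nA + k.+1.+4
  end.

Definition clear_of e f p : Prop :=
  [\/ hgt e p <> hgt f p, fold_at e f p | fold_at f e p].

Lemma clear_lt e f p : hgt e p < hgt f p -> clear_of e f p.
Proof. by move=> h; apply: Or31 => E; rewrite E ltxx in h. Qed.

Lemma clear_gt e f p : hgt f p < hgt e p -> clear_of e f p.
Proof. by move=> h; apply: Or31 => E; rewrite E ltxx in h. Qed.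

Lemma clear_if (b : bool) e f p :
  (if b then hgt e p < hgt f p else hgt f p < hgt e p) -> clear_of e f p.
Proof. by case: b; [exact: clear_lt | exact: clear_gt]. Qed.

Lemma clear_Right f p : valid f -> f <> Right -> region Right p -> region f p ->
  clear_of Right f p.
Proof.
case: f => [| | |k|k] v ne r r' //; have [h1 h2 h3] := region_Right r.
- by case: (sep_Right_Top r r') => [h|]; [exact: clear_gt | exact: Or32].
- by have [] := region_Left r'; lra.
- case: (Up_cases v) => [E|[i iN E]]; rewrite {}E in r' *.
    by have [] := win_Up0 r'; lra.
  move: iN r'; rewrite leq_eqVlt => /orP[/eqP -> | iN] r'.
    by have h := sep_UpLast_Right r' r; apply: clear_gt; rewrite /= in h *; lra.
  by have [] := mid_Up iN r'; lra.
case: (Down_cases v) => [kN|E|[j jn E]|E]; rewrite ?E in r' *.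
- case: k kN r' {v ne} => [_|k kN] r'; first by apply: clear_lt; exact: (sep_Right_Down0 r r').
  by have [] := mid_Down kN r'; lra.
- by have [] := win_Cross r'; lra.
- by have [] := win_fold jn r'; lra.
- by case: (sep_Right_last r r') => [h|]; [exact: clear_lt | exact: Or33].
Qed.

Lemma clear_Top f p : valid f -> f <> Right -> f <> Top -> region Top p -> region f p ->
  clear_of Top f p.
Proof.
case: f => [| | |k|k] v ne ne' r r' //; have [h1 h2 h3] := region_Top r.
- by case: (sep_Left_Top r' r) => [h|]; [exact: clear_lt | exact: Or32].
- case: (Up_cases v) => [E|[i iN E]]; rewrite {}E in r' *.
    by have [] := win_Up0 r'; lra.
  by apply: clear_gt; exact: (sep_Up_Top iN r' r).
case: (Down_cases v) => [kN|E|[j jn E]|E]; rewrite ?E in r' *.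
- by apply: clear_lt; exact: (sep_Top_Down kN r' r).
- by have [] := win_Cross r'; lra.
- by have [] := win_fold jn r'; lra.
- by have [] := win_last r'; lra.
Qed.

Lemma clear_Left f p : valid f -> f <> Right -> f <> Top -> f <> Left ->
  region Left p -> region f p -> clear_of Left f p.
Proof.
case: f => [| | |k|k] v ne ne' ne2 r r' //; have [h1 h2 h3] := region_Left r.
- case: (Up_cases v) => [E|[i iN E]]; rewrite {}E in r' *.
    by case: (sep_Left_Up0 r r') => [h|]; [exact: clear_gt | exact: Or32].
  move: iN r'; rewrite leq_eqVlt => /orP[/eqP -> | iN] r'.
    by have [] := win_UpLast r'; lra.
  by have [] := win_Up iN r'; lra.
case: (Down_cases v) => [kN|E|[j jn E]|E]; rewrite ?E in r' *.
- case: k kN r' {v ne ne' ne2} => [_|k kN] r'; first by have [] := win_Down0 r'; lra.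
  by have [] := win_Down kN r'; lra.
- by have [] := region_Cross r'; lra.
- by have [] := win_fold jn r'; lra.
- by have [[]] := win_last r'; lra.
Qed.

Lemma clear_Up k f p : (k < nA.+2)%N -> valid f -> (place (Up k) < place f)%N ->
  region (Up k) p -> region f p -> clear_of (Up k) f p.
Proof.
case: f => [| | |l|l] // kN v kl r r'.
  by case: (sep_Up_Up (kl : (k < l)%N) (v : (l <= nA.+1)%N) r r') => [h|]; [exact: clear_lt | exact: Or32].
clear kl; case: (Up_cases kN) => [E|[i iN E]]; rewrite {}E in r *.
  have [h1 h2 _] := win_Up0 r.
  case: (Down_cases v) => [lN|E|[j jn E]|E]; rewrite ?E in r' *.
  - case: l lN r' {v} => [_|l lN] r'; first by have [] := win_Down0 r'; lra.
    by have [] := win_Down lN r'; lra.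
  - by have [] := win_Cross r'; lra.
  - by have [] := win_fold jn r'; lra.
  - by have [|] := @near_last p r'; lra.
case: (Down_cases v) => [lN|E|[j jn E]|E]; rewrite ?E in r' *.
- by case: (sep_Up_Down iN lN r r') => [h|]; [exact: clear_lt | exact: Or32].
- move: iN r; rewrite leq_eqVlt => /orP[/eqP -> | iN] r.
    by have [] := win_UpLast r; have [] := win_Cross r'; lra.
  by apply: clear_lt; apply: sep_Up_Cross.
- move: iN r; rewrite leq_eqVlt => /orP[/eqP -> | iN] r.
    by have [] := win_UpLast r; have [] := win_fold jn r'; lra.
  by apply: (@clear_if (odd j)); apply: sep_Up_fold.
- move: iN r; rewrite leq_eqVlt => /orP[/eqP -> | iN] r.
    by have [] := win_UpLast r; have [] := win_last r'; lra.
  by apply: clear_lt; apply: sep_Up_last.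
Qed.

Lemma clear_Down k l p : (k < l)%N -> (l < mB)%N -> region (Down k) p ->
  region (Down l) p -> clear_of (Down k) (Down l) p.
Proof.
move=> kl lN r r'; case: (leqP l nB) => lB.
  by case: (sep_Down_Down kl lB r r') => [h|]; [exact: clear_gt | exact: Or32].
case: (Down_cases (ltn_trans kl lN)) => [kN|E|[i iN E]|E]; rewrite ?E in r kl *.
- have far : -5 <= p.2 <= 5 -> (0 < k)%N.
    by case: k r {kN kl} => // r; have [] := win_Down0 r; lra.
  case: (Down_cases lN) => [|E|[j jn E]|E]; rewrite ?E in r' lB *.
  - by move=> lB'; move: lB lB'; clear; lia.
  - by rewrite ltnn in lB.
  - apply/(@clear_if (odd j))/sep_Down_fold => //; rewrite kN andbT; apply: far.
    by have [] := win_fold jn r'.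
  - have k1 : (0 < k)%N.
      case: k r {kN kl} far => // r far.
      by have [] := win_Down0 r; have [] := win_last r'; lra.
    by apply/clear_lt/sep_Down_last => //; rewrite k1.
- case: (Down_cases lN) => [|E'|[j jn E']|E']; rewrite ?E' in r' lB *.
  - by move=> lB'; move: lB lB'; clear; lia.
  - by rewrite ltnn in lB.
  - case: (sep_Cross_fold jn r r') => [h|]; last exact: Or32.
    exact: clear_if h.
  - exact/clear_lt/sep_Cross_last.
- case: (Down_cases lN) => [|E'|[j jn E']|E']; rewrite ?E' in r' lB kl *.
  - by move=> lB'; move: lB lB'; clear; lia.
  - by rewrite ltnn in lB.
  - have ij : (i < j)%N by move: kl; clear; lia.
    case: (sep_fold_fold ij jn r r') => [h|]; last exact: Or32.
    exact: clear_if h.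
  - by case: (sep_fold_last iN r r') => [h|]; [exact: clear_lt | exact: Or32].
- by move: kl lN; rewrite /mB; clear; lia.
Qed.

Lemma clear_regions e f p : valid e -> valid f -> e <> f -> region e p -> region f p ->
  clear_of e f p.
Proof.
have C : forall e f, clear_of e f p -> clear_of f e p.
  move=> a b [h|h|h]; [apply: Or31 => /esym // | exact: Or33 | exact: Or32].
have W : forall e f, valid e -> valid f -> e <> f -> (place e <= place f)%N ->
    region e p -> region f p -> clear_of e f p.
  move=> {}e {}f ve vf ne le r r'; case: e ve ne le r => [| | |k|k] ve ne le r.
  - by apply: clear_Right => // E; apply: ne.
  - by apply: clear_Top => // E; [rewrite E in le | apply: ne].
  - by apply: clear_Left => // E; [rewrite E in le | rewrite E in le | apply: ne].
  - apply: clear_Up => //; rewrite ltn_neqAle le andbT; apply/eqP => E; apply: ne.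
    by case: f vf E le {r'} => [| | |l|l] //= vf E le; [congr Up; move: E; clear; lia | move: E ve => /=; clear; lia].
  - case: f vf ne le r' => [| | |l|l] vf ne le r'; try by exfalso; move: vf le => /=; clear; lia.
    apply: (@clear_Down k l p _ vf r r'); rewrite ltn_neqAle; apply/andP; split.
      by apply/eqP => E; apply: ne; rewrite E.
    by move: le => /=; clear; lia.
move=> ve vf ne r r'; case: (leqP (place e) (place f)) => le; first exact: W.
by apply: C; apply: W => //; [move=> E; apply: ne | exact: ltnW].
Qed.

Lemma slope_tilt k (a : R) : tilt k * (slope k * a) = a.
Proof. by rewrite /tilt /slope; case: (odd k); field. Qed.

Lemma axisA_next k : (k < nA.+2)%N -> axisA k (va k.+1).1 = (va k.+1).2.
Proof.
move=> kN; have [_ E] := @va_step R n n0 k kN.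
by rewrite /axisA E slope_tilt addrC subrK.
Qed.

Lemma axisB_next k : (k < mB)%N -> axisB k (vb k.+1).1 = (vb k.+1).2.
Proof.
move=> kN; have [_ E] := @vb_step R n n0 k kN.
by rewrite /axisB E slope_tilt addrC subrK.
Qed.

Lemma axis_self k : axisA k (va k).1 = (va k).2 /\ axisB k (vb k).1 = (vb k).2.
Proof. by rewrite /axisA /axisB !subrr !mulr0 !addr0. Qed.

Lemma on_nrm_Up k p : dot (p - va k.+1) (nrm (Up k.+1)) = 0 -> p.1 = (va k.+1).1.
Proof. by rewrite nrm_Up; case: (odd k); lra. Qed.

Lemma on_nrm_Down k p : dot (p - vb k.+1) (nrm (Down k.+1)) = 0 -> p.1 = (vb k.+1).1.
Proof. by rewrite nrm_Down; case: (odd k); lra. Qed.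

Lemma slope_neq0 k : slope k != 0 :> R.
Proof.
have h : 4 / 3 != 0 :> R by apply: lt0r_neq0; lra.
by rewrite /slope; case: ifP => _; rewrite ?oppr_eq0.
Qed.

Lemma va1_neq k : (k < nA.+2)%N -> (va k).1 != (va k.+1).1.
Proof.
move=> kN; have [lt E] := @va_step R n n0 k kN; rewrite eq_sym -subr_eq0 E.
by apply: mulf_neq0; [exact: slope_neq0 | rewrite subr_eq0 gt_eqF].
Qed.

Lemma vb1_neq k : (k < mB)%N -> (vb k).1 != (vb k.+1).1.
Proof.
move=> kN; have [lt E] := @vb_step R n n0 k kN; rewrite eq_sym -subr_eq0 E.
by apply: mulf_neq0; [exact: slope_neq0 | rewrite subr_eq0 lt_eqF].
Qed.

Lemma ends_clear e p : valid e -> `|cross (dir e) (p - src e)| <= w / 2 ->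
  dot (p - src e) (nrm e) = 0 -> dot (p - src (next e)) (nrm (next e)) = 0 -> False.
Proof.
move=> v h h1 h2; have r : region e p by split; rewrite ?h1 ?h2.
case: e v h h1 h2 r => [| | |k|k] v h h1 h2 r.
- have [a1 a2 a3] := region_Right r; have b := bR.
  by move: h1 h2; rewrite /dot /=; lra.
- have [a1 a2 a3] := region_Top r.
  by move: h1 h2; rewrite /dot /=; lra.
- have [a1 a2 a3] := region_Left r; have b := bL.
  by move: h1 h2; rewrite /dot /=; lra.
- case: k v h h1 h2 r => [|k] v h h1 h2 r.
    have a := region_axisA r; have [a1 a2 a3] := region_Up0 r; rewrite a3 in a.
    have /on_nrm_Up : dot (p - va 1) (nrm (Up 1)) = 0 := h2.
    rewrite va1 //= mulr1 => E; move: h1; rewrite /dot /= E.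
    have y1 : yL + 3 / 4 * (4 + de) = yE by rewrite /yL; lra.
    by have := d0; lra.
  have /on_nrm_Up E := h1; move: h2; rewrite [next _]/=; case: ifP => kN h2.
    have /on_nrm_Up E' := h2; have := va1_neq v.
    by rewrite -E -E' eqxx.
  have Ek : k = nA by move: v kN; rewrite /=; clear; lia.
  rewrite Ek in r E; have [a1 a2 a3] := region_UpLast r.
  have a := region_axisA r; rewrite a3 in a.
  move: h2 E; rewrite va1 // odd_nA /dot /=; lra.
case: k v h h1 h2 r => [|k] v h h1 h2 r.
  have a := region_axisB r; have [a1 a2 a3] := region_Down0 r; rewrite a3 in a.
  have /on_nrm_Down : dot (p - vb 1) (nrm (Down 1)) = 0 := h2.
  by move: h1; rewrite vb_mid // /dot /=; lra.
have /on_nrm_Down E := h1; move: h2; rewrite [next _]/=; case: ifP => kN h2.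
  have /on_nrm_Down E' := h2; have := vb1_neq v.
  by rewrite -E -E' eqxx.
have n2 : (0 < 2 * n)%N by rewrite muln_gt0.
have Ek : k = (nB + (2 * n).-1)%N by move: v kN n2; rewrite /= /mB; clear; lia.
rewrite Ek in r E; have [a1 a2 a3] := region_last r.
have a := region_axisB r; rewrite a3 in a.
have y1 : yR = yF - 3 / 4 * (4 + n%:R * de) by [].
have nd0 : 0 <= n%:R * de by rewrite mulr_ge0 // ltW.
by move: h2 E; rewrite vb_fold ?prednK // fx_last // /dot /=; lra.
Qed.

Lemma wave_end j : wave j (fx j) = -1 /\ wave j (fx j.+1) = -1.
Proof.
have h0 : (0 : R) <= j./2%:R by [].
rewrite /wave; case: (boolP (odd j)) => o.
  have [-> ->] := fx_odd o.
  by rewrite !subrr min_l ?min_r; lra.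
have [-> ->] := fx_even o.
by rewrite !subrr min_r ?min_l; lra.
Qed.

Lemma glue e p : valid e -> region e p -> region (next e) p ->
  dot (p - src (next e)) (nrm (next e)) = 0 -> hgt e p = hgt (next e) p.
Proof.
have e0 := lt0r_neq0 d0; have n2 : (0 < 2 * n)%N by rewrite muln_gt0.
case: e => [| | |k|k] v r r' h.
- by move: h; rewrite /dot /= /slantR; lra.
- by move: h; rewrite /dot /= /slantL; lra.
- have [h1 h2 h3] := region_Left r; have [g1 g2 g3] := win_Up0 r'.
  have h4 := region_axisA r'.
  have F : p.1 + 4 + 2 * (p.2 - yL) = 0 by move: h; rewrite /dot /=; lra.
  by rewrite [next _]/= /hgt g3 F mulr0 subr0 max_r // /slantL; lra.
- move: r' h; rewrite [next _]/=; case: ifP => kN r' h.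
    by rewrite /hgt (on_nrm_Up h) axisA_next ?(axis_self _).1.
  have Ek : k = nA.+1 by move: v kN; rewrite /=; clear; lia.
  rewrite Ek in r *; have [_ _ ->] := win_UpLast r; have [_ _ ->] := win_Down0 r'.
  rewrite (_ : tipd p = 0) ?oppr0 // /tipd; move: h; rewrite /dot /= => h.
  by rewrite min_r; lra.
move: r' h; rewrite [next _]/=; case: ifP => kN r' h; last first.
  have Ek : k = (nB + (2 * n).-1).+1 by move: v kN n2; rewrite /= /mB; clear; lia.
  rewrite Ek in r *; have [_ _ _ _ ->] := win_last r; have [h1 h2 h3] := region_Right r'.
  have -> : 2 * (p.2 - yR) - (p.1 - 4) = 0 by move: h; rewrite /dot /=; lra.
  rewrite mulr0 addr0 min_r //.
  have : 15 <= p.1 / de by rewrite ler_pdivlMr; have := d1; have := d0; lra.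
  by have := n1'; have := bR; rewrite /slantR; lra.
have E := on_nrm_Down h.
case: (Down_cases kN) => [kB|kB|[j jn kB]|kB].
- by rewrite !hgt_Down ?(ltnW kB) // E axisB_next ?(axis_self _).2.
- have kN' : (k < nB)%N by rewrite -kB.
  rewrite kB in r' E *; have [_ _ _ ->] := win_Cross r'; rewrite (hgt_Down _ kN').
  have {}E : p.1 = 0 by rewrite E (nB_index n0).
  have t1 : tipd p = 1.
    have [_ _ b _] := win_Cross r'; apply: tipd_1; lra.
  rewrite E mul0r subr0 t1 min_l; last by have := region_axisB r'; rewrite E; lra.
  have -> : 0 = (vb nB).1 by rewrite (nB_index n0).
  by rewrite (axis_self _).2 -kB axisB_next.
- have x0 : p.1 / de = fx j by rewrite E kB vb_fold ?(ltnW jn) //= mulfK.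
  rewrite kB in r' *; have [_ _ _ ->] := win_fold jn r'; rewrite x0 (wave_end j).1.
  case: j jn kB r' x0 => [|j] jn kB r' x0.
    have Ek : k = nB by move: kB; rewrite addn0 => -[].
    rewrite Ek in r *; have [_ _ _ ->] := win_Cross r.
    have a := region_axisB r; rewrite x0 /fx /= addr0 subrr mulr0 addr0 min_r //; lra.
  have Ek : k = (nB + j).+1 by move: kB; clear; lia.
  rewrite Ek in r *; have [_ _ _ ->] := win_fold (ltnW jn) r.
  by rewrite x0 (wave_end j).2.
have x0 : p.1 / de = - n%:R by rewrite E kB vb_fold ?prednK // fx_last // mulfK.
rewrite kB in r' *; have [_ _ _ H ->] := win_last r'.
have [_ H2] : -5 <= p.2 /\ 2^-1 <= 2 * (p.2 - yR) - (p.1 - 4).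
  apply: H; rewrite -(divfK e0 p.1) x0; have := nde.
  have : 0 <= n%:R * de by rewrite mulr_ge0 // ltW.
  by lra.
have Ek : k = (nB + (2 * n).-2).+1 by move: kB n2; clear; lia.
have jn : ((2 * n).-2.+1 < 2 * n)%N by move: n2; clear; lia.
rewrite Ek in r *; have [_ b1 b2 ->] := win_fold jn r.
have {}x0 : p.1 / de = fx (2 * n).-2.+1.
  by rewrite x0 (_ : (2 * n).-2.+1 = (2 * n).-1) ?fx_last //; move: n2 n0; clear; lia.
rewrite x0 (wave_end _).2 min_l -x0.
  by rewrite x0 (_ : (2 * n).-2.+1 = (2 * n).-1) ?fx_last //; [lra | move: n2 n0; clear; lia].
have := n1'; have : 0 <= 40 * n%:R * (2 * (p.2 - yR) - (p.1 - 4)).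
  by rewrite mulr_ge0 //; lra.
rewrite /slantR; rewrite x0 (_ : (2 * n).-2.+1 = (2 * n).-1) ?fx_last //.
  by lra.
by move: n2 n0; clear; lia.
Qed.

Lemma hgt_continuous e : continuous (hgt e).
Proof.
case: e => [| | |k|k]; rewrite /hgt /wave /tipd /slantR /slantL /axisA /axisB.
- by cont.
- by cont.
- by cont.
- by cont.
case: (k < nB)%N; first by cont.
case: (k == nB); first by cont.
case: (k - nB < 2 * n)%N; last by cont.
by case: (odd _); cont.
Qed.

Definition piece_of (i : nat) : piece :=
  match i with
  | 0%N => Right | 1%N => Top | 2%N => Left
  | k.+3 => if (k < nA.+2)%N then Up k else Down (k - nA.+2)
  end.

Definition npieces : nat := 5 + nA + mB.

Lemma piece_index i : place (piece_of i) = i.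
Proof. by case: i => [|[|[|k]]] //=; case: ifP => //=; clear; lia. Qed.

Lemma piece_inj : injective piece_of.
Proof. by move=> i j E; rewrite -(piece_index i) E piece_index. Qed.

Lemma piece_valid i : (i < npieces)%N -> valid (piece_of i).
Proof.
by rewrite /npieces; case: i => [|[|[|k]]] //= h; case: ifP => //= h'; move: h h'; clear; lia.
Qed.

Lemma index_next e : valid e -> next e = piece_of ((place e).+1 %% npieces).
Proof.
have m0 : (0 < mB)%N by [].
have sz (i : nat) : (i < npieces)%N -> piece_of (i %% npieces) = piece_of i by move=> h; rewrite modn_small.
case: e => [| | |k|k] v; rewrite [place _]/=.
- by rewrite sz.
- by rewrite sz.
- by rewrite sz.
- rewrite sz; last by move: v m0; rewrite /npieces /=; clear; lia.
  rewrite /= !ltnS; case: (leqP k nA) => // h; congr Down.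
  by move: v h; rewrite /=; clear; lia.
rewrite [next _]/=; case: ifP => h.
  rewrite sz; last by move: h; rewrite /npieces; clear; lia.
  rewrite !addnS /= (_ : ((nA + k).+3 < nA.+2)%N = false); last by clear; lia.
  by congr Down; clear; lia.
have -> : (nA + k.+1.+4).+1 = npieces by move: v h; rewrite /npieces /=; clear; lia.
by rewrite modnn.
Qed.

Definition core_vertex (i : 'I_npieces) : plane R := src (piece_of i).

Lemma piece_ordS (i : 'I_npieces) : piece_of (ordS i) = next (piece_of i).
Proof. by rewrite index_next ?piece_valid ?ltn_ord // piece_index. Qed.

Lemma core_step (i : 'I_npieces) :
  core_vertex (ordS i) = core_vertex i + len (piece_of i) *: dir (piece_of i).
Proof. by rewrite /core_vertex piece_ordS src_next ?piece_valid. Qed.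

Lemma core_neq (i : 'I_npieces) : core_vertex (ordS i) != core_vertex i.
Proof.
have v := piece_valid (ltn_ord i); have l0 := len_gt0 v.
rewrite core_step -subr_eq0 addrC addKr scaler_eq0 negb_or lt0r_neq0 //=.
apply/eqP => E; have := dir_unit (piece_of i).
by rewrite E /dot /= mulr0 addr0; lra.
Qed.

Variable mirror : bool.

Definition level e p : R := if mirror then - hgt e p else hgt e p.

Definition core_diagram : knot_diagram R :=
  KnotDiagram (fun i j p => level (piece_of j) p < level (piece_of i) p) core_neq.

Let u (i : 'I_(nedges core_diagram)) := dir (piece_of i).
Let l (i : 'I_(nedges core_diagram)) := len (piece_of i).
Let step (i : 'I_(nedges core_diagram)) : vertex (ordS i) = vertex i + l i *: u i.
Proof. exact: core_step. Qed.
Let l_gt0 i : 0 < l i. Proof. exact/len_gt0/piece_valid. Qed.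
Let u1 i : dot (u i) (u i) = 1. Proof. exact: dir_unit. Qed.
Let u_turn i : u (ordS i) != u i.
Proof. by rewrite /u piece_ordS dir_turn ?piece_valid. Qed.

Lemma core_length i : @edge_length R core_diagram i = len (piece_of i).
Proof. exact: (edge_length_unit step l_gt0 u1). Qed.

Lemma core_direction i : @direction R core_diagram i = dir (piece_of i).
Proof. exact: (direction_unit step l_gt0 u1). Qed.

Lemma core_start i : @start_normal R core_diagram i = nrm (piece_of i).
Proof.
rewrite (start_normal_unit step l_gt0 u1 u_turn) /u -{1 3}(ord_predK i) piece_ordS.
by rewrite nrm_next ?piece_valid.
Qed.

Lemma core_end i : @end_normal R core_diagram i = nrm (next (piece_of i)).
Proof.
rewrite (end_normal_unit step l_gt0 u1 u_turn) /u piece_ordS.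
by rewrite nrm_next ?piece_valid.
Qed.

Lemma core_within i p : @within_width R core_diagram w i p <->
  `|cross (dir (piece_of i)) (p - src (piece_of i))| <= w / 2.
Proof. by rewrite /within_width core_direction. Qed.

Lemma core_start_line i p : @on_start_line R core_diagram i p <->
  dot (p - src (piece_of i)) (nrm (piece_of i)) = 0.
Proof. by rewrite /on_start_line core_start. Qed.

Lemma core_end_line i p : @on_end_line R core_diagram i p <->
  dot (p - src (next (piece_of i))) (nrm (next (piece_of i))) = 0.
Proof. by rewrite /on_end_line core_end -piece_ordS. Qed.

Lemma core_strip i p : @strip R core_diagram w i p <-> region (piece_of i) p.
Proof. by rewrite /strip /region /= core_start core_end -piece_ordS /within_width core_direction. Qed.

Hypothesis w_gt0 : 0 < w.

Lemma core_ends (i : 'I_(nedges core_diagram)) p : within_width w i p ->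
  ~ (on_start_line i p /\ on_end_line i p).
Proof.
move=> /core_within h [/core_start_line h1 /core_end_line h2].
exact: (ends_clear (piece_valid (ltn_ord i)) h h1 h2).
Qed.

Lemma level_continuous (i : 'I_(nedges core_diagram)) :
  {within strip w i, continuous (level (piece_of i))}.
Proof.
apply: continuous_subspaceT; rewrite /level; have c := @hgt_continuous (piece_of i).
by case: mirror; cont.
Qed.

Lemma level_glued (i : 'I_(nedges core_diagram)) p : strip w i p -> strip w (ordS i) p ->
  on_start_line (ordS i) p -> level (piece_of i) p = level (piece_of (ordS i)) p.
Proof.
move=> /core_strip r /core_strip r' /core_start_line h.
move: r' h; rewrite /level piece_ordS => r' h.
by rewrite (glue (piece_valid (ltn_ord i)) r r' h).
Qed.

Lemma fold_at_ordS (i j : 'I_(nedges core_diagram)) p : fold_at (piece_of i) (piece_of j) p ->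
  j = ordS i /\ on_start_line j p.
Proof.
case=> E h; split; last exact/core_start_line.
by apply/val_inj/piece_inj; rewrite E -piece_ordS.
Qed.

Lemma level_embedded (i j : 'I_(nedges core_diagram)) p : strip w i p -> strip w j p ->
  ~ same_band_point i j p -> level (piece_of i) p != level (piece_of j) p.
Proof.
move=> /core_strip r /core_strip r' ns.
have ne : piece_of i <> piece_of j.
  by move=> /piece_inj/val_inj E; apply: ns; apply: Or31.
have := clear_regions (piece_valid (ltn_ord i)) (piece_valid (ltn_ord j)) ne r r'.
case=> [h|/fold_at_ordS h|/fold_at_ordS h].
- by apply/eqP; rewrite /level; case: mirror => // /oppr_inj.
- by case: ns; apply: Or32.
- by case: ns; apply: Or33.
Qed.

Definition core_ribbon : folded_ribbon_knot R :=
  @FoldedRibbonKnot R core_diagram w (fun i => level (piece_of i)) w_gt0 core_ends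
    level_continuous level_glued level_embedded (fun i j p _ _ _ => conj id id).

Lemma sum_pieces (F : piece -> R) : \sum_(i < npieces) F (piece_of i) =
  F Right + F Top + F Left + \sum_(k < nA.+2) F (Up k) + \sum_(k < mB) F (Down k).
Proof.
have -> : npieces = (3 + (nA.+2 + mB))%N by rewrite /npieces; clear; lia.
rewrite big_split_ord -addrA; congr (_ + _).
  by rewrite !big_ord_recr big_ord0 /= add0r.
rewrite big_split_ord; congr (_ + _); apply: eq_bigr => i _ /=.
  by rewrite ltn_ord.
have h : (nA.+2 + i < nA.+2)%N = false by apply/negbTE; rewrite -leqNgt leq_addr.
by rewrite h; congr (F (Down _)); exact: (addKn nA.+2 i).
Qed.

Lemma core_total : length core_diagram =
  26 - yR - yL + 5 / 3 * (124 / 5 - yR - yL).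
Proof.
rewrite /length (eq_bigr (fun i : 'I_npieces => len (piece_of i))); last by move=> i _; exact: core_length.
rewrite sum_pieces /len -!mulr_sumr.
rewrite -(big_mkord xpredT (fun k => (va k.+1).2 - (va k).2)) telescope_sumr //.
rewrite -(big_mkord xpredT (fun k => (vb k).2 - (vb k.+1).2)).
rewrite (eq_bigr (fun k => - (vb k.+1).2 - - (vb k).2)); last by move=> i _; ring.
rewrite (telescope_sumr (fun k => - (vb k).2)) // va_last vb_last /tip /=.
by field.
Qed.
End Pieces.

Section Lift.
Context {R : realType} (n : nat).
Local Notation de := (@de R n).
Local Notation sg := (@sg R n).
Local Notation nA := (nA n).
Local Notation nB := (nB n).
Local Notation mB := (mB n).
Local Notation yE := (@yE R n).
Local Notation yL := (@yL R n).
Local Notation yF := (@yF R n).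
Local Notation yR := (@yR R n).
Local Notation va := (@va R n).
Local Notation vb := (@vb R n).
Local Notation fA := (@fA R n).
Local Notation fB := (@fB R n).
Local Notation fx := (@fx R).
Local Notation Psi := (@Psi R n).
Local Notation src := (@src R n).
Local Notation next := (next n).
Local Notation valid := (valid n).
Local Notation region := (@region R n 0).
Local Notation hgt := (@hgt R n).
Implicit Types (e f : piece) (p : plane R) (x y : R).
Hypothesis n0 : (0 < n)%N.
Let w0 : (0 : R) <= 15 / 2. Proof. lra. Qed.

Definition on e p : Prop :=
  match e with
  | Right => p.1 = 4 /\ yR <= p.2 <= 9
  | Top => p.2 = 9 /\ -4 <= p.1 <= 4
  | Left => p.1 = -4 /\ yL <= p.2 <= 9
  | Up k => (va k).2 <= p.2 <= (va k.+1).2 /\ p.1 = fA p.2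
  | Down k => (vb k.+1).2 <= p.2 <= (vb k).2 /\ p.1 = fB p.2
  end.

Lemma segment_graph (a b : plane R) (c : R) p : a.2 != b.2 -> b.1 - a.1 = c * (b.2 - a.2) ->
  segment a b p <-> Num.min a.2 b.2 <= p.2 <= Num.max a.2 b.2 /\ p.1 = a.1 + c * (p.2 - a.2).
Proof.
move=> ne E; split=> [[t /andP[t0 t1] ->]|[h e1]].
  rewrite /= /GRing.scale /= E; split; last by ring.
  have k1 : (1 - t) * a.2 + t * b.2 = a.2 + t * (b.2 - a.2) by ring.
  have u : 0 <= 1 - t by lra.
  rewrite -k1; case: (lerP a.2 b.2) => ab.
    have := ler_wpM2l u ab; have := ler_wpM2l t0 ab; lra.
  have := ler_wpM2l u (ltW ab); have := ler_wpM2l t0 (ltW ab); lra.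
have d : b.2 - a.2 != 0 by rewrite subr_eq0 eq_sym.
exists ((p.2 - a.2) / (b.2 - a.2)).
  move: h; case: (ltrgtP a.2 b.2) ne => // ab _ h.
    by rewrite divr_ge0 ?ler_pdivrMr; lra.
  rewrite -mulrNN -invrN divr_ge0 ?ler_pdivrMr; lra.
apply: plane_eq; rewrite /= /GRing.scale /= ?E; first by rewrite mulrCA divfK.
by rewrite divfK // addrC subrK.
Qed.

Lemma segment_level (a b : plane R) p : a.2 = b.2 -> a.1 < b.1 \/ b.1 < a.1 ->
  segment a b p <-> Num.min a.1 b.1 <= p.1 <= Num.max a.1 b.1 /\ p.2 = a.2.
Proof.
move=> E ne; pose s (q : plane R) : plane R := (q.2, q.1).
have : segment (s a) (s b) (s p) <-> Num.min a.1 b.1 <= p.1 <= Num.max a.1 b.1 /\ p.2 = a.2 + 0 * (p.1 - a.1).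
  apply: (@segment_graph (s a) (s b) 0 (s p)); rewrite /s /=; first by case: ne => h; [rewrite lt_eqF | rewrite gt_eqF].
  by rewrite E subrr mul0r.
rewrite mul0r addr0 => <-; split=> -[t t01 h]; exists t => //.
  by rewrite h.
by have := congr1 s h; case: (p).
Qed.

Lemma edge_on e p : valid e -> segment (src e) (src (next e)) p <-> on e p.
Proof.
have a := yR_bound n0 : _ <= yR <= _; have b := yL_bound n0 : _ <= yL <= _.
case: e => [| | |k|k] v; rewrite /on.
- rewrite (@segment_graph _ _ 0) /=; [|by rewrite lt_eqF; lra|by lra].
  by rewrite mul0r addr0 min_l ?max_r; [split=> -[]| lra..].
- rewrite segment_level /=; [|by []|by right; lra].
  by rewrite min_r ?max_l; [split=> -[] | lra..].
- rewrite (@segment_graph _ _ 0) /=; [|by rewrite gt_eqF; lra|by lra].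
  by rewrite mul0r addr0 min_r ?max_l; [split=> -[] | lra..].
- have -> : src (next (Up k)) = va k.+1.
    rewrite /=; case: ifP => //= kN; have -> : k = nA.+1 by move: v kN; rewrite /=; clear; lia.
    by rewrite va_last.
  have [lt E] := @va_step R n n0 k v.
  rewrite (segment_graph _ _ E) /=; last by rewrite lt_eqF.
  rewrite min_l ?max_r ?(ltW lt) //; split=> -[h ->]; split=> //.
    by rewrite -(fA_piece n0 v h).
  by rewrite (fA_piece n0 v h).
have -> : src (next (Down k)) = vb k.+1.
  rewrite /=; case: ifP => //= kN; have -> : k.+1 = mB by move: v kN; rewrite /=; clear; lia.
  by rewrite vb_last.
have [lt E] := @vb_step R n n0 k v.
rewrite (segment_graph _ _ E) /=; last by rewrite gt_eqF.
rewrite min_r ?max_l ?(ltW lt) //; split=> -[h ->]; split=> //.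
  by rewrite -(fB_piece n0 v h).
by rewrite (fB_piece n0 v h).
Qed.

Lemma on_region e p : valid e -> on e p -> region e p.
Proof.
move=> v /(edge_on _ v)[t /andP[t0 t1] ->].
have l0 := @len_gt0 R n n0 e v.
rewrite (src_next n0 v) addrAC subrr add0r.
set l := len n e in l0 *; set u := @dir R e; set s := src e.
have c1 : 0 <= dot u (nrm e).
  by rewrite /u /dot; case: (e) => [| | |[|k]|[|k]] /=; try case: (odd k) => /=; lra.
have c2 : dot u (nrm (next e)) <= 0.
  rewrite (nrm_next v) /u /dot.
  by case: (e) v => [| | |k|k] v; rewrite /next; try (case: ifP => _); rewrite /=; try case: (odd k) => /=; lra.
have e1 : s + t *: (l *: u) - s = (t * l) *: u by rewrite addrC addKr scalerA.
have e2 : s + t *: (l *: u) - src (next e) = (- ((1 - t) * l)) *: u.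
  rewrite (src_next n0 v) -/s -/l -/u opprD addrACA subrr add0r scalerA -scalerBl.
  by congr (_ *: _); ring.
have dz (a : R) (q q' : plane R) : dot (a *: q) q' = a * dot q q'.
  by rewrite /dot /= /GRing.scale /=; ring.
split; rewrite ?e1 ?e2 ?dz.
- have -> : cross u ((t * l) *: u) = 0 by rewrite /cross /= /GRing.scale /=; ring.
  by rewrite normr0 mul0r.
- by rewrite mulr_ge0 // mulr_ge0 // ltW.
- by rewrite mulNr -mulrN mulr_ge0 ?oppr_ge0 // mulr_ge0 ?subr_ge0 // ltW.
Qed.

Definition elev e p : R :=
  match e with
  | Right => xr n (Psi p.2) | Top => cap n Psi (- p.1) | Left => xs n (Psi p.2)
  | Up _ => xA n (Psi p.2) | Down _ => xB n (Psi p.2)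
  end.

Let nn : (2 * n)%:R = (2 : R) * n%:R. Proof. by rewrite natrM. Qed.
Let n1' : (1 : R) <= n%:R := n1 n0.
Let d0 : 0 < de := de_gt0 n0.
Let d1 : de <= 60^-1 := de_le n0.
Let s0 : sg = 3 / 4 * de := sgE n.
Let bR : -3 - 10^-1 <= yR <= -3 := yR_bound n0.
Let bL : -13 - 10^-1 <= yL <= -13 := yL_bound n0.
Let bF : - 16^-1 <= yF <= - (5 * sg) := yF_bound n0.
Let eE : yE = -10 - sg := yEE n0.

Lemma Psi_mono y z : y <= z -> Psi y <= Psi z.
Proof. by rewrite le_eqVlt => /orP[/eqP -> //|/(Psi_lt n0)/ltW]. Qed.

Lemma Psi_neg y : yR <= y <= 0 -> - (2 * n)%:R <= Psi y <= 0.
Proof.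
move=> /andP[/Psi_mono h /Psi_mono h']; move: h h'.
by rewrite (Psi_at_yR n0) (Psi_at_0 n0) nn => -> ->.
Qed.

Lemma braid y : yR <= y <= 0 -> xA n (Psi y) = zig n (Psi y) /\ xB n (Psi y) = 1 - zig n (Psi y).
Proof. by move=> /Psi_neg h; rewrite (xA_braid n0) // (xB_braid n0) //; case/andP: h. Qed.

Lemma top_order y : 0 <= y < 62 / 5 -> xA n (Psi y) < xB n (Psi y).
Proof.
move=> /andP[y0 y1].
have P0 : 0 <= Psi y by rewrite -(Psi_at_0 n0); exact: Psi_mono.
have P1 : Psi y < 15 / 4.
  have <- : Psi (62 / 5) = 15 / 4 by rewrite (Psi_up' n0); [field | lra].
  exact: Psi_lt.
case: (lerP (Psi y) 2^-1) => h; first by rewrite (xA_up0 n0) ?(xB_up0 n0); lra.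
case: (lerP (Psi y) 2) => h2; first by rewrite (xA_up1 n0) ?(xB_up0 n0); lra.
case: (lerP (Psi y) (7 / 2)) => h3; first by rewrite (xA_up1 n0) ?(xB_up1 n0); lra.
by rewrite (xA_up2 n0) ?(xB_up1 n0); lra.
Qed.

Lemma top_cap x : 0 <= x <= de -> xA n (Psi 9) < cap n Psi (- x) < xB n (Psi 9).
Proof.
move=> h; rewrite (cap_neg n0 (Psi_up n0)); last by lra.
have e := d1; rewrite !(Psi_up n0); [|lra..].
by rewrite (xA_up1 n0) ?(xB_up1 n0) ?(xr1 n0); lra.
Qed.

Lemma cross_order y : - (2 * sg) <= y <= 0 -> fB y <= de -> xA n (Psi y) < xB n (Psi y).
Proof.
move=> h; rewrite (fB_V n0 h) => hd; have e0 := d0; have e2 := s0; have e4 := bR; have e5 := d1.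
have [-> ->] : xA n (Psi y) = zig n (Psi y) /\ xB n (Psi y) = 1 - zig n (Psi y).
  by apply: braid; lra.
have P := Psi_V n0 h.
have P1 : - 4^-1 <= Psi y by rewrite -(ler_pM2r (_ : 0 < 4 * sg)); lra.
have P0 : Psi y <= 0 by rewrite -(pmulr_lle0 _ (_ : 0 < 4 * sg)); lra.
rewrite (@zig_piece R n 0) /=; [|by rewrite muln_gt0|by lra].
by lra.
Qed.

Lemma fold_order j t y : (j.+1 < 2 * n)%N -> 0 <= t <= 1 ->
  y = fy n j - t * (j%:R + 3) * sg -> yR <= y <= 0 -> 0 <= fB y <= de ->
  if odd j then xA n (Psi y) < xB n (Psi y) else xB n (Psi y) < xA n (Psi y).
Proof.
move=> jn t01 Ey yr fb; have e0 := d0.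
have P := Psi_fold n0 jn Ey t01; have [-> ->] := braid yr.
have far k : (k < 2 * n)%N -> 8^-1 < `|Psi y + k%:R + 2^-1|.
  move=> kn; rewrite ltNge; apply/negP => /(fB_cross n0 kn).
  by case: (odd k); lra.
have := far _ jn; have := far _ (ltnW jn); rewrite P -(natr1 j).
rewrite (_ : - (j%:R + 2^-1) - t + j%:R + 2^-1 = - t); last by lra.
rewrite (_ : - (j%:R + 2^-1) - t + (j%:R + 1) + 2^-1 = 1 - t); last by lra.
rewrite normrN !ger0_norm; [|lra..] => h1 h2.
case: (lerP t 2^-1) => th.
  rewrite (@zig_piece R n j) ?(ltnW jn) // -?(natr1 j); last by lra.
  by case: (odd j); lra.
rewrite (@zig_piece R n j.+1) // -?(natr1 j.+1) -?(natr1 j); last by lra.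
by rewrite oddS; case: (odd j) => /=; lra.
Qed.

Lemma last_order y : yR <= y <= yF -> 0 <= fB y -> xA n (Psi y) < xB n (Psi y).
Proof.
move=> h; rewrite (fB_E n0 h) => hb; have e0 := d0; have e3 := bF; have e2 := s0; have e1 := n1'.
have nd : 0 < n%:R * de by rewrite mulr_gt0 //; lra.
have ns : 0 < n%:R * sg by rewrite s0; lra.
have [-> ->] : xA n (Psi y) = zig n (Psi y) /\ xB n (Psi y) = 1 - zig n (Psi y).
  by apply: braid; lra.
have n' := nn; have yr : yR <= y <= 0 by lra.
have := Psi_neg yr; rewrite n' => b0.
have P : Psi y + 2 * n%:R < 2^-1.
  case: (lerP y (yR + 3)) => y3; first by rewrite (Psi_E n0 h y3); lra.
  have yy : yR + 3 <= y <= yF by lra.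
  have := Psi_E' n0 yy => E; have : (Psi y + 2 * n%:R - 2^-1) * (4 * (n%:R * sg)) < 0 by rewrite E; lra.
  by rewrite pmulr_llt0; lra.
by rewrite (zig_end n0) n'; lra.
Qed.

Definition agree e f p : Prop :=
  [\/ hgt e p < hgt f p /\ elev e p < elev f p,
      hgt f p < hgt e p /\ elev f p < elev e p,
      f = next e /\ p = src f | e = next f /\ p = src e].

Lemma on_UpLast p : on (Up nA.+1) p -> 10 <= p.2 <= 62 / 5 /\ p.1 = 4 / 3 * (p.2 - 10).
Proof.
case=> h ->; rewrite (fA_piece n0 (ltnSn _) h); move: h.
rewrite va_last va_mid // odd_nA subrr mul0r subr0 mulr0 /= /slope oddS odd_nA /=.
by rewrite add0r.
Qed.

Lemma on_Down0 p : on (Down 0) p -> 10 <= p.2 <= 62 / 5 /\ p.1 = 4 / 3 * (p.2 - 10).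
Proof.
case=> h ->; rewrite (fB_piece n0 (isT : (0 < mB)%N) h); move: h.
rewrite vb_mid //= /slope /=; lra.
Qed.

Lemma on_last p : on (Down (nB + (2 * n).-1).+1) p ->
  yR <= p.2 <= yF /\ p.1 = - (n%:R * de) - 4 / 3 * (p.2 - yF).
Proof.
have n2 : (0 < 2 * n)%N by rewrite muln_gt0.
have e : (nB + (2 * n).-1).+2 = mB by rewrite /mB -addnS prednK.
case=> h; move: h; rewrite e vb_last vb_fold ?prednK //= -/yF => h ->; split=> //.
by rewrite (fB_E n0 h) mulNr.
Qed.

Lemma on_fold j p : (j.+1 < 2 * n)%N -> on (Down (nB + j).+1) p ->
  exists2 t : R, 0 <= t <= 1 & p.2 = fy n j - t * (j%:R + 3) * sg.
Proof.
have e0 := d0; have e2 := s0.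
move=> jn [h _]; move: h; have := @vb_fold R n j.+1 jn; rewrite addnS => ->.
rewrite vb_fold ?(ltnW jn) //= => h.
have s0' : 0 < (j%:R + 3) * sg by rewrite mulr_gt0 ?ltr_wpDl //; lra.
have st := @fy_step R n j.
exists ((fy n j - p.2) / ((j%:R + 3) * sg)).
  by rewrite divr_ge0 ?ler_pdivrMr //; lra.
by rewrite -mulrA divfK ?lt0r_neq0 //; ring.
Qed.

Lemma on_Cross p : on (Down nB) p -> - (2 * sg) <= p.2 <= 0.
Proof.
have v : vb nB.+1 = (fx 0 * de, fy n 0).
  by rewrite -[in LHS](addn0 nB) vb_fold // muln_gt0.
by case=> h _; move: h; rewrite v (nB_index n0) fy0.
Qed.

Lemma on_Up_range k p : (k <= nA)%N -> on (Up k) p -> p.2 <= 10.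
Proof.
move=> kN [/andP[_ h] _]; apply: (le_trans h); have := @va_range R n n0 _ kN; lra.
Qed.

Lemma on_Up_low k p : (k <= nA)%N -> on (Up k.+1) p -> yE <= p.2.
Proof.
move=> kN [/andP[h _] _]; apply: le_trans h; have := @va_range R n n0 _ kN; lra.
Qed.

Lemma on_Up0 p : on (Up 0) p -> yL <= p.2 <= yE /\ p.1 = -4 + 4 / 3 * (p.2 - yL).
Proof.
case=> h ->; rewrite (fA_piece n0 (isT : (0 < nA.+2)%N) h); move: h.
by rewrite va_mid //= subr0.
Qed.

Lemma on_Down_range k p : (k < nB)%N -> on (Down k) p -> 0 <= p.2 <= 62 / 5.
Proof.
case: k => [_ /on_Down0[]|k kN [/andP[h1 h2] _]]; first by lra.
have := @vb_range R n n0 _ kN; have := @vb_range R n n0 _ (ltnW kN); lra.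
Qed.

Lemma agree_Right f p : valid f -> f <> Right -> on Right p -> on f p -> agree Right f p.
Proof.
case: f => [| | |k|k] v ne r r' //; clear ne; case: r => h1 h2.
- by case: r' => g1 g2; apply: Or43; split=> //; apply: plane_eq.
- by case: r' => g1 g2; lra.
- case: (Up_cases v) => [E|[i iN E]]; rewrite {}E in r' v *.
    by have [_ g] := on_Up0 r'; have [] := win_Up0 n0 w0 (on_region v r'); lra.
  move: iN r' v; rewrite leq_eqVlt => /orP[/eqP -> | iN] r' v.
    by have [] := on_UpLast r'; lra.
  by have [] := win_Up n0 w0 iN (on_region v r'); lra.
case: (Down_cases n0 v) => [kN|E|[j jn E]|E]; rewrite ?E in r' v *.
- case: k kN r' v => [_|k kN] r' v; first by have [] := on_Down0 r'; lra.
  by have [] := win_Down n0 w0 kN (on_region v r'); lra.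
- by have [] := win_Cross n0 w0 (on_region v r'); lra.
- by have [] := win_fold n0 w0 jn (on_region v r'); lra.
have [g1 g2] := on_last r'; apply: Or44; split.
  have n2 : (0 < 2 * n)%N by rewrite muln_gt0.
  have e : (nB + (2 * n).-1).+2 = mB by rewrite /mB -addnS prednK.
  by rewrite /next e ltnn.
by apply: plane_eq => //=; rewrite /yR; lra.
Qed.

Lemma agree_Top f p : valid f -> f <> Right -> f <> Top -> on Top p -> on f p ->
  agree Top f p.
Proof.
case: f => [| | |k|k] v ne ne' r r' //; clear ne ne'; have rt := @on_region Top p isT r; case: r => h1 h2.
- by case: r' => g1 g2; apply: Or43; split=> //; apply: plane_eq.
- have e0 := d0; have e2 := s0; have e4 := eE.
  case: (Up_cases v) => [E|[i iN E]]; rewrite {}E in r' v *.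
    by have [] := on_Up0 r'; lra.
  have r2 := on_region v r'; apply: Or42; split; first exact: (sep_Up_Top n0 w0 iN r2 rt).
  move: iN r' v r2; rewrite leq_eqVlt => /orP[/eqP -> | iN] r' v r2.
    by have [] := on_UpLast r'; lra.
  have [k1 _] := region_Up n0 iN r2.
  by rewrite /elev h1; have := top_cap k1; lra.
case: (Down_cases n0 v) => [kN|E|[j jn E]|E]; rewrite ?E in r' v *.
- have r2 := on_region v r'; apply: Or41; split; first exact: (sep_Top_Down n0 w0 kN r2 rt).
  case: k kN r' v r2 => [_|k kN] r' v r2; first by have [] := on_Down0 r'; lra.
  have [k1 _] := region_Down n0 kN r2.
  by rewrite /elev h1; have := top_cap k1; lra.
- by have := on_Cross r'; lra.
- by have [] := win_fold n0 w0 jn (on_region v r'); lra.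
- by have [] := on_last r'; have := bF; have := s0; have := d0; lra.
Qed.

Lemma agree_Left f p : valid f -> f <> Right -> f <> Top -> f <> Left -> on Left p ->
  on f p -> agree Left f p.
Proof.
case: f => [| | |k|k] v ne ne' ne2 r r' //; clear ne ne' ne2; case: r => h1 h2.
- case: (Up_cases v) => [E|[i iN E]]; rewrite {}E in r' v *.
    have [g1 g2] := on_Up0 r'; apply: Or43; split=> //.
    by apply: plane_eq => //=; lra.
  move: iN r' v; rewrite leq_eqVlt => /orP[/eqP -> | iN] r' v.
    by have [] := on_UpLast r'; lra.
  by have [] := win_Up n0 w0 iN (on_region v r'); lra.
case: (Down_cases n0 v) => [kN|E|[j jn E]|E]; rewrite ?E in r' v *.
- case: k kN r' v => [_|k kN] r' v; first by have [] := on_Down0 r'; lra.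
  by have [] := win_Down n0 w0 kN (on_region v r'); lra.
- by have [] := region_Cross n0 (on_region v r'); lra.
- by have [] := win_fold n0 w0 jn (on_region v r'); lra.
- by have [[]] := win_last n0 w0 (on_region v r'); lra.
Qed.

Lemma agree_Up_Up k l p : (k < l)%N -> (l < nA.+2)%N -> on (Up k) p -> on (Up l) p ->
  agree (Up k) (Up l) p.
Proof.
move=> kl lN [h1 e1] [h2 _]; have kN := ltn_trans kl lN.
have kn := @va_knots R n n0.
have le : (va k.+1).2 <= (va l).2 by apply: (knots_le kn); rewrite kl ltnW.
have E : p.2 = (va l).2 by lra.
have El : l = k.+1.
  apply/eqP; rewrite eqn_leq kl andbT leqNgt; apply/negP => lt.
  have := knots_lt kn (_ : (k.+1 < l <= nA.+2)%N); rewrite lt ltnW // => /(_ isT).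
  by lra.
rewrite El in E lN *; apply: Or43; split; first by rewrite /= -ltnS -ltnS lN.
apply: plane_eq => //=; rewrite e1 E; exact: (@pl_knot R nA.+2 _ (fun k => (va k).1) k.+1 kn (ltnW lN)).
Qed.

Lemma agree_Down_Down k l p : (k < l)%N -> (l < mB)%N -> on (Down k) p -> on (Down l) p ->
  agree (Down k) (Down l) p.
Proof.
move=> kl lN [h1 e1] [h2 _]; have kN := ltn_trans kl lN.
have kn := @vb_knots R n n0.
have le : - (vb k.+1).2 <= - (vb l).2.
  by apply: (knots_le (t := fun k => - (vb k).2) kn); rewrite kl ltnW.
have E : p.2 = (vb l).2 by lra.
have El : l = k.+1.
  apply/eqP; rewrite eqn_leq kl andbT leqNgt; apply/negP => lt.
  have := knots_lt (t := fun k => - (vb k).2) kn (_ : (k.+1 < l <= mB)%N); rewrite lt ltnW // => /(_ isT).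
  by lra.
rewrite El in E lN *; apply: Or43; split; first by rewrite /= lN.
apply: plane_eq => //=; rewrite e1 E /fB.
exact: (@pl_knot R mB _ (fun k => (vb k).1) k.+1 kn (ltnW lN)).
Qed.

Lemma agree_Up_Down k l p : (k < nA.+2)%N -> (l < mB)%N -> on (Up k) p -> on (Down l) p ->
  agree (Up k) (Down l) p.
Proof.
have e0 := d0; have e2 := s0; have e4 := eE; have e3 := bF; have e5 := bR; have yer := yE_lt n0 : yE < yR.
move=> kN lN r r'; have v : valid (Up k) := kN; have v' : valid (Down l) := lN.
have low : yR <= p.2.
  case: r' => /andP[h _] _; apply: le_trans h.
  have := knots_le (t := fun k => - (vb k).2) (@vb_knots R n n0) (_ : (l.+1 <= mB <= mB)%N).
  by rewrite lN leqnn vb_last => /(_ isT) /=; lra.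
case: (Up_cases kN) => [E|[i iN E]]; rewrite {}E in r v *.
  by have [] := on_Up0 r; lra.
have u := on_region v r; have u' := on_region v' r'.
have px : p.1 = fA p.2 by case: r.
have px' : p.1 = fB p.2 by case: r'.
have below : (l < nB)%N \/ (p.2 <= 0 /\ (i < nA)%N).
  case: (ltnP l nB) => lB; [by left | right].
  have y0 : p.2 <= 0.
    case: r' => /andP[_ h] _; apply: (le_trans h).
    have := knots_le (t := fun k => - (vb k).2) (@vb_knots R n n0) (_ : (nB <= l <= mB)%N).
    by rewrite lB (ltnW lN) (nB_index n0) => /(_ isT) /=; lra.
  split=> //; rewrite ltn_neqAle iN andbT; apply/eqP => E; rewrite E in r.
  by have [] := on_UpLast r; lra.
have small : p.2 <= 0 -> 0 <= fB p.2 <= de.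
  by move=> y0; rewrite -px' px; apply: (fA_mid n0); lra.
case: (Down_cases n0 lN) => [lB|E|[j jn E]|E].
- have yr := on_Down_range lB r'.
  case: (ltrP p.2 (62 / 5)) => y1.
    apply: Or41; split; last by apply: top_order; lra.
    case: (sep_Up_Down n0 w0 iN lB u u') => // -[].
    rewrite /next; case: ifP => // iA [->]; rewrite /dot /= => h.
    have Ei : i = nA by move: iN iA; clear; lia.
    rewrite Ei in r; have [_ hx] := on_UpLast r; lra.
  have Ei : i = nA.
    apply/eqP; rewrite eqn_leq iN leqNgt; apply/negP => iA.
    by have := on_Up_range iA r; lra.
  rewrite Ei in r *; have [_ hx] := on_UpLast r.
  case: l lB r' {u' v' lN below} => [_|l lB] r'; last first.
    by case: r' => h _; have := @vb_range R n n0 _ (ltnW lB); lra.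
  apply: Or43; split; first by rewrite /= ltnn.
  by apply: plane_eq; rewrite /=; lra.
- case: below => [|[y0 iA]]; first by rewrite E ltnn.
  rewrite E in r' u' *; apply: Or41; split; first by apply: (sep_Up_Cross n0 w0).
  by apply: cross_order; [exact: on_Cross r' | have := small y0; lra].
- case: below => [|[y0 iA]]; first by rewrite E; clear; lia.
  rewrite E in r' u' *; have := sep_Up_fold n0 w0 (_ : (0 < i.+1 <= nA)%N) jn u u'.
  rewrite iA => /(_ isT); have [t t01 Ey] := on_fold jn r'.
  have := fold_order jn t01 Ey (_ : yR <= p.2 <= 0) (small y0); rewrite low y0 => /(_ isT).
  by case: (odd j) => h1 h2; [apply: Or41 | apply: Or42].
case: below => [|[y0 iA]]; first by rewrite E; clear; lia.
rewrite E in r' u' *; have [yr _] := on_last r'.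
apply: Or41; split; first by apply: (sep_Up_last n0 w0).
by apply: last_order => //; have := small y0; lra.
Qed.

Lemma agreement e f p : valid e -> valid f -> e <> f -> on e p -> on f p -> agree e f p.
Proof.
have C : forall e f, agree e f p -> agree f e p.
  by move=> a b [h|h|h|h]; [apply: Or42 | apply: Or41 | apply: Or44 | apply: Or43].
case: e => [| | |k|k] ve vf ne r r'.
- by apply: agree_Right => // E; apply: ne.
- case: f vf ne r' => [| | |l|l] vf ne r'; try by apply: agree_Top.
  by apply: C; apply: agree_Right.
- case: f vf ne r' => [| | |l|l] vf ne r'; try by apply: agree_Left.
    by apply: C; apply: agree_Right.
  by apply: C; apply: agree_Top.
- case: f vf ne r' => [| | |l|l] vf ne r'.
  + by apply: C; apply: agree_Right.
  + by apply: C; apply: agree_Top.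
  + by apply: C; apply: agree_Left.
  + case: (ltngtP k l) => kl; [exact: agree_Up_Up | by apply: C; exact: agree_Up_Up |].
    by case: ne; rewrite kl.
  + exact: agree_Up_Down.
case: f vf ne r' => [| | |l|l] vf ne r'.
- by apply: C; apply: agree_Right.
- by apply: C; apply: agree_Top.
- by apply: C; apply: agree_Left.
- by apply: C; exact: agree_Up_Down.
case: (ltngtP k l) => kl; [exact: agree_Down_Down | by apply: C; exact: agree_Down_Down |].
by case: ne; rewrite kl.
Qed.

Lemma elev_continuous e : continuous (elev e).
Proof.
have cP := @Psi_continuous R n; have cc := @cap_continuous R n Psi cP.
have c1 := @xA_continuous R n; have c2 := @xB_continuous R n.
have c3 := @xr_continuous R n; have c4 := @xs_continuous R n.
by case: e => [| | |k|k]; rewrite /elev; cont.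
Qed.

Lemma elev_next e : valid e -> elev e (src (next e)) = elev (next e) (src (next e)).
Proof.
have P5 : Psi (62 / 5) = 15 / 4 by rewrite (Psi_up' n0); [field | lra].
have PR : Psi yR = - (2 * n)%:R by rewrite (Psi_at_yR n0) nn.
case: e => [| | |k|k] v.
- by rewrite /= (cap_neg n0 (Psi_up n0)) ?addrN ?mul0r ?addr0 //; lra.
- by rewrite /= (cap_pos n0 (Psi_up n0)) ?opprK ?addrN ?mul0r ?addr0 //; lra.
- rewrite /=.
  have : Psi yL + 2 * n%:R + 2^-1 = (yL - yL) / (2 * (yR - yL)).
    by apply: (Psi_low n0); have := bR; have := bL; lra.
  rewrite subrr mul0r => P; have n' := nn.
  by rewrite (xs0 n0) ?(xA_low n0); lra.
- rewrite /=; case: ifP => //= kN; rewrite P5.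
  by rewrite (xA_up2 n0) ?(xB_up1 n0); lra.
rewrite /=; case: ifP => //= kN; rewrite PR; have n' := nn; have n'' := n1'.
rewrite (xB_braid n0) ?zig_hi ?(xr0 n0) //; [|lra..].
by rewrite mulNr divff ?lt0r_neq0 //; lra.
Qed.

Lemma index_lt e : valid e -> (place n e < npieces n)%N.
Proof. by rewrite /npieces; case: e => [| | |k|k] //= v; move: v; clear; lia. Qed.

Lemma index_piece e : valid e -> piece_of n (place n e) = e.
Proof.
case: e => [| | |k|k] //= v; first by rewrite v.
rewrite !addnS /= (_ : ((nA + k).+2 < nA.+2)%N = false); last by clear; lia.
by congr Down; exact: (addKn nA k).
Qed.

Section Mirror.
Variable mirror : bool.
Local Notation D := (@core_diagram R n n0 mirror).

Definition elev_of (i : 'I_(nedges D)) p : R :=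
  if mirror then - elev (piece_of n i) p else elev (piece_of n i) p.

Lemma core_edge (i : 'I_(nedges D)) p : edge i p <-> on (piece_of n i) p.
Proof.
rewrite /edge -(edge_on _ (piece_valid (ltn_ord i))) /= /core_vertex.
by rewrite -piece_ordS.
Qed.

Lemma core_is_lift : is_lift elev_of.
Proof.
split.
- move=> i; apply: continuous_subspaceT; rewrite /elev_of.
  have c := @elev_continuous (piece_of n i).
  by case: (mirror); cont.
- move=> i; rewrite /elev_of /= /core_vertex piece_ordS.
  by rewrite elev_next ?piece_valid.
move=> i j p /core_edge ri /core_edge rj ns.
have ne : piece_of n i <> piece_of n j.
  by move=> /piece_inj/val_inj E; apply: ns; apply: Or31.
have A := agreement (piece_valid (ltn_ord i)) (piece_valid (ltn_ord j)) ne ri rj.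
rewrite /elev_of /= /level; case: A => [[h1 h2]|[h1 h2]|[E h]|[E h]].
- case: mirror; split; rewrite ?eqr_opp ?ltrN2.
  + by rewrite lt_eqF.
  + by rewrite h1 h2.
  + by rewrite lt_eqF.
  + by rewrite (lt_gtF h1) (lt_gtF h2).
- case: mirror; split; rewrite ?eqr_opp ?ltrN2.
  + by rewrite gt_eqF.
  + by rewrite (lt_gtF h1) (lt_gtF h2).
  + by rewrite gt_eqF.
  + by rewrite h1 h2.
- case: ns; apply: Or32; split=> //.
  by apply/val_inj/(@piece_inj n); rewrite E -piece_ordS.
- case: ns; apply: Or33; split=> //.
  by apply/val_inj/(@piece_inj n); rewrite E -piece_ordS.
Qed.

Lemma core_lifted (x : (R * R * R)%type) : lifted_curve elev_of x <->
  exists e, [/\ valid e, on e x.1 & x.2 = if mirror then - elev e x.1 else elev e x.1].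
Proof.
split=> [[i /core_edge h E]|[e [v h E]]].
  by exists (piece_of n i); split=> //; exact/piece_valid.
exists (Ordinal (index_lt v)).
  by apply/core_edge; rewrite /= index_piece.
by rewrite /elev_of /= index_piece.
Qed.
End Mirror.

Lemma on_tip_range k p : valid (Up k) -> on (Up k) p -> yL <= p.2 <= 62 / 5.
Proof.
move=> v [/andP[h1 h2] _]; have kn := @va_knots R n n0.
have l1 : (va 0).2 <= (va k).2 by apply: (knots_le kn); rewrite /= ltnW.
have l2 : (va k.+1).2 <= (va nA.+2).2 by apply: (knots_le kn); rewrite leqnn andbT.
have l3 : (va 0).2 = yL by []. have l4 : (va nA.+2).2 = 62 / 5 by rewrite va_last.
lra.
Qed.

Lemma on_Down_tip k p : valid (Down k) -> on (Down k) p -> yR <= p.2 <= 62 / 5.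
Proof.
move=> v [/andP[h1 h2] _]; have kn := @vb_knots R n n0.
have l1 : - (vb 0).2 <= - (vb k).2.
  by apply: (knots_le (t := fun k => - (vb k).2) kn); rewrite /= ltnW.
have l2 : - (vb k.+1).2 <= - (vb mB).2.
  by apply: (knots_le (t := fun k => - (vb k).2) kn); rewrite leqnn andbT.
have l3 : (vb 0).2 = 62 / 5 by []. have l4 : (vb mB).2 = yR by rewrite vb_last.
lra.
Qed.

Lemma core_strands : (fun p : (R * R * R)%type => (p.2, p.1.2, - p.1.1)) @` lifted_curve (@elev_of false) =
  polygon_strands n yL yR fA fB Psi.
Proof.
have b1 := bR; have b2 := bL.
apply/seteqP; split=> [_ [[[x y] z] /core_lifted[e [v h /= ->]] <-]|].
  case: e v h => [| | |k|k] v h.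
  - by right; right; left; case: h => /= -> h; split.
  - by right; right; right; right; case: h => /= -> h; split=> //=; lra.
  - by right; right; right; left; case: h => /= -> h; split=> //=; rewrite opprK.
  - by left; have h2 := on_tip_range v h; case: h => /= _ ->; split.
  - by right; left; have h2 := on_Down_tip v h; case: h => /= _ ->; split.
move=> [[x y] z]; case=> [|[|[|[|]]]] [/= h1 h2 h3].
- have [|k kN hk] := @knots_piece R nA.+2 (fun k => (va k).2) y (ltn0Sn _).
    by rewrite va_last.
  exists (fA y, y, x); last by rewrite /= h3.
  by apply/core_lifted; exists (Up k); split.
- have [|k kN hk] := @knots_piece R mB (fun k => - (vb k).2) (- y) (ltn0Sn _).
    by rewrite vb_last !lerN2 andbC.
  exists (fB y, y, x); last by rewrite /= h3.
  apply/core_lifted; exists (Down k); split=> //; split=> //=.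
  by move: hk; rewrite !lerN2 andbC.
- by exists (4, y, x); [apply/core_lifted; exists Right | rewrite /= h3].
- by exists (-4, y, x); [apply/core_lifted; exists Left | rewrite /= opprK h3].
exists (- z, 9, x); last by rewrite /= opprK h2.
apply/core_lifted; exists Top; split=> //=; last by rewrite opprK.
by split=> //=; lra.
Qed.
End Lift.

Section Reflection.
Context {R : realType}.

Definition reflect (p : (R * R * R)%type) : (R * R * R)%type := (p.1, - p.2).

Lemma reflectK : cancel reflect reflect.
Proof. by move=> [q z]; rewrite /reflect /= opprK. Qed.

Lemma reflect_continuous : continuous reflect.
Proof. by rewrite /reflect; cont. Qed.

Lemma reflect_segment (a b : (R * R * R)%type) :
  reflect @` segment a b = segment (reflect a) (reflect b).
Proof.
apply: image_segment => t _; rewrite /reflect; case: a b => [a u] [b v].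
by congr (_, _); rewrite /= /GRing.scale /=; ring.
Qed.

Lemma reflect_flat (a b : plane R) : reflect @` flat_edge a b = flat_edge a b.
Proof. by rewrite /flat_edge reflect_segment /reflect /= oppr0. Qed.

Lemma reflect_raised (z : R) (a b : plane R) :
  reflect @` raised_edge z a b = raised_edge (- z) a b.
Proof. by rewrite /raised_edge image_setU !reflect_segment /reflect /= oppr0. Qed.

Lemma reflect_twist_knot m : reflect @` twist_knot false m = twist_knot true m.
Proof.
rewrite /twist_knot /half_twist /clasp /closing_arcs.
rewrite !(reflect_flat, reflect_raised, image_setU).
congr (_ `|` _); rewrite image_bigcup; apply: eq_bigcupr => k _.
by rewrite !(reflect_flat, reflect_raised, image_setU).
Qed.
End Reflection.

Section Represents.
Context {R : realType} (n : nat) (n0 : (0 < n)%N).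

Lemma isotopic_core : isotopic (lifted_curve (@elev_of R n n0 false)) (twist_knot false (2 * n)).
Proof.
apply: isotopic_trans (quarter_turn_y _) _; rewrite core_strands.
apply: isotopic_trans (isotopic_core_plat n0) _.
exact: isotopic_sym (isotopic_twist_knot n0).
Qed.

Lemma core_represents mirror :
  represents (@core_diagram R n n0 mirror) (twist_knot mirror (2 * n)).
Proof.
exists (@elev_of R n n0 mirror); first exact: core_is_lift.
apply: isotopic_ambient; case: mirror; last exact: isotopic_core.
rewrite -reflect_twist_knot.
have -> : lifted_curve (@elev_of R n n0 true) = reflect @` lifted_curve (@elev_of R n n0 false).
  apply/seteqP; split=> [[q z] /core_lifted[e [v h /= E]]|_ [[q z] /core_lifted[e [v h /= E]] <-]].
    exists (q, - z); last by rewrite /reflect /= opprK.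
    by apply/core_lifted; exists e; split; rewrite //= E opprK.
  by apply/core_lifted; exists e; split; rewrite //= E.
exact: (isotopic_conj reflect_continuous reflect_continuous reflectK reflectK isotopic_core).
Qed.
End Represents.

Theorem theorem27 (R : realType) (mirror : bool) (n : nat) (e : R) :
  (1 <= n)%N -> 0 < e ->
  exists K : folded_ribbon_knot R,
    represents (diagram K) (twist_knot mirror (2 * n)%N) /\
    ribbonlength K = 8 * Num.sqrt 3 + 2 + e.
Proof.
move=> n0 e0; set c := 8 * Num.sqrt 3 + 2 + e.
have c0 : 79 / 5 < c.
  have : (69 / 40 : R) < Num.sqrt 3.
    rewrite -[X in X < _]ger0_norm -?sqrtr_sqr ?ltr_sqrt; lra.
  by rewrite /c; lra.
pose l := length (@core_diagram R n n0 mirror).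
have l0 : 0 < l <= 117.
  by rewrite /l core_total; have := @yR_bound R n n0; have := @yL_bound R n n0; lra.
have w0 : 0 < l / c by rewrite divr_gt0; lra.
have w1 : l / c <= 15 / 2 by rewrite ler_pdivrMr; lra.
exists (core_ribbon n0 w1 mirror w0); split; first exact: core_represents.
rewrite /ribbonlength /= -/l invfM invrK mulrA divff ?mul1r //.
by apply: lt0r_neq0; lra.
Qed.
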